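(* Let $r\in S_0=\left\{\frac{2\nu+1}{2j}:\nu,j\in\mathbb{Z},\,j\ne0\right\}\cup\left\{\frac{2j}{2\nu+1}:\nu,j\in\mathbb{Z}\right\}$. Then $\zeta_{r}(z)=\sum_{n=1}^{\infty}e^{i\pi rn^2}n^{-z}$, $\operatorname{Re}z>1$, admits an analytic continuation to $\mathbb{C}\setminus\{1\}$. Furthermore, $\zeta_{r}$ has a simple pole at $z=1$ with residue $\mathfrak{p}_{r}$, and the entire function $$A_{r}(z)=\zeta_{r}(z)-\frac{\mathfrak{p}_{r}}{z-1}$$ can be expressed as the Cesàro limit $$A_{r}(z)= \lim_{x\to\infty}\left( \sum_{1\leq n<x} \frac{ e^{i\pi r n^{2}}}{n^{z}}-\mathfrak{p}_{r}\int_{1}^{x}\frac{d\xi}{\xi^{z}}\right)\quad(\mathrm{C}).$$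
   Context: $S_0$ is the orbit of $0$, $G_\vartheta\cdot0$, restricted to finite points, under the theta group $G_\vartheta$ generated by $K^2:z\mapsto z+2$ and $U:z\mapsto-1/z$. The constants $\mathfrak{p}_r\in\mathbb{C}$, $r\in S_0$, are the ones completely determined by the transformation equations $\mathfrak{p}_0=1$, $\mathfrak{p}_{r+2}=\mathfrak{p}_r$, and $\mathfrak{p}_{-1/r}=\sqrt{-i/r}\;\mathfrak{p}_r$ for $r\neq0$ (principal branch of the square root). For a locally integrable function $F$ on $[1,\infty)$, $\lim_{x\to\infty}F(x)=s$ $(\mathrm{C})$ means that for some integer $k\geq1$, $\lim_{x\to\infty}\frac{k}{x^k}\int_1^x(x-u)^{k-1}F(u)\,du=s$. *)

(* Defs.v *)
From Stdlib Require Import Reals ZArith ClassicalEpsilon.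
From Coquelicot Require Import Coquelicot.

Open Scope R_scope.

(** * The theta group and the orbit of 0 *)

(** The real projective line: [None] is the point at infinity. *)
Definition P1R := option R.

Definition theta_K2 (x : P1R) : P1R :=
  match x with
  | Some r => Some (r + 2)
  | None => None
  end.

Definition theta_U (x : P1R) : P1R :=
  match x with
  | Some r => if Req_EM_T r 0 then None else Some (- / r)
  | None => Some 0
  end.

(** The transformation group generated by [theta_K2] and [theta_U]. *)
Inductive theta_group : (P1R -> P1R) -> Prop :=
| theta_group_K2 : theta_group theta_K2
| theta_group_U : theta_group theta_U
| theta_group_id : theta_group (fun x => x)
| theta_group_comp g h :
    theta_group g -> theta_group h -> theta_group (fun x => g (h x))
| theta_group_inv g h :
    theta_group g ->
    (forall x, h (g x) = x) -> (forall x, g (h x) = x) -> theta_group h.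

Definition S0 (r : R) : Prop :=
  exists g, theta_group g /\ g (Some 0) = Some r.

(** * Complex elementary functions *)

Definition Cexp (z : C) : C := (exp (Re z) * cos (Im z), exp (Re z) * sin (Im z)).

(** [x ^ z = exp (z * ln x)], used only for [x > 0]. *)
Definition RCpow (x : R) (z : C) : C := Cexp (z * RtoC (ln x))%C.

(** Principal square root (argument in (-PI/2, PI/2]), in Cartesian form:
    [Re = sqrt ((|z| + Re z) / 2)], [|Im| = sqrt ((|z| - Re z) / 2)], and the
    imaginary part has the sign of [Im z]. *)
Definition Csqrt (z : C) : C :=
  (sqrt ((Cmod z + Re z) / 2),
   (if Rlt_dec (Im z) 0 then -1 else 1) * sqrt ((Cmod z - Re z) / 2)).

(** * The constants p_r *)

Definition theta_equations (p : R -> C) : Prop :=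
  p 0 = RtoC 1 /\
  (forall r, S0 r -> p (r + 2) = p r) /\
  (forall r, S0 r -> r <> 0 ->
     p (- / r) = (Csqrt (- Ci / RtoC r) * p r)%C).

(** The equations have a solution and determine it on [S0], which is the only
    place where [theta_p] is used; the choice made by [epsilon] therefore only
    concerns the irrelevant values outside [S0]. *)
Definition theta_p : R -> C :=
  epsilon (inhabits (fun _ : R => RtoC 0)) theta_equations.

(** * Holomorphic functions *)

Definition holomorphic_on (D : C -> Prop) (f : C -> C) : Prop :=
  forall z : C, D z -> @ex_derive C_AbsRing C_NormedModule f z.

Definition entire (f : C -> C) : Prop := holomorphic_on (fun _ => True) f.

(** The Laurent expansion of [f] at [a] has principal part [c / (z - a)],
    with [c <> 0]. *)
Definition simple_pole_with_residue (f : C -> C) (a c : C) : Prop :=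
  c <> RtoC 0 /\
  exists g : C -> C,
    @locally C_UniformSpace a
      (fun z => @ex_derive C_AbsRing C_NormedModule g z /\
                (z <> a -> f z = (c / (z - a) + g z)%C)).

(** * The series zeta_r *)

Definition theta_phase (r : R) (n : nat) : C :=
  Cexp (Ci * RtoC (PI * r * INR n ^ 2))%C.

(** Coquelicot's series start at index 0, hence the shift by one. *)
Definition zeta_term (r : R) (z : C) (n : nat) : C :=
  (theta_phase r (S n) * RCpow (INR (S n)) (- z))%C.

(** The sum over [1 <= n < x]; the range up to [up x > x] contains all such [n]. *)
Definition zeta_partial (r : R) (z : C) (x : R) : C :=
  @sum_n_m C_AbelianMonoid
    (fun n => if Rlt_dec (INR n) x
              then (theta_phase r n / RCpow (INR n) z)%C else RtoC 0)
    1 (Z.to_nat (up x)).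

(** * Cesaro limits *)

(** [C] is viewed here as a normed space over [R]; local integrability and
    integrals are in the sense of Riemann. *)
Definition CRInt (f : R -> C) (a b : R) : C :=
  @RInt C_R_CompleteNormedModule f a b.

Definition locally_integrable (F : R -> C) : Prop :=
  forall x, 1 <= x -> @ex_RInt C_R_NormedModule F 1 x.

Definition is_cesaro_lim (F : R -> C) (s : C) : Prop :=
  locally_integrable F /\
  exists k : nat, (1 <= k)%nat /\
    filterlim
      (fun x : R =>
         (RtoC (INR k / x ^ k) *
          CRInt (fun u => RtoC ((x - u) ^ (k - 1)) * F u)%C 1 x)%C)
      (Rbar_locally p_infty) (@locally C_UniformSpace s).

(* Main.v *)
(** Write [f n = exp (i pi r n^2)], a sequence of some period [q], and let [m] be
    its mean over a period.

    The constants: the Gauss means [m] satisfy the transformation equations, the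
    one for [r -> -1/r] being the Landsberg-Schaar reciprocity of quadratic Gauss
    sums; Euclid's algorithm with even quotients shows that these equations have
    at most one solution on [S0], so [m = theta_p r].  For reciprocity, Fourier
    inversion applied to [exp (i pi p t^2 / q)] at [t = 0, ..., q - 1] turns the
    Gauss sum into [sum_n int_{-1/2}^{q-1/2} exp (i pi p t^2 / q - 2 i pi n t) dt];
    completing the square and grouping [n] modulo [p] gives the reciprocal sum
    times a Fresnel integral, whose value is read off the case [p = 1], [q = 2].

    The continuation: choose a bounded periodic [S1], of mean zero, such that
    [S1'' = sum_n f n delta_n - m] on [u >= 0].  Integrating by parts twice against
    [u^(-z)] or against [(x - u)^k u^(-z)] turns the series and its Riesz means into
    boundary terms plus the same kind of means of [int_1^x S1 u u^(-z-2) du].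
    Further integrations by parts, each replacing the periodic function by its
    mean-zero primitive and gaining a factor [1/u], reduce those to an absolutely
    convergent range of [z], where holomorphy in [z] is elementary.  The
    coefficients in the recursion are polynomials in [z], so the Cesaro limits
    exist and are holomorphic on all of [C]. *)

Require Import Defs.
From Stdlib Require Import Reals ZArith Lia Lra ClassicalEpsilon.
From Coquelicot Require Import Coquelicot.

Open Scope R_scope.

(** * The orbit of 0 and uniqueness of the constants *)

(** Two obstacles shape the argument. Pointwise facts are available only where functions are
    regular. This fixes the Fourier window [[-1/2, q - 1/2]]: every integer is then interior to a
    unit interval, so inversion takes place at a point of differentiability and no average of end
    values appears. It also explains the second primitive: a first primitive of the point masses
    minus their mean jumps at the integers, whereas [S1] is continuous and all its further
    primitives are differentiable everywhere, so classical integration by parts applies.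

    No single Cesàro order serves all [z]: a step to the left by one unit costs one order. A
    regularised integral must therefore not depend on the order, and it is defined by asking for the
    same limit at every sufficiently large order. The Riesz weight then does double duty: its zero
    at the upper limit kills the boundary terms there, and those at 1 are explicit. What is left is
    the formula [A z = - z * Q1 - dQ1 + z * (z + 1) * reg_int S1 (z + 2)], with [Q1] and [dQ1] the
    value and slope at 1 of the quadratic part of [S1]. *)

Definition parity_rational (r : R) : Prop :=
  exists p q : Z, (0 < q)%Z /\ Z.odd (p + q) = true /\ r = IZR p / IZR q.

Lemma parity_rational_0 : parity_rational 0.
Proof. exists 0%Z, 1%Z. repeat split; try lia. simpl. field. Qed.

Lemma parity_rational_shift (r : R) (k : Z) :
  parity_rational r -> parity_rational (r + 2 * IZR k).
Proof.
  intros (p & q & Hq & Ho & ->). exists (p + 2 * k * q)%Z, q.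
  split; [easy|]. split.
  - replace (p + 2 * k * q + q)%Z with (p + q + 2 * (k * q))%Z by ring.
    now rewrite Z.odd_add_mul_2.
  - rewrite plus_IZR, !mult_IZR. field. apply IZR_lt in Hq. lra.
Qed.

Lemma parity_rational_inv (r : R) :
  r <> 0 -> parity_rational r -> parity_rational (- / r).
Proof.
  intros Hr (p & q & Hq & Ho & ->).
  assert (Hq' := IZR_lt _ _ Hq).
  assert (Hp : p <> 0%Z) by (intros ->; apply Hr; field; lra).
  assert (Hp' : IZR p <> 0) by (intros H; apply Hp, eq_IZR, H).
  destruct (Z_lt_le_dec 0 p) as [Hp0 | Hp0].
  - exists (- q)%Z, p. split; [easy|]. split.
    + replace (- q + p)%Z with (p + q + 2 * (- q))%Z by ring.
      now rewrite Z.odd_add_mul_2.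
    + rewrite opp_IZR. field. lra.
  - exists q, (- p)%Z. split; [lia|]. split.
    + replace (q + - p)%Z with (p + q + 2 * (- p))%Z by ring.
      now rewrite Z.odd_add_mul_2.
    + rewrite opp_IZR. field. lra.
Qed.

(** Euclid's algorithm with even quotients: subtracting a multiple of [2 q]
    brings the numerator into [(-q, q)], the bounds being excluded by parity. *)
Lemma parity_rational_ind (P : R -> Prop) :
  P 0 ->
  (forall r, parity_rational r -> P r -> P (r + 2)) ->
  (forall r, parity_rational r -> P r -> P (r - 2)) ->
  (forall r, parity_rational r -> r <> 0 -> P r -> P (- / r)) ->
  forall r, parity_rational r -> P r.
Proof.
  intros H0 Hp Hm Hi.
  assert (Hshift : forall r, parity_rational r -> P r ->
                     forall k : Z, P (r + 2 * IZR k)).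
  { intros r Hr HP.
    assert (Hnat : forall n : nat, P (r + 2 * IZR (Z.of_nat n)) /\
                                   P (r + 2 * IZR (- Z.of_nat n))).
    { induction n as [|n [IH1 IH2]].
      - simpl. now rewrite Rmult_0_r, Rplus_0_r.
      - rewrite Nat2Z.inj_succ, opp_IZR, succ_IZR. split.
        + replace (r + 2 * (IZR (Z.of_nat n) + 1))
            with (r + 2 * IZR (Z.of_nat n) + 2) by ring.
          apply Hp; [now apply parity_rational_shift | easy].
        + rewrite opp_IZR in IH2.
          replace (r + 2 * - (IZR (Z.of_nat n) + 1))
            with (r + 2 * - IZR (Z.of_nat n) - 2) by ring.
          apply Hm; [|easy].
          rewrite <- opp_IZR. now apply parity_rational_shift. }
    intros k. destruct (Z_le_gt_dec 0 k) as [Hk | Hk].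
    - rewrite <- (Z2Nat.id k) by lia. apply Hnat.
    - replace k with (- Z.of_nat (Z.to_nat (- k)))%Z by lia. apply Hnat. }
  assert (Hall : forall n : nat, forall p q : Z, (0 < q <= Z.of_nat n)%Z ->
            Z.odd (p + q) = true -> P (IZR p / IZR q)).
  { induction n as [|n IH]; intros p q Hq Ho; [lia|].
    assert (Hq' : 0 < IZR q) by (apply IZR_lt; lia).
    (* Dividing [p + q] instead of [p] centres the remainder at 0. *)
    set (k := ((p + q) / (2 * q))%Z).
    set (p' := (p - 2 * k * q)%Z).
    assert (Hk : (- q <= p' < q)%Z).
    { assert (H1 := Z.div_mod (p + q) (2 * q) ltac:(lia)).
      assert (H2 := Z.mod_pos_bound (p + q) (2 * q) ltac:(lia)).
      fold k in H1. unfold p'. nia. }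
    assert (Ho' : Z.odd (p' + q) = true).
    { unfold p'. replace (p - 2 * k * q + q)%Z with (p + q + 2 * (- (k * q)))%Z
        by ring. now rewrite Z.odd_add_mul_2. }
    assert (Hne : p' <> (- q)%Z).
    { intros E. rewrite E in Ho'. now rewrite Z.add_opp_diag_l in Ho'. }
    replace (IZR p / IZR q) with (IZR p' / IZR q + 2 * IZR k).
    2:{ unfold p'. rewrite minus_IZR, !mult_IZR. field. lra. }
    assert (Hpar : parity_rational (IZR p' / IZR q))
      by (exists p', q; repeat split; lia || easy).
    apply Hshift; [easy|].
    destruct (Z.eq_dec p' 0) as [E | Hp0].
    { rewrite E. unfold Rdiv. now rewrite Rmult_0_l. }
    assert (Hp0' : IZR p' <> 0) by (intros H; apply Hp0, eq_IZR, H).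
    (* The inverted fraction has denominator [|p'| < q], which is what the induction on the
       denominator consumes. *)
    replace (IZR p' / IZR q) with (- / (- / (IZR p' / IZR q))) by (field; lra).
    assert (Hr0 : IZR p' / IZR q <> 0).
    { apply Rmult_integral_contrapositive. split; [easy|].
      apply Rinv_neq_0_compat. lra. }
    apply Hi.
    - now apply parity_rational_inv.
    - apply Ropp_neq_0_compat. now apply Rinv_neq_0_compat.
    - destruct (Z_lt_le_dec 0 p') as [Hlt | Hle].
      + replace (- / (IZR p' / IZR q)) with (IZR (- q) / IZR p').
        2:{ rewrite opp_IZR. field. lra. }
        apply IH; [lia|].
        replace (- q + p')%Z with (p' + q + 2 * (- q))%Z by ring.
        now rewrite Z.odd_add_mul_2.
      + replace (- / (IZR p' / IZR q)) with (IZR q / IZR (- p')).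
        2:{ rewrite opp_IZR. field. lra. }
        apply IH; [lia|].
        replace (q + - p')%Z with (p' + q + 2 * (- p'))%Z by ring.
        now rewrite Z.odd_add_mul_2. }
  intros r (p & q & Hq & Ho & ->).
  apply (Hall (Z.to_nat q)); [lia | easy].
Qed.

(** Infinity is the fraction 1/0, of opposite parity like 0/1, with which [theta_U] exchanges it. *)
Definition extended_parity_rational (x : P1R) : Prop :=
  match x with Some r => parity_rational r | None => True end.

(** An equivalence, since one implication for [g] would say nothing about its inverse; with both
    directions that case is a rewriting. *)
Lemma theta_group_parity (g : P1R -> P1R) :
  theta_group g ->
  forall x, extended_parity_rational (g x) <-> extended_parity_rational x.
Proof.
  induction 1 as [ | | | g h _ IHg _ IHh | g h _ IHg Hhg Hgh ]; intros x.
  - destruct x as [r|]; simpl; [|easy]. split; intros H.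
    + replace r with (r + 2 + 2 * IZR (-1)) by (simpl; lra).
      now apply parity_rational_shift.
    + replace (r + 2) with (r + 2 * IZR 1) by (simpl; lra).
      now apply parity_rational_shift.
  - destruct x as [r|]; simpl.
    + destruct (Req_EM_T r 0) as [-> | Hr]; simpl.
      * split; intros; [apply parity_rational_0 | easy].
      * split; intros H; [|now apply parity_rational_inv].
        replace r with (- / (- / r)) by (field; easy).
        apply parity_rational_inv; [|easy].
        apply Ropp_neq_0_compat. now apply Rinv_neq_0_compat.
    + split; intros; [easy | apply parity_rational_0].
  - easy.
  - now rewrite IHg, IHh.
  - now rewrite <- (IHg (h x)), Hgh.
Qed.

Lemma theta_group_K2_inv :
  theta_group (fun x : P1R => match x with Some r => Some (r - 2) | None => None end).
Proof.
  apply (theta_group_inv theta_K2); [constructor | |];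
    intros [r|]; simpl; try easy; f_equal; lra.
Qed.

(** One inclusion is invariance of parity; for the other, each move of Euclid's algorithm is
    composition with a generator or its inverse. *)
Lemma S0_iff_parity_rational (r : R) : S0 r <-> parity_rational r.
Proof.
  split.
  - intros (g & Hg & E).
    change (extended_parity_rational (Some r)). rewrite <- E.
    rewrite theta_group_parity by easy. apply parity_rational_0.
  - revert r. apply parity_rational_ind.
    + exists (fun x => x). split; [constructor | easy].
    + intros r _ (g & Hg & E). exists (fun x => theta_K2 (g x)).
      split; [now constructor; [constructor|] | now rewrite E].
    + intros r _ (g & Hg & E). eexists.
      split; [apply (theta_group_comp _ g theta_group_K2_inv Hg)|].
      simpl. now rewrite E.
    + intros r _ Hr (g & Hg & E). exists (fun x => theta_U (g x)).
      split; [now constructor; [constructor|]|].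
      rewrite E. simpl. now destruct (Req_EM_T r 0).
Qed.

Lemma parity_rational_iff (r : R) :
  parity_rational r <->
  ((exists nu j : Z, j <> 0%Z /\ r = IZR (2 * nu + 1) / IZR (2 * j)) \/
   (exists nu j : Z, r = IZR (2 * j) / IZR (2 * nu + 1))).
Proof.
  assert (sgn : forall p q : Z, q <> 0%Z -> Z.odd (p + q) = true ->
            parity_rational (IZR p / IZR q)).
  { intros p q Hq Ho.
    assert (Hq' : IZR q <> 0) by (intros H; apply Hq, eq_IZR, H).
    destruct (Z_lt_le_dec 0 q).
    - now exists p, q.
    - exists (- p)%Z, (- q)%Z. split; [lia|]. split.
      + replace (- p + - q)%Z with (p + q + 2 * (- p - q))%Z by ring.
        now rewrite Z.odd_add_mul_2.
      + rewrite !opp_IZR. field. lra. }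
  split.
  - intros (p & q & Hq & Ho & ->).
    destruct (Z.Even_or_Odd p) as [[j ->] | [nu ->]];
      destruct (Z.Even_or_Odd q) as [[k ->] | [l ->]].
    + exfalso. replace (2 * j + 2 * k)%Z with (0 + 2 * (j + k))%Z in Ho by ring.
      now rewrite Z.odd_add_mul_2 in Ho.
    + right. now exists l, j.
    + left. exists nu, k. split; [lia | easy].
    + exfalso. replace (2 * nu + 1 + (2 * l + 1))%Z with (0 + 2 * (nu + l + 1))%Z
        in Ho by ring.
      now rewrite Z.odd_add_mul_2 in Ho.
  - intros [(nu & j & Hj & ->) | (nu & j & ->)]; apply sgn; try lia.
    + replace (2 * nu + 1 + 2 * j)%Z with (1 + 2 * (nu + j))%Z by ring.
      now rewrite Z.odd_add_mul_2.
    + replace (2 * j + (2 * nu + 1))%Z with (1 + 2 * (nu + j))%Z by ring.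
      now rewrite Z.odd_add_mul_2.
Qed.

Lemma Csqrt_neq_0 (z : C) : z <> 0 -> Csqrt z <> 0.
Proof.
  intros Hz E. injection E as E1 E2.
  assert (Hm := proj1 (Cmod_gt_0 z) Hz).
  assert (Hre := re_le_Cmod z). apply Rabs_le_between in Hre.
  apply sqrt_eq_0 in E1; [|lra].
  assert (E3 : sqrt ((Cmod z - Re z) / 2) = 0)
    by (destruct (Rlt_dec (Im z) 0); lra).
  apply sqrt_eq_0 in E3; lra.
Qed.

(** The equations multiply by nonzero factors only, starting from 1. This makes the pole at 1 a
    genuine one. *)
Lemma theta_equations_neq_0 (p : R -> C) :
  theta_equations p -> forall r, S0 r -> p r <> 0.
Proof.
  intros (E0 & E2 & EU) r Hr. apply S0_iff_parity_rational in Hr. revert r Hr.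
  apply parity_rational_ind.
  - rewrite E0. intros H. injection H. lra.
  - intros r Hr IH. rewrite E2; [easy|]. now apply S0_iff_parity_rational.
  - intros r Hr IH. rewrite <- E2; [now replace (r - 2 + 2) with r by ring|].
    apply S0_iff_parity_rational. replace (r - 2) with (r + 2 * IZR (-1)) by (simpl; ring).
    now apply parity_rational_shift.
  - intros r Hr H0 IH. rewrite EU by (easy || now apply S0_iff_parity_rational).
    apply Cmult_neq_0; [|easy]. apply Csqrt_neq_0.
    intros E. apply (f_equal Cmod) in E.
    rewrite Cmod_div, Cmod_opp, Cmod_Ci, Cmod_R, Cmod_0 in E
      by (intros H; now injection H).
    assert (H := Rabs_pos_lt r H0). apply Rinv_0_lt_compat in H.
    unfold Rdiv in E. lra.
Qed.

Lemma theta_equations_unique (p p' : R -> C) :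
  theta_equations p -> theta_equations p' -> forall r, S0 r -> p r = p' r.
Proof.
  intros (E0 & E2 & EU) (E0' & E2' & EU') r Hr.
  apply S0_iff_parity_rational in Hr. revert r Hr. apply parity_rational_ind.
  - now rewrite E0, E0'.
  - intros r Hr IH. apply S0_iff_parity_rational in Hr. now rewrite E2, E2'.
  - intros r Hr IH.
    assert (Hr' : S0 (r - 2)).
    { apply S0_iff_parity_rational.
      replace (r - 2) with (r + 2 * IZR (-1)) by (simpl; ring).
      now apply parity_rational_shift. }
    rewrite <- E2, <- E2' by easy. now replace (r - 2 + 2) with r by ring.
  - intros r Hr H0 IH. apply S0_iff_parity_rational in Hr.
    now rewrite EU, EU', IH.
Qed.

(** * Calculus of complex-valued functions of a real variable *)

Notation is_derC := (@is_derive R_AbsRing C_R_NormedModule).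
Notation contC := (@continuous R_UniformSpace C_UniformSpace).
Notation is_intC := (@is_RInt C_R_NormedModule).
Notation ex_intC := (@ex_RInt C_R_NormedModule).

Ltac Rring := match goal with |- @eq _ ?a ?b => change (@eq R a b); unfold minus, scal, mult, plus, opp; simpl;
  unfold mult, plus, opp; simpl; ring end.

Lemma C_ext (z w : C) : Re z = Re w -> Im z = Im w -> z = w.
Proof. destruct z, w; simpl; congruence. Qed.

Lemma scal_R_C (r : R) (z : C) :
  @scal R_AbsRing C_R_NormedModule r z = (RtoC r * z)%C.
Proof. destruct z. apply C_ext; simpl; unfold scal; simpl; unfold mult; simpl; Rring. Qed.

Lemma norm_C_R (z : C) : @norm R_AbsRing C_R_NormedModule z = Cmod z.
Proof. now rewrite Cmod_norm. Qed.

Lemma is_derC_intro (f : R -> C) (x : R) (l : C) :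
  is_derive (fun t => Re (f t)) x (Re l) -> is_derive (fun t => Im (f t)) x (Im l) ->
  is_derC f x l.
Proof.
  intros H1 H2.
  assert (H : is_derC (fun t => plus (@scal R_AbsRing C_R_NormedModule (Re (f t)) (RtoC 1))
                      (@scal R_AbsRing C_R_NormedModule (Im (f t)) Ci)) x
      (plus (@scal R_AbsRing C_R_NormedModule (Re l) (RtoC 1))
            (@scal R_AbsRing C_R_NormedModule (Im l) Ci))).
  { apply @is_derive_plus; now apply (@is_derive_scal_l R_AbsRing C_R_NormedModule). }
  replace l with (plus (@scal R_AbsRing C_R_NormedModule (Re l) (RtoC 1))
            (@scal R_AbsRing C_R_NormedModule (Im l) Ci)).
  2:{ rewrite !scal_R_C. destruct l; apply C_ext; simpl; Rring. }
  revert H. apply is_derive_ext.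
  intros t. rewrite !scal_R_C. apply C_ext; simpl; Rring.
Qed.

Lemma is_derC_Re (f : R -> C) (x : R) (l : C) :
  is_derC f x l -> is_derive (fun t => Re (f t)) x (Re l).
Proof.
  intros H.
  refine (filterdiff_comp _ _ _ _ H
    (filterdiff_linear _ (@is_linear_fst R_AbsRing R_NormedModule R_NormedModule))).
Qed.

Lemma is_derC_Im (f : R -> C) (x : R) (l : C) :
  is_derC f x l -> is_derive (fun t => Im (f t)) x (Im l).
Proof.
  intros H.
  refine (filterdiff_comp _ _ _ _ H
    (filterdiff_linear _ (@is_linear_snd R_AbsRing R_NormedModule R_NormedModule))).
Qed.

Lemma is_derC_eq (f : R -> C) (x : R) (l l' : C) :
  is_derC f x l -> l = l' -> is_derC f x l'.
Proof. now intros H <-. Qed.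

Lemma is_derC_const (c : C) (x : R) : is_derC (fun _ => c) x (RtoC 0).
Proof. exact (@is_derive_const R_AbsRing C_R_NormedModule c x). Qed.

Lemma is_derC_plus (f g : R -> C) (x : R) (a b : C) :
  is_derC f x a -> is_derC g x b -> is_derC (fun t => f t + g t)%C x (a + b)%C.
Proof. exact (@is_derive_plus R_AbsRing C_R_NormedModule f g x a b). Qed.

Lemma is_derC_minus (f g : R -> C) (x : R) (a b : C) :
  is_derC f x a -> is_derC g x b -> is_derC (fun t => f t - g t)%C x (a - b)%C.
Proof. exact (@is_derive_minus R_AbsRing C_R_NormedModule f g x a b). Qed.

Lemma is_derC_mult (f g : R -> C) (x : R) (a b : C) :
  is_derC f x a -> is_derC g x b ->
  is_derC (fun t => f t * g t)%C x (a * g x + f x * b)%C.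
Proof.
  intros Hf Hg.
  assert (Hf1 := is_derC_Re _ _ _ Hf). assert (Hf2 := is_derC_Im _ _ _ Hf).
  assert (Hg1 := is_derC_Re _ _ _ Hg). assert (Hg2 := is_derC_Im _ _ _ Hg).
  assert (M : forall u v u' v', is_derive u x u' -> is_derive v x v' ->
      is_derive (fun t : R => u t * v t) x (u' * v x + u x * v')).
  { intros u v u' v' Hu Hv.
    exact (is_derive_mult (K := R_AbsRing) u v x u' v' Hu Hv Rmult_comm). }
  apply is_derC_intro.
  - replace (Re (a * g x + f x * b)) with
      ((Re a * Re (g x) + Re (f x) * Re b) - (Im a * Im (g x) + Im (f x) * Im b))
      by (simpl; unfold Re, Im; ring).
    exact (is_derive_minus (V := R_NormedModule) _ _ x _ _
             (M _ _ _ _ Hf1 Hg1) (M _ _ _ _ Hf2 Hg2)).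
  - replace (Im (a * g x + f x * b)) with
      ((Re a * Im (g x) + Re (f x) * Im b) + (Im a * Re (g x) + Im (f x) * Re b))
      by (simpl; unfold Re, Im; ring).
    exact (is_derive_plus (V := R_NormedModule) _ _ x _ _
             (M _ _ _ _ Hf1 Hg2) (M _ _ _ _ Hf2 Hg1)).
Qed.

Lemma is_derC_RtoC (f : R -> R) (x l : R) :
  is_derive f x l -> is_derC (fun t => RtoC (f t)) x (RtoC l).
Proof.
  intros H. apply is_derC_intro; simpl; [exact H|].
  exact (@is_derive_const R_AbsRing R_NormedModule 0 x).
Qed.

Lemma is_derC_scal (c : C) (f : R -> C) (x : R) (a : C) :
  is_derC f x a -> is_derC (fun t => c * f t)%C x (c * a)%C.
Proof.
  intros H. eapply is_derC_eq; [apply (is_derC_mult _ _ _ _ _ (is_derC_const c x) H)|].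
  ring.
Qed.

Lemma is_derC_contC (f : R -> C) (x : R) (l : C) : is_derC f x l -> contC f x.
Proof. intros H. apply (@ex_derive_continuous R_AbsRing C_R_NormedModule). now exists l. Qed.

Lemma contC_intro (f : R -> C) (x : R) :
  continuous (fun t => Re (f t)) x -> continuous (fun t => Im (f t)) x -> contC f x.
Proof.
  intros H1 H2.
  apply (continuous_ext (fun t => (Re (f t), Im (f t)))); [now intros t; destruct (f t)|].
  unfold continuous. simpl.
  apply (filterlim_filter_le_2 (F := locally x)
    (G := filter_prod (locally (Re (f x))) (locally (Im (f x))))).
  - intros P [eps HP]. exists (fun u => ball (Re (f x)) eps u) (fun u => ball (Im (f x)) eps u).
    + apply locally_ball.
    + apply locally_ball.
    + intros u v Hu Hv. apply HP. now split.
  - apply filterlim_pair; [exact H1 | exact H2].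
Qed.

Lemma contC_Re (f : R -> C) (x : R) : contC f x -> continuous (fun t => Re (f t)) x.
Proof.
  intros H.
  exact (continuous_comp f (@fst R R) x H
    (continuous_fst (U := R_UniformSpace) (V := R_UniformSpace) (Re (f x)) (Im (f x)))).
Qed.

Lemma contC_Im (f : R -> C) (x : R) : contC f x -> continuous (fun t => Im (f t)) x.
Proof.
  intros H.
  exact (continuous_comp f (@snd R R) x H
    (continuous_snd (U := R_UniformSpace) (V := R_UniformSpace) (Re (f x)) (Im (f x)))).
Qed.

Lemma contC_const (c : C) (x : R) : contC (fun _ => c) x.
Proof. apply continuous_const. Qed.

Lemma contC_plus (f g : R -> C) (x : R) :
  contC f x -> contC g x -> contC (fun t => f t + g t)%C x.
Proof. exact (continuous_plus (V := C_R_NormedModule) f g x). Qed.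

Lemma contC_opp (f : R -> C) (x : R) : contC f x -> contC (fun t => - f t)%C x.
Proof. exact (continuous_opp (V := C_R_NormedModule) f x). Qed.

Lemma contC_minus (f g : R -> C) (x : R) :
  contC f x -> contC g x -> contC (fun t => f t - g t)%C x.
Proof. exact (continuous_minus (V := C_R_NormedModule) f g x). Qed.

Lemma contC_mult (f g : R -> C) (x : R) :
  contC f x -> contC g x -> contC (fun t => f t * g t)%C x.
Proof.
  intros Hf Hg.
  assert (Hf1 := contC_Re _ _ Hf). assert (Hf2 := contC_Im _ _ Hf).
  assert (Hg1 := contC_Re _ _ Hg). assert (Hg2 := contC_Im _ _ Hg).
  assert (M : forall u v : R -> R, continuous u x -> continuous v x ->
      continuous (fun t => u t * v t) x).
  { intros u v Hu Hv. exact (continuous_mult (K := R_AbsRing) u v x Hu Hv). }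
  apply contC_intro.
  - exact (continuous_minus (V := R_NormedModule) _ _ x (M _ _ Hf1 Hg1) (M _ _ Hf2 Hg2)).
  - exact (continuous_plus (V := R_NormedModule) _ _ x (M _ _ Hf1 Hg2) (M _ _ Hf2 Hg1)).
Qed.

Lemma contC_RtoC (f : R -> R) (x : R) : continuous f x -> contC (fun t => RtoC (f t)) x.
Proof. intros H. apply contC_intro; simpl; [exact H | apply continuous_const]. Qed.

Lemma is_intC_intro (f : R -> C) (a b : R) (l : C) :
  is_RInt (fun t => Re (f t)) a b (Re l) -> is_RInt (fun t => Im (f t)) a b (Im l) ->
  is_intC f a b l.
Proof.
  intros H1 H2. destruct l as [l1 l2].
  exact (@is_RInt_fct_extend_pair R_NormedModule R_NormedModule f a b l1 l2 H1 H2).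
Qed.

Lemma is_intC_Re (f : R -> C) (a b : R) (l : C) :
  is_intC f a b l -> is_RInt (fun t => Re (f t)) a b (Re l).
Proof. exact (@is_RInt_fct_extend_fst R_NormedModule R_NormedModule f a b l). Qed.

Lemma is_intC_Im (f : R -> C) (a b : R) (l : C) :
  is_intC f a b l -> is_RInt (fun t => Im (f t)) a b (Im l).
Proof. exact (@is_RInt_fct_extend_snd R_NormedModule R_NormedModule f a b l). Qed.

Lemma is_intC_plus (f g : R -> C) (a b : R) (l m : C) :
  is_intC f a b l -> is_intC g a b m -> is_intC (fun t => f t + g t)%C a b (l + m)%C.
Proof. exact (@is_RInt_plus C_R_NormedModule f g a b l m). Qed.

Lemma is_intC_minus (f g : R -> C) (a b : R) (l m : C) :
  is_intC f a b l -> is_intC g a b m -> is_intC (fun t => f t - g t)%C a b (l - m)%C.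
Proof. exact (@is_RInt_minus C_R_NormedModule f g a b l m). Qed.

Lemma is_intC_scal (c : C) (f : R -> C) (a b : R) (l : C) :
  is_intC f a b l -> is_intC (fun t => c * f t)%C a b (c * l)%C.
Proof.
  intros H. assert (H1 := is_intC_Re _ _ _ _ H). assert (H2 := is_intC_Im _ _ _ _ H).
  assert (S : forall (k : R) (u : R -> R) (m : R), is_RInt u a b m ->
            is_RInt (fun t => k * u t) a b (k * m)).
  { intros k u m Hu. exact (@is_RInt_scal R_NormedModule u a b k m Hu). }
  apply is_intC_intro.
  - exact (@is_RInt_minus R_NormedModule _ _ a b _ _ (S (Re c) _ _ H1) (S (Im c) _ _ H2)).
  - exact (@is_RInt_plus R_NormedModule _ _ a b _ _ (S (Re c) _ _ H2) (S (Im c) _ _ H1)).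
Qed.

Lemma is_intC_const (c : C) (a b : R) : is_intC (fun _ => c) a b (RtoC (b - a) * c)%C.
Proof. rewrite <- scal_R_C. apply @is_RInt_const. Qed.

Lemma is_intC_ext (f g : R -> C) (a b : R) (l : C) :
  (forall x, Rmin a b < x < Rmax a b -> f x = g x) -> is_intC f a b l -> is_intC g a b l.
Proof. apply @is_RInt_ext. Qed.

Lemma is_intC_eq (f : R -> C) (a b : R) (l l' : C) :
  is_intC f a b l -> l = l' -> is_intC f a b l'.
Proof. now intros H <-. Qed.

Lemma is_intC_CRInt (f : R -> C) (a b : R) (l : C) : is_intC f a b l -> CRInt f a b = l.
Proof. apply (@is_RInt_unique C_R_CompleteNormedModule). Qed.

Lemma CRInt_correct (f : R -> C) (a b : R) : ex_intC f a b -> is_intC f a b (CRInt f a b).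
Proof. apply (@RInt_correct C_R_CompleteNormedModule). Qed.

Lemma ex_intC_cont (f : R -> C) (a b : R) :
  (forall x, Rmin a b <= x <= Rmax a b -> contC f x) -> ex_intC f a b.
Proof. apply (@ex_RInt_continuous C_R_CompleteNormedModule). Qed.

Lemma is_intC_cont (f : R -> C) (a b : R) :
  (forall x, Rmin a b <= x <= Rmax a b -> contC f x) -> is_intC f a b (CRInt f a b).
Proof. intros H. now apply CRInt_correct, ex_intC_cont. Qed.

Lemma is_intC_bound (f : R -> C) (g : R -> R) (a b : R) (l : C) (m : R) :
  a <= b -> (forall x, a <= x <= b -> Cmod (f x) <= g x) ->
  is_intC f a b l -> is_RInt g a b m -> Cmod l <= m.
Proof.
  intros Hab Hb Hf Hg. rewrite <- norm_C_R.
  apply (@norm_RInt_le C_R_NormedModule f g a b l m); try easy.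
  intros x Hx. rewrite norm_C_R. now apply Hb.
Qed.

Lemma is_intC_bound_const (f : R -> C) (a b : R) (l : C) (m : R) :
  a <= b -> (forall x, a <= x <= b -> Cmod (f x) <= m) ->
  is_intC f a b l -> Cmod l <= (b - a) * m.
Proof.
  intros Hab Hb Hf. apply (is_intC_bound f (fun _ => m) a b); try easy.
  exact (@is_RInt_const R_NormedModule a b m).
Qed.

Lemma is_intC_derive (f df : R -> C) (a b : R) :
  (forall x, Rmin a b <= x <= Rmax a b -> is_derC f x (df x)) ->
  (forall x, Rmin a b <= x <= Rmax a b -> contC df x) ->
  is_intC df a b (f b - f a)%C.
Proof. exact (@is_RInt_derive C_R_CompleteNormedModule f df a b). Qed.

Lemma is_intC_by_parts (f df g dg : R -> C) (a b : R) (l : C) :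
  (forall x, Rmin a b <= x <= Rmax a b -> is_derC f x (df x)) ->
  (forall x, Rmin a b <= x <= Rmax a b -> is_derC g x (dg x)) ->
  (forall x, Rmin a b <= x <= Rmax a b -> contC df x) ->
  (forall x, Rmin a b <= x <= Rmax a b -> contC dg x) ->
  is_intC (fun t => f t * dg t)%C a b l ->
  is_intC (fun t => df t * g t)%C a b (f b * g b - f a * g a - l)%C.
Proof.
  intros Hf Hg Hdf Hdg Hl.
  assert (H : is_intC (fun t => df t * g t + f t * dg t)%C a b (f b * g b - f a * g a)%C).
  { apply (is_intC_derive (fun t => f t * g t)%C).
    - intros x Hx. apply is_derC_mult; auto.
    - intros x Hx. apply contC_plus; apply contC_mult; auto.
      + eapply is_derC_contC; eauto.
      + eapply is_derC_contC; eauto. }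
  eapply is_intC_ext; [|exact (is_intC_minus _ _ _ _ _ _ H Hl)].
  intros x _. simpl. ring.
Qed.

Lemma is_intC_shift (f : R -> C) (c a b : R) (l : C) :
  is_intC f (a + c) (b + c) l -> is_intC (fun t => f (t + c)) a b l.
Proof.
  intros H.
  assert (H' := @is_RInt_comp_lin C_R_NormedModule f 1 c a b l).
  rewrite !Rmult_1_l in H'. specialize (H' H).
  eapply is_intC_ext; [|exact H'].
  intros x _. simpl. rewrite scal_R_C, Rmult_1_l. ring.
Qed.

(** * The complex exponential and powers of a positive base *)

Lemma Cexp_plus (z w : C) : Cexp (z + w) = (Cexp z * Cexp w)%C.
Proof.
  unfold Cexp. destruct z as [a b], w as [c d]. simpl.
  rewrite exp_plus, cos_plus, sin_plus. apply C_ext; simpl; ring.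
Qed.

Lemma Cexp_0 : Cexp 0 = 1.
Proof. unfold Cexp. simpl. rewrite exp_0, cos_0, sin_0. apply C_ext; simpl; ring. Qed.

Lemma Cmod_Cexp (z : C) : Cmod (Cexp z) = exp (Re z).
Proof.
  unfold Cexp, Cmod. simpl.
  replace (_ + _) with ((exp (Re z))²).
  - apply sqrt_Rsqr, Rlt_le, exp_pos.
  - assert (H := sin2_cos2 (Im z)). unfold Rsqr in *.
    transitivity (exp (Re z) * exp (Re z) * (sin (Im z) * sin (Im z) + cos (Im z) * cos (Im z))).
    + rewrite H. ring.
    + ring.
Qed.

Lemma Cexp_neq_0 (z : C) : Cexp z <> 0.
Proof.
  intros H. assert (H' := Cmod_Cexp z). rewrite H, Cmod_0 in H'.
  assert (H1 := exp_pos (Re z)). lra.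
Qed.

Lemma Cexp_opp (z : C) : Cexp (- z) = (/ Cexp z)%C.
Proof.
  assert (H : (Cexp z * Cexp (- z))%C = 1).
  { rewrite <- Cexp_plus, <- Cexp_0. f_equal. ring. }
  rewrite <- (Cmult_1_r (/ Cexp z)), <- H. field. apply Cexp_neq_0.
Qed.

Lemma is_derC_Cexp (f : R -> C) (x : R) (l : C) :
  is_derC f x l -> is_derC (fun t => Cexp (f t)) x (l * Cexp (f x))%C.
Proof.
  intros H. assert (H1 := is_derC_Re _ _ _ H). assert (H2 := is_derC_Im _ _ _ H).
  set (u := fun t => Re (f t)) in *. set (v := fun t => Im (f t)) in *.
  assert (E1 : Derive u x = Re l) by now apply is_derive_unique.
  assert (E2 : Derive v x = Im l) by now apply is_derive_unique.
  assert (D1 : ex_derive u x) by now exists (Re l).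
  assert (D2 : ex_derive v x) by now exists (Im l).
  apply is_derC_intro.
  - change (is_derive (fun t => exp (u t) * cos (v t)) x
      (Re l * (exp (u x) * cos (v x)) - Im l * (exp (u x) * sin (v x)))).
    auto_derive; [easy|].
    change (fun x0 : R => u x0) with u. change (fun x0 : R => v x0) with v.
    rewrite E1, E2. ring.
  - change (is_derive (fun t => exp (u t) * sin (v t)) x
      (Re l * (exp (u x) * sin (v x)) + Im l * (exp (u x) * cos (v x)))).
    auto_derive; [easy|].
    change (fun x0 : R => u x0) with u. change (fun x0 : R => v x0) with v.
    rewrite E1, E2. ring.
Qed.

Lemma RCpow_plus (u : R) (z w : C) : RCpow u (z + w) = (RCpow u z * RCpow u w)%C.
Proof. unfold RCpow. rewrite <- Cexp_plus. f_equal. ring. Qed.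

Lemma RCpow_opp (u : R) (z : C) : RCpow u (- z) = (/ RCpow u z)%C.
Proof. unfold RCpow. rewrite <- Cexp_opp. f_equal. ring. Qed.

Lemma RCpow_1_l (z : C) : RCpow 1 z = 1.
Proof. unfold RCpow. rewrite ln_1, Cmult_0_r. apply Cexp_0. Qed.

Lemma RCpow_1_r (u : R) : 0 < u -> RCpow u 1 = u.
Proof.
  intros H. unfold RCpow, Cexp. simpl.
  replace (1 * ln u - 0 * 0) with (ln u) by ring.
  replace (1 * 0 + 0 * ln u) with 0 by ring.
  rewrite exp_ln, cos_0, sin_0 by easy. apply C_ext; simpl; ring.
Qed.

Lemma Cmod_RCpow (u : R) (z : C) : Cmod (RCpow u z) = exp (Re z * ln u).
Proof. unfold RCpow. rewrite Cmod_Cexp. f_equal. unfold Re. simpl. ring. Qed.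

Lemma is_derC_RCpow (z : C) (u : R) :
  0 < u -> is_derC (fun t => RCpow t z) u (z * RCpow u (z - 1))%C.
Proof.
  intros H. eapply is_derC_eq.
  - unfold RCpow. apply is_derC_Cexp, is_derC_scal, is_derC_RtoC.
    apply is_derive_Reals, derivable_pt_lim_ln, H.
  - unfold Cminus. rewrite RCpow_plus, RCpow_opp, RCpow_1_r by easy.
    unfold RCpow. rewrite RtoC_inv by lra. ring.
Qed.

Lemma contC_RCpow (z : C) (u : R) : 0 < u -> contC (fun t => RCpow t z) u.
Proof. intros H. eapply is_derC_contC. now apply is_derC_RCpow. Qed.

(** * Finite sums and limits *)

Fixpoint csum (f : nat -> C) (n : nat) : C :=
  match n with
  | O => RtoC 0
  | S m => (csum f m + f m)%C
  end.

Lemma csum_ext (f g : nat -> C) (n : nat) :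
  (forall i, (i < n)%nat -> f i = g i) -> csum f n = csum g n.
Proof.
  induction n as [|n IH]; intros H; [easy|]. simpl.
  rewrite IH, H; [easy | lia | intros; apply H; lia].
Qed.

Lemma csum_plus (f g : nat -> C) (n : nat) :
  csum (fun i => f i + g i)%C n = (csum f n + csum g n)%C.
Proof. induction n as [|n IH]; simpl; [ring|]. rewrite IH. ring. Qed.

Lemma csum_scal (c : C) (f : nat -> C) (n : nat) :
  csum (fun i => c * f i)%C n = (c * csum f n)%C.
Proof. induction n as [|n IH]; simpl; [ring|]. rewrite IH. ring. Qed.

Lemma csum_const (c : C) (n : nat) : csum (fun _ => c) n = (INR n * c)%C.
Proof.
  induction n as [|n IH]; [simpl; ring|]. rewrite S_INR, RtoC_plus. simpl csum.
  rewrite IH. ring.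
Qed.

Lemma csum_zero (f : nat -> C) (n : nat) :
  (forall i, (i < n)%nat -> f i = 0) -> csum f n = 0.
Proof.
  intros H. rewrite (csum_ext _ (fun _ => RtoC 0)) by easy. rewrite csum_const. ring.
Qed.

Lemma csum_add (f : nat -> C) (a b : nat) :
  csum f (a + b) = (csum f a + csum (fun i => f (a + i)%nat) b)%C.
Proof.
  induction b as [|b IH]; simpl.
  - rewrite Nat.add_0_r. ring.
  - rewrite Nat.add_succ_r. simpl. rewrite IH. ring.
Qed.

(** Serves to group frequencies by residue class and to cut a long sum into periods. *)
Lemma csum_mul (f : nat -> C) (a b : nat) :
  csum f (b * a) = csum (fun i => csum (fun j => f (b * i + j)%nat) b) a.
Proof.
  induction a as [|a IH]; [now rewrite Nat.mul_0_r|].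
  rewrite Nat.mul_succ_r, csum_add, IH. easy.
Qed.

Lemma csum_swap (f : nat -> nat -> C) (a b : nat) :
  csum (fun i => csum (fun j => f i j) b) a = csum (fun j => csum (fun i => f i j) a) b.
Proof.
  induction a as [|a IH]; simpl; [now rewrite csum_zero|].
  now rewrite IH, csum_plus.
Qed.

Lemma csum_telescope (f : nat -> C) (n : nat) :
  csum (fun i => f i - f (S i))%C n = (f O - f n)%C.
Proof. induction n as [|n IH]; simpl; [ring|]. rewrite IH. ring. Qed.

Lemma csum_succ_l (f : nat -> C) (n : nat) :
  csum f (S n) = (f O + csum (fun i => f (S i)) n)%C.
Proof. change (S n) with (1 + n)%nat. rewrite csum_add. simpl. ring. Qed.

Lemma Cmod_csum (f : nat -> C) (M : R) (n : nat) :
  (forall i, (i < n)%nat -> Cmod (f i) <= M) -> Cmod (csum f n) <= INR n * M.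
Proof.
  induction n as [|n IH]; intros H.
  - simpl. rewrite Cmod_0. lra.
  - rewrite S_INR. simpl csum. eapply Rle_trans; [apply Cmod_triangle|].
    assert (H1 := H n ltac:(lia)).
    assert (H2 := IH ltac:(intros; apply H; lia)). lra.
Qed.

Lemma is_intC_csum (f : nat -> R -> C) (l : nat -> C) (a b : R) (n : nat) :
  (forall i, (i < n)%nat -> is_intC (f i) a b (l i)) ->
  is_intC (fun t => csum (fun i => f i t) n) a b (csum l n).
Proof.
  induction n as [|n IH]; intros H; simpl.
  - eapply is_intC_eq; [apply is_intC_const | ring].
  - apply is_intC_plus; [apply IH; intros; apply H; lia | apply H; lia].
Qed.

Definition cis (t : R) : C := (cos t, sin t).

Lemma cis_Cexp (t : R) : cis t = Cexp (Ci * t).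
Proof.
  unfold cis, Cexp. simpl. rewrite !Rmult_0_l, Rmult_0_r, Rminus_0_r, exp_0.
  rewrite Rplus_0_l, !Rmult_1_l. easy.
Qed.

Lemma cis_plus (s t : R) : cis (s + t) = (cis s * cis t)%C.
Proof. rewrite !cis_Cexp, <- Cexp_plus. f_equal. rewrite RtoC_plus. ring. Qed.

Lemma cis_0 : cis 0 = 1.
Proof. unfold cis. now rewrite cos_0, sin_0. Qed.

Lemma Cmod_cis (t : R) : Cmod (cis t) = 1.
Proof.
  rewrite cis_Cexp, Cmod_Cexp. simpl. rewrite <- exp_0. f_equal. ring.
Qed.

Lemma cis_opp (t : R) : cis (- t) = Cconj (cis t).
Proof. unfold cis, Cconj. simpl. now rewrite cos_neg, sin_neg. Qed.

Lemma cis_2PI_nat (n : nat) : cis (2 * PI * INR n) = 1.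
Proof.
  induction n as [|n IH]; [simpl; now rewrite Rmult_0_r, cis_0|].
  rewrite S_INR, Rmult_plus_distr_l, cis_plus, IH, Rmult_1_r.
  unfold cis. rewrite cos_2PI, sin_2PI. apply C_ext; simpl; ring.
Qed.

Lemma cis_2PI_Z (k : Z) : cis (2 * PI * IZR k) = 1.
Proof.
  destruct (Z_le_gt_dec 0 k) as [H | H].
  - rewrite <- (Z2Nat.id k), <- INR_IZR_INZ by lia. apply cis_2PI_nat.
  - replace k with (- Z.of_nat (Z.to_nat (- k)))%Z by lia.
    rewrite opp_IZR, <- INR_IZR_INZ, Ropp_mult_distr_r_reverse, cis_opp, cis_2PI_nat.
    apply C_ext; simpl; ring.
Qed.

Lemma is_derC_cis (f : R -> R) (x l : R) :
  is_derive f x l -> is_derC (fun t => cis (f t)) x (Ci * l * cis (f x))%C.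
Proof.
  intros H. rewrite cis_Cexp.
  apply (@is_derive_ext R_AbsRing C_R_NormedModule (fun t => Cexp (Ci * f t))).
  - intros t. now rewrite cis_Cexp.
  - now apply is_derC_Cexp, is_derC_scal, is_derC_RtoC.
Qed.

(** * Complex limits along a filter *)

(** Stated with the modulus rather than the product uniform structure of [C], so that estimates
    apply directly; the filter covers sequences and limits at infinity alike. *)
Definition limC {T : Type} (F : (T -> Prop) -> Prop) (f : T -> C) (l : C) : Prop :=
  forall eps : R, 0 < eps -> F (fun x => Cmod (f x - l)%C < eps).

Lemma Cmod_sub_sym (a b : C) : Cmod (a - b) = Cmod (b - a).
Proof. rewrite <- Cmod_opp. f_equal. ring. Qed.

Lemma Cmod_triangle_sub (a b : C) : Cmod (a - b) <= Cmod a + Cmod b.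
Proof.
  unfold Cminus. eapply Rle_trans; [apply Cmod_triangle|]. rewrite Cmod_opp. lra.
Qed.

Lemma limC_filterlim {T : Type} (F : (T -> Prop) -> Prop) {FF : Filter F} (f : T -> C) (l : C) :
  limC F f l -> filterlim f F (@locally C_UniformSpace l).
Proof.
  intros H. apply filterlim_locally. intros eps.
  eapply filter_imp; [|apply (H eps), cond_pos].
  intros x Hx. now apply C_NormedModule_mixin_compat1.
Qed.

Lemma limC_const {T : Type} (F : (T -> Prop) -> Prop) {FF : Filter F} (l : C) :
  limC F (fun _ => l) l.
Proof.
  intros eps He. apply filter_forall. intros _.
  replace (l - l)%C with (RtoC 0) by ring. now rewrite Cmod_0.
Qed.

Lemma limC_plus {T : Type} (F : (T -> Prop) -> Prop) {FF : Filter F} (f g : T -> C) (l m : C) :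
  limC F f l -> limC F g m -> limC F (fun x => f x + g x)%C (l + m)%C.
Proof.
  intros Hf Hg eps He.
  eapply filter_imp;
    [|apply (filter_and (F := F) _ _ (Hf (eps / 2) ltac:(lra)) (Hg (eps / 2) ltac:(lra)))].
  intros x [H1 H2]. replace (f x + g x - (l + m))%C with ((f x - l) + (g x - m))%C by ring.
  eapply Rle_lt_trans; [apply Cmod_triangle | lra].
Qed.

Lemma limC_scal {T : Type} (F : (T -> Prop) -> Prop) {FF : Filter F} (c : C) (f : T -> C) (l : C) :
  limC F f l -> limC F (fun x => c * f x)%C (c * l)%C.
Proof.
  intros Hf eps He. assert (Hc := Cmod_ge_0 c).
  eapply filter_imp; [|apply (Hf (eps / (Cmod c + 1)))].
  - intros x Hx. replace (c * f x - c * l)%C with (c * (f x - l))%C by ring.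
    rewrite Cmod_mult. assert (Hp := Cmod_ge_0 (f x - l)).
    apply Rle_lt_trans with ((Cmod c + 1) * Cmod (f x - l)); [nra|].
    apply (Rmult_lt_compat_l (Cmod c + 1)) in Hx; [|lra].
    replace ((Cmod c + 1) * (eps / (Cmod c + 1))) with eps in Hx by (field; lra). lra.
  - apply Rdiv_lt_0_compat; lra.
Qed.

Lemma limC_minus {T : Type} (F : (T -> Prop) -> Prop) {FF : Filter F} (f g : T -> C) (l m : C) :
  limC F f l -> limC F g m -> limC F (fun x => f x - g x)%C (l - m)%C.
Proof.
  intros Hf Hg.
  assert (H := limC_plus F _ _ _ _ Hf (limC_scal F (RtoC (-1)) _ _ Hg)).
  intros eps He. eapply filter_imp; [|apply (H eps He)].
  intros x Hx. simpl in Hx.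
  replace (f x - g x - (l - m))%C with (f x + -1 * g x - (l + -1 * m))%C by ring. easy.
Qed.

Lemma limC_ext_loc {T : Type} (F : (T -> Prop) -> Prop) {FF : Filter F} (f g : T -> C) (l : C) :
  F (fun x => f x = g x) -> limC F f l -> limC F g l.
Proof.
  intros H Hf eps He. eapply filter_imp; [|apply (filter_and (F := F) _ _ H (Hf eps He))].
  intros x [E Hx]. now rewrite <- E.
Qed.

Lemma limC_unique {T : Type} (F : (T -> Prop) -> Prop) {FF : ProperFilter F} (f : T -> C) (l m : C) :
  limC F f l -> limC F f m -> l = m.
Proof.
  intros Hl Hm. destruct (Req_dec (Cmod (l - m)) 0) as [E | E].
  - apply Cmod_eq_0 in E. replace l with (l - m + m)%C by ring. rewrite E. ring.
  - assert (Hp := Cmod_ge_0 (l - m)).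
    destruct (filter_ex (F := F) _ (filter_and (F := F) _ _ (Hl (Cmod (l - m) / 2) ltac:(lra))
                                     (Hm (Cmod (l - m) / 2) ltac:(lra)))) as (x & H1 & H2).
    exfalso. rewrite Cmod_sub_sym in H1.
    assert (H := Cmod_triangle (l - f x) (f x - m)).
    replace (l - f x + (f x - m))%C with (l - m)%C in H by ring. lra.
Qed.

Lemma limC_squeeze {T : Type} (F : (T -> Prop) -> Prop) {FF : Filter F}
  (f : T -> C) (g : T -> R) (l : C) :
  F (fun x => Cmod (f x - l) <= g x) -> filterlim g F (locally 0) -> limC F f l.
Proof.
  intros H Hg eps He.
  assert (Hg' := proj1 (filterlim_locally g 0) Hg (mkposreal eps He)).
  eapply filter_imp; [|apply (filter_and (F := F) _ _ H Hg')].
  intros x [H1 H2]. apply Rabs_def2 in H2. unfold minus, plus, opp in H2. simpl in H2. lra.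
Qed.

Lemma limC_comp {T U : Type} (F : (T -> Prop) -> Prop) (G : (U -> Prop) -> Prop)
  (f : U -> C) (g : T -> U) (l : C) :
  filterlim g F G -> limC G f l -> limC F (fun x => f (g x)) l.
Proof. intros Hg Hf eps He. exact (Hg _ (Hf eps He)). Qed.

Lemma filterlim_div_infty (K : R) :
  filterlim (fun x => K / x) (Rbar_locally p_infty) (locally 0).
Proof.
  assert (H : is_lim (fun x => K * / x) p_infty (Rbar_mult K 0)).
  { apply is_lim_scal_l.
    apply (is_lim_inv (fun x => x) p_infty p_infty); [apply is_lim_id | easy]. }
  simpl in H. rewrite Rmult_0_r in H. exact H.
Qed.

(** Cauchy's criterion with a rate. The limit is taken coordinatewise along the integers, and
    comparison with a large integer carries the rate over to real [x]. *)
Lemma limC_tail (F : R -> C) (K : R) :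
  (forall x y, 1 <= x <= y -> Cmod (F y - F x) <= K / x) ->
  exists l : C, forall x, 1 <= x -> Cmod (F x - l) <= K / x.
Proof.
  intros H.
  assert (HK : 0 <= K).
  { assert (H1 := H 1 1 ltac:(lra)). assert (H2 := Cmod_ge_0 (F 1 - F 1)).
    unfold Rdiv in H1. rewrite Rinv_1 in H1. lra. }
  assert (part : forall g : C -> R, (forall z, Rabs (g z) <= Cmod z) ->
            (forall z w, g (z - w)%C = g z - g w) ->
            exists l, is_lim_seq (fun n => g (F (INR n))) (Finite l)).
  { intros g Hg1 Hg2. apply ex_lim_seq_cauchy_corr. intros eps.
    destruct (nfloor_ex (K / eps + 1)) as [N [_ HN]].
    { assert (0 <= K / eps) by (apply Rdiv_le_0_compat; [easy | apply cond_pos]). lra. }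
    assert (Hnm : forall n m, (S N <= n <= m)%nat ->
              Rabs (g (F (INR n)) - g (F (INR m))) < eps).
    { intros n m Hn. rewrite <- Hg2. eapply Rle_lt_trans; [apply Hg1|].
      assert (Hn1 : INR (S N) <= INR n) by (apply le_INR; lia).
      assert (Hn2 : INR n <= INR m) by (apply le_INR; lia). rewrite S_INR in Hn1.
      assert (0 <= K / eps) by (apply Rdiv_le_0_compat; [easy | apply cond_pos]).
      rewrite Cmod_sub_sym. eapply Rle_lt_trans; [apply H; lra|].
      assert (He := cond_pos eps).
      apply Rlt_div_l; [lra|]. replace K with (eps * (K / eps)) by (field; lra).
      apply Rmult_lt_compat_l; lra. }
    exists (S N). intros n m Hn Hm. destruct (Nat.le_ge_cases n m).
    - apply Hnm. lia.
    - rewrite Rabs_minus_sym. apply Hnm. lia. }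
  destruct (part Re) as [a Ha]; [apply re_le_Cmod | now intros [] [] |].
  destruct (part Im) as [b Hb]; [|now intros [] [] |].
  { intros z. assert (H1 := Rmax_Cmod z). assert (H2 := Rmax_r (Rabs (fst z)) (Rabs (snd z))).
    unfold Im. lra. }
  exists (a, b). intros x Hx. apply Rle_plus_epsilon. intros eps He.
  apply is_lim_seq_spec in Ha. apply is_lim_seq_spec in Hb.
  assert (He2 : 0 < eps / 2) by lra.
  destruct (Ha (mkposreal _ He2)) as [N1 H1]. destruct (Hb (mkposreal _ He2)) as [N2 H2].
  destruct (nfloor_ex x) as [N3 H3]; [lra|].
  set (n := (N1 + N2 + S N3)%nat).
  specialize (H1 n ltac:(lia)). specialize (H2 n ltac:(lia)). simpl in H1, H2.
  assert (Hn : x <= INR n).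
  { apply Rle_trans with (INR (S N3)); [rewrite S_INR; lra | apply le_INR; lia]. }
  assert (H4 := H x (INR n) ltac:(lra)).
  assert (H5 : Cmod (F (INR n) - (a, b)) <= eps).
  { replace (F (INR n) - (a, b))%C with
      (RtoC (Re (F (INR n)) - a) + Ci * RtoC (Im (F (INR n)) - b))%C.
    2:{ apply C_ext; simpl; unfold Re, Im; ring. }
    eapply Rle_trans; [apply Cmod_triangle|].
    rewrite Cmod_mult, Cmod_Ci, !Cmod_R. lra. }
  replace (F x - (a, b))%C with ((F (INR n) - (a, b)) - (F (INR n) - F x))%C by ring.
  eapply Rle_trans; [apply Cmod_triangle_sub|]. lra.
Qed.

(** * Fourier inversion at a point *)

Lemma contC_inv (f : R -> C) (x : R) :
  contC f x -> f x <> 0 -> contC (fun t => / f t)%C x.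
Proof.
  intros H H0.
  assert (H1 := contC_Re _ _ H). assert (H2 := contC_Im _ _ H).
  assert (Hd : Re (f x) ^ 2 + Im (f x) ^ 2 <> 0).
  { rewrite <- Cmod2_alt. apply pow_nonzero. apply Cmod_gt_0 in H0. lra. }
  assert (M : forall u v : R -> R, continuous u x -> continuous v x ->
      continuous (fun t => u t * v t) x).
  { intros u v Hu Hv. exact (continuous_mult (K := R_AbsRing) u v x Hu Hv). }
  assert (D : continuous (fun t => / (Re (f t) ^ 2 + Im (f t) ^ 2)) x).
  { apply (continuous_comp (fun t => Re (f t) ^ 2 + Im (f t) ^ 2) Rinv).
    - apply (continuous_plus (V := R_NormedModule)).
      + apply (continuous_ext (fun t => Re (f t) * Re (f t))); [intros; simpl; ring | now apply M].
      + apply (continuous_ext (fun t => Im (f t) * Im (f t))); [intros; simpl; ring | now apply M].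
    - now apply continuous_Rinv. }
  apply contC_intro.
  - exact (M _ _ H1 D).
  - refine (M (fun t => - Im (f t)) _ _ D).
    exact (continuous_opp (V := R_NormedModule) _ x H2).
Qed.

(** The difference quotient completed at 0. A ratio of two slopes gives a continuous meaning to
    [(h x - h 0) / (freq 1 x - 1)], whose denominator vanishes at 0. *)
Definition slope (f : R -> C) (l : C) (x : R) : C :=
  if Req_EM_T x 0 then l else ((f x - f 0) / x)%C.

Lemma contC_slope_0 (f : R -> C) (l : C) : is_derC f 0 l -> contC (slope f l) 0.
Proof.
  intros H. assert (H1 := is_derC_Re _ _ _ H). assert (H2 := is_derC_Im _ _ _ H).
  assert (part : forall (g : C -> R) (k : R), g l = k ->
     (forall t, t <> 0 -> g (slope f l t) = (g (f t) - g (f 0)) / t) ->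
     is_derive (fun t => g (f t)) 0 k -> continuous (fun t => g (slope f l t)) 0).
  { intros g k Hk Ht Hd. apply is_derive_Reals in Hd.
    apply continuity_pt_filterlim. intros eps He.
    destruct (Hd eps He) as [delta Hdelta].
    exists delta. split; [apply cond_pos|]. intros t [[_ Hne] Hlt].
    simpl in Hlt |- *. unfold R_dist in *. rewrite Rminus_0_r in Hlt.
    rewrite Ht by auto. assert (E0 : g (slope f l 0) = k).
    { unfold slope. now destruct (Req_EM_T 0 0). }
    rewrite E0. specialize (Hdelta t (not_eq_sym Hne) Hlt). now rewrite Rplus_0_l in Hdelta. }
  apply contC_intro.
  - apply (part Re (Re l)); [easy | | exact H1].
    intros t Ht. unfold slope. destruct (Req_EM_T t 0); [easy|].
    unfold Cdiv. rewrite <- RtoC_inv by easy. simpl. unfold Re, Im. field. easy.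
  - apply (part Im (Im l)); [easy | | exact H2].
    intros t Ht. unfold slope. destruct (Req_EM_T t 0); [easy|].
    unfold Cdiv. rewrite <- RtoC_inv by easy. simpl. unfold Re, Im. field. easy.
Qed.

Lemma contC_ext_loc (f g : R -> C) (x : R) :
  locally x (fun t => f t = g t) -> contC f x -> contC g x.
Proof.
  intros H Hf. unfold continuous in *.
  rewrite <- (locally_singleton x _ H).
  exact (filterlim_ext_loc f g H Hf).
Qed.

Lemma contC_slope (f : R -> C) (l : C) (x : R) :
  is_derC f 0 l -> contC f x -> contC (slope f l) x.
Proof.
  intros H Hf. destruct (Req_EM_T x 0) as [-> | Hx]; [now apply contC_slope_0|].
  apply (contC_ext_loc (fun t => (f t - f 0%R) * RtoC (/ t))%C).
  - exists (mkposreal _ (Rabs_pos_lt x Hx)). intros t Ht.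
    unfold slope. destruct (Req_EM_T t 0) as [E | E].
    + subst t. unfold ball in Ht. simpl in Ht. unfold AbsRing_ball, abs, minus, plus, opp in Ht.
      simpl in Ht. rewrite Rplus_0_l, Rabs_Ropp in Ht. lra.
    + now rewrite RtoC_inv.
  - apply contC_mult; [apply contC_minus; [easy | apply contC_const]|].
    apply contC_RtoC, continuous_Rinv, Hx.
Qed.

Lemma slope_eq (f : R -> C) (l : C) (x : R) : (f x - f 0 = x * slope f l x)%C.
Proof.
  unfold slope. destruct (Req_EM_T x 0) as [-> | H]; [ring|].
  field. intros E. apply H. now injection E.
Qed.

Definition freq (m : Z) (x : R) : C := cis (2 * PI * IZR m * x).

Lemma freq_plus (m n : Z) (x : R) : freq (m + n) x = (freq m x * freq n x)%C.
Proof. unfold freq. rewrite <- cis_plus, plus_IZR. f_equal. ring. Qed.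

Lemma is_derC_freq (m : Z) (x : R) :
  is_derC (freq m) x (Ci * RtoC (2 * PI * IZR m) * freq m x)%C.
Proof.
  apply (is_derC_cis (fun t => 2 * PI * IZR m * t)). auto_derive; [easy | ring].
Qed.

Lemma contC_freq (m : Z) (x : R) : contC (freq m) x.
Proof. eapply is_derC_contC, is_derC_freq. Qed.

Lemma freq_shift_nat (m : Z) (n : nat) (x : R) : freq m (INR n + x) = freq m x.
Proof.
  unfold freq.
  replace (2 * PI * IZR m * (INR n + x)) with
    (2 * PI * IZR (m * Z.of_nat n) + 2 * PI * IZR m * x)
    by (rewrite mult_IZR, <- INR_IZR_INZ; ring).
  rewrite cis_plus, cis_2PI_Z. ring.
Qed.

Lemma is_intC_freq (m : Z) (a b : R) :
  m <> 0%Z -> is_intC (freq m) a b ((freq m b - freq m a) / (Ci * RtoC (2 * PI * IZR m)))%C.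
Proof.
  intros Hm. set (c := (Ci * RtoC (2 * PI * IZR m))%C).
  assert (Hc : c <> 0).
  { apply Cmult_neq_0.
    - intros E. injection E. lra.
    - intros E. injection E. assert (H := PI_RGT_0).
      assert (IZR m <> 0) by (intros E'; apply Hm, eq_IZR, E').
      apply Rmult_integral_contrapositive. split; [lra | easy]. }
  assert (H : is_intC (fun x => c * freq m x)%C a b (freq m b - freq m a)%C).
  { apply is_intC_derive; intros x _; [apply is_derC_freq|].
    apply contC_mult; [apply contC_const | apply contC_freq]. }
  apply (is_intC_scal (/ c)%C) in H.
  eapply is_intC_eq; [|unfold Cdiv; apply Cmult_comm].
  revert H. apply is_intC_ext. intros x _. field. easy.
Qed.

Lemma is_intC_freq_period (m : Z) :
  m <> 0%Z -> is_intC (freq m) (-1/2) (1/2) (RtoC 0).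
Proof.
  intros Hm. eapply is_intC_eq; [now apply is_intC_freq|].
  replace (1/2) with (INR 1 + -1/2) by (simpl; field).
  rewrite freq_shift_nat. unfold Cdiv. ring.
Qed.

(** Riemann-Lebesgue: [freq m] has mean zero on each of the [|m|] intervals of
    length [1 / |m|], on which [k] is almost constant. *)
Lemma riemann_lebesgue (k : R -> C) :
  (forall x, -1/2 <= x <= 1/2 -> contC k x) ->
  forall eps, 0 < eps -> exists N : nat, forall m : Z, (Z.of_nat N <= Z.abs m)%Z ->
    Cmod (CRInt (fun x => k x * freq m x)%C (-1/2) (1/2)) <= eps.
Proof.
  intros Hk eps He.
  destruct (@unifcont_normed_1d R_AbsRing C_R_NormedModule k (-1/2) (1/2) Hk (mkposreal eps He))
    as [delta Hd].
  destruct (nfloor_ex (/ delta)) as [N HN].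
  { left. apply Rinv_0_lt_compat, cond_pos. }
  exists (S N). intros m Hm.
  set (n := Z.to_nat (Z.abs m)).
  assert (Hn : (S N <= n)%nat) by lia.
  assert (Hn0 : 0 < INR n) by (apply lt_0_INR; lia).
  assert (Hn1 : / INR n < delta).
  { rewrite <- (Rinv_inv delta).
    assert (0 < / delta) by (apply Rinv_0_lt_compat, cond_pos).
    apply Rinv_0_lt_contravar; [easy|].
    apply Rlt_le_trans with (INR (S N)); [rewrite S_INR; lra | now apply le_INR]. }
  assert (Hm0 : m <> 0%Z) by lia.
  set (pt := fun j : nat => -1/2 + INR j / INR n).
  assert (Hpt : forall j, (j <= n)%nat -> -1/2 <= pt j <= 1/2).
  { intros j Hj. unfold pt. apply le_INR in Hj. assert (H0 := pos_INR j).
    assert (0 <= INR j / INR n) by (apply Rdiv_le_0_compat; easy).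
    assert (INR j / INR n <= 1) by (apply Rle_div_l; lra). lra. }
  assert (Hpt1 : forall j, pt (S j) = pt j + / INR n).
  { intros j. unfold pt. rewrite S_INR. field. lra. }
  assert (Hex : forall a b, -1/2 <= a <= 1/2 -> -1/2 <= b <= 1/2 ->
            is_intC (fun x => k x * freq m x)%C a b (CRInt (fun x => k x * freq m x)%C a b)).
  { intros a b Ha Hb. apply is_intC_cont. intros x Hx.
    assert (-1/2 <= x <= 1/2).
    { unfold Rmin, Rmax in Hx. destruct (Rle_dec a b); lra. }
    apply contC_mult; [now apply Hk | apply contC_freq]. }
  assert (Hz : forall j, is_intC (freq m) (pt j) (pt (S j)) (RtoC 0)).
  { intros j. eapply is_intC_eq; [now apply is_intC_freq|].
    rewrite Hpt1.
    replace (freq m (pt j + / INR n)) with (freq m (pt j)); [unfold Cdiv; ring|].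
    unfold freq. rewrite Rmult_plus_distr_l, cis_plus.
    replace (2 * PI * IZR m * / INR n) with (2 * PI * IZR (Z.sgn m)).
    - rewrite cis_2PI_Z. ring.
    - assert (E : IZR m = IZR (Z.sgn m) * INR n).
      { unfold n. rewrite INR_IZR_INZ, <- mult_IZR. f_equal. lia. }
      rewrite E. field. lra. }
  assert (Hind : forall j, (j <= n)%nat ->
            exists l, is_intC (fun x => k x * freq m x)%C (-1/2) (pt j) l /\
                      Cmod l <= INR j / INR n * eps).
  { induction j as [|j IH]; intros Hj.
    - exists (RtoC 0). split.
      + replace (pt 0%nat) with (-1/2) by (unfold pt; simpl; field; lra).
        apply (@is_RInt_point C_R_NormedModule).
      + rewrite Cmod_0. simpl. unfold Rdiv. rewrite !Rmult_0_l. lra.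
    - destruct IH as (l & Hl & Hb); [lia|].
      assert (Hj0 := Hpt j ltac:(lia)). assert (Hj1 := Hpt (S j) Hj).
      assert (Hle : pt j <= pt (S j)).
      { rewrite Hpt1. assert (0 < / INR n) by now apply Rinv_0_lt_compat. lra. }
      assert (Hi := Hex (pt j) (pt (S j)) Hj0 Hj1).
      set (i := CRInt (fun x => k x * freq m x)%C (pt j) (pt (S j))) in *.
      exists (l + i)%C. split; [exact (@is_RInt_Chasles C_R_NormedModule _ _ _ _ _ _ Hl Hi)|].
      assert (Hd' : is_intC (fun x => k x * freq m x - k (pt j) * freq m x)%C (pt j) (pt (S j)) i).
      { eapply is_intC_eq; [exact (is_intC_minus _ _ _ _ _ _ Hi
          (is_intC_scal (k (pt j)) _ _ _ _ (Hz j)))|]. ring. }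
      assert (Hi' : Cmod i <= (pt (S j) - pt j) * eps).
      { apply (is_intC_bound_const _ _ _ _ _ Hle) with (2 := Hd').
        intros x Hx.
        replace (k x * freq m x - k (pt j) * freq m x)%C with ((k x - k (pt j)) * freq m x)%C by ring.
        unfold freq. rewrite Cmod_mult, Cmod_cis, Rmult_1_r. left.
        assert (Hdx := Hd (pt j) x Hj0 ltac:(lra)).
        unfold ball_norm in Hdx. rewrite norm_C_R in Hdx. apply Hdx.
        unfold ball. simpl. unfold AbsRing_ball, abs, minus, plus, opp. simpl.
        rewrite Hpt1 in Hx. rewrite Rabs_pos_eq; lra. }
      eapply Rle_trans; [apply Cmod_triangle|].
      rewrite Hpt1 in Hi'. rewrite S_INR.
      replace ((INR j + 1) / INR n * eps) with (INR j / INR n * eps + / INR n * eps) by (field; lra).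
      replace (pt j + / INR n - pt j) with (/ INR n) in Hi' by ring. lra. }
  destruct (Hind n (Nat.le_refl n)) as (l & Hl & Hb).
  replace (pt n) with (1/2) in Hl by (unfold pt; field; lra).
  rewrite (is_intC_CRInt _ _ _ _ Hl). replace (INR n / INR n) with 1 in Hb by (field; lra). lra.
Qed.

(** [freq 1] takes the value 1 only at integers, as the real part [cos (2 * PI * x)] shows, and 0 is
    the only one in the interval; there the slope is the derivative. *)
Lemma slope_freq_neq_0 (x : R) :
  -1/2 <= x <= 1/2 -> slope (freq 1) (Ci * RtoC (2 * PI)) x <> 0.
Proof.
  intros Hx. assert (HPI := PI_RGT_0). unfold slope.
  destruct (Req_EM_T x 0) as [E | E].
  - apply Cmult_neq_0; intros H; injection H; lra.
  - intros H.
    assert (H' : (freq 1 x - freq 1 0)%C = 0).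
    { replace (freq 1 x - freq 1 0)%C with ((freq 1 x - freq 1 0) / x * x)%C.
      - rewrite H. ring.
      - field. intros E'. apply E. now injection E'. }
    apply (f_equal Re) in H'. unfold freq, cis in H'. simpl in H'.
    replace (2 * PI * 1 * 0) with 0 in H' by ring. rewrite cos_0 in H'.
    replace (2 * PI * 1 * x) with (2 * PI * x) in H' by ring.
    assert (Hc : forall t, 0 < t <= PI -> cos t < 1).
    { intros t Ht. rewrite <- cos_0. apply cos_decreasing_1; lra. }
    destruct (Rlt_le_dec 0 x).
    + assert (H1 := Hc (2 * PI * x) ltac:(nra)). lra.
    + assert (H1 := Hc (- (2 * PI * x)) ltac:(nra)). rewrite cos_neg in H1. lra.
Qed.

(** Fourier inversion at a point of differentiability (Chernoff's argument):
    [h - h 0 = (freq 1 - 1) k] with [k] continuous, so that the partial sum of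
    the Fourier series telescopes to two Fourier coefficients of [k]. *)
Lemma fourier_at_0 (h : R -> C) (l : C) :
  (forall x, -1/2 <= x <= 1/2 -> contC h x) -> is_derC h 0 l ->
  limC eventually
    (fun M => csum (fun i => CRInt (fun x => h x * freq (Z.of_nat M - Z.of_nat i) x)%C (-1/2) (1/2))
                (2 * M)) (h 0).
Proof.
  intros Hh Hl.
  set (k := fun x => (slope h l x / slope (freq 1) (Ci * RtoC (2 * PI)) x)%C).
  assert (Hd1 : is_derC (freq 1) 0 (Ci * RtoC (2 * PI))%C).
  { eapply is_derC_eq; [apply is_derC_freq|]. rewrite Rmult_1_r.
    unfold freq. rewrite Rmult_0_r, cis_0. ring. }
  assert (Hk : forall x, -1/2 <= x <= 1/2 -> contC k x).
  { intros x Hx. apply contC_mult; [apply contC_slope; auto|].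
    apply contC_inv; [|now apply slope_freq_neq_0].
    apply contC_slope; [easy | apply contC_freq]. }
  assert (Heq : forall x, -1/2 <= x <= 1/2 -> h x = (h 0 + (freq 1 x - 1) * k x)%C).
  { intros x Hx. assert (Hne := slope_freq_neq_0 x Hx).
    replace (RtoC 1) with (freq 1 0) by (unfold freq; now rewrite Rmult_0_r, cis_0).
    rewrite (slope_eq (freq 1) (Ci * RtoC (2 * PI)) x).
    replace (h x) with (h 0 + (h x - h 0%R))%C by ring.
    rewrite (slope_eq h l x). unfold k. field. exact Hne. }
  set (kh := fun m => CRInt (fun x => k x * freq m x)%C (-1/2) (1/2)).
  assert (Hkh : forall m, is_intC (fun x => k x * freq m x)%C (-1/2) (1/2) (kh m)).
  { intros m. apply is_intC_cont. intros x Hx. rewrite Rmin_left, Rmax_right in Hx by lra.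
    apply contC_mult; [now apply Hk | apply contC_freq]. }
  (* The Fourier coefficients of the constant 1. *)
  set (d := fun m => if Z.eq_dec m 0 then RtoC 1 else RtoC 0).
  assert (Hd : forall m, is_intC (freq m) (-1/2) (1/2) (d m)).
  { intros m. unfold d. destruct (Z.eq_dec m 0) as [-> | Hm]; [|now apply is_intC_freq_period].
    eapply is_intC_ext; [|eapply is_intC_eq; [apply (is_intC_const 1)|]].
    - intros x _. unfold freq. now rewrite Rmult_0_r, Rmult_0_l, cis_0.
    - replace (1/2 - -1/2) with 1 by field. ring. }
  assert (Hhm : forall m, CRInt (fun x => h x * freq m x)%C (-1/2) (1/2) =
                     (h 0 * d m + (kh (m + 1)%Z - kh m))%C).
  { intros m. apply is_intC_CRInt.
    eapply is_intC_ext.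
    2: { apply is_intC_plus; [apply is_intC_scal, Hd | apply is_intC_minus; apply Hkh]. }
    intros x Hx. rewrite Rmin_left, Rmax_right in Hx by lra. simpl.
    rewrite (Heq x), freq_plus by lra. ring. }
  assert (Hsum : forall M, (1 <= M)%nat ->
    csum (fun i => CRInt (fun x => h x * freq (Z.of_nat M - Z.of_nat i) x)%C (-1/2) (1/2)) (2 * M)
    = (h 0 + (kh (Z.of_nat M + 1)%Z - kh (1 - Z.of_nat M)%Z))%C).
  { intros M HM.
    rewrite (csum_ext _ (fun i => h 0 * d (Z.of_nat M - Z.of_nat i)%Z +
       (kh (Z.of_nat M - Z.of_nat i + 1)%Z - kh (Z.of_nat M - Z.of_nat (S i) + 1)%Z)))%C.
    2:{ intros i _. rewrite Hhm. do 3 f_equal. lia. }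
    rewrite csum_plus, csum_scal,
      (csum_telescope (fun i => kh (Z.of_nat M - Z.of_nat i + 1)%Z)).
    replace (csum (fun i => d (Z.of_nat M - Z.of_nat i)%Z) (2 * M)) with (RtoC 1).
    - rewrite Cmult_1_r. do 3 f_equal; lia.
    (* The frequencies run from [M] down to [1 - M]; frequency 0 occurs exactly once, at index
       [M]. *)
    - replace (2 * M)%nat with (M + S (M - 1))%nat by lia.
      rewrite csum_add, csum_succ_l, !csum_zero.
      + unfold d. destruct (Z.eq_dec _ 0); [ring | lia].
      + intros i Hi. unfold d. now destruct (Z.eq_dec _ 0); [lia|].
      + intros i Hi. unfold d. now destruct (Z.eq_dec _ 0); [lia|]. }
  intros eps He.
  destruct (riemann_lebesgue k Hk (eps / 3) ltac:(lra)) as [N HN].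
  exists (N + 2)%nat. intros M HM.
  rewrite Hsum by lia.
  replace (h 0 + (kh (Z.of_nat M + 1)%Z - kh (1 - Z.of_nat M)%Z) - h 0)%C
    with (kh (Z.of_nat M + 1)%Z - kh (1 - Z.of_nat M)%Z)%C by ring.
  assert (H1 := HN (Z.of_nat M + 1)%Z ltac:(lia)).
  assert (H2 := HN (1 - Z.of_nat M)%Z ltac:(lia)).
  eapply Rle_lt_trans; [apply Cmod_triangle_sub|]. unfold kh. lra.
Qed.

(** * Reciprocity of quadratic Gauss sums *)

Definition chirp (a t : R) : C := cis (PI * a * t ^ 2).

Lemma is_derC_chirp (a t : R) :
  is_derC (chirp a) t (Ci * RtoC (2 * PI * a * t) * chirp a t)%C.
Proof.
  apply (is_derC_cis (fun t => PI * a * t ^ 2)). auto_derive; [easy | ring].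
Qed.

Lemma contC_chirp (a t : R) : contC (chirp a) t.
Proof. eapply is_derC_contC, is_derC_chirp. Qed.

Definition fresnel (a x : R) : C := CRInt (chirp a) 0 x.

Lemma is_intC_chirp (a x y : R) : is_intC (chirp a) x y (fresnel a y - fresnel a x)%C.
Proof.
  assert (H : forall x, is_intC (chirp a) 0 x (fresnel a x)).
  { intros z. apply is_intC_cont. intros; apply contC_chirp. }
  eapply is_intC_eq.
  - apply (@is_RInt_Chasles C_R_NormedModule _ x 0 y); [|apply H].
    apply (@is_RInt_swap C_R_NormedModule), H.
  - apply Cplus_comm.
Qed.

(** Away from 0 the chirp is its own derivative times [- i / (2 pi t)], so one integration by parts
    produces the decay. The three resulting terms add up to at most [1 / (pi x)]. *)
Lemma fresnel_tail (x y : R) :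
  1 <= x <= y -> Cmod (fresnel 1 y - fresnel 1 x) <= 1 / x.
Proof.
  intros Hxy. assert (HPI := PI_RGT_0).
  set (g := fun t => (- Ci * RtoC (/ (2 * PI * t)))%C).
  set (dg := fun t => (Ci * RtoC (/ (2 * PI * t ^ 2)))%C).
  assert (Hpos : forall t, Rmin x y <= t <= Rmax x y -> x <= t <= y).
  { intros t Ht. rewrite Rmin_left, Rmax_right in Ht by lra. lra. }
  assert (Hg : forall t, x <= t <= y -> is_derC g t (dg t)).
  { intros t Ht. eapply is_derC_eq.
    - apply is_derC_scal, is_derC_RtoC.
      instantiate (1 := - / (2 * PI * t ^ 2)).
      auto_derive; [|field; split; lra].
      apply Rmult_integral_contrapositive. split; lra.
    - unfold dg. rewrite RtoC_opp. ring. }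
  assert (Hdg : forall t, x <= t <= y -> contC dg t).
  { intros t Ht. apply contC_mult; [apply contC_const|]. apply contC_RtoC.
    apply (@ex_derive_continuous R_AbsRing R_NormedModule). auto_derive.
    apply Rmult_integral_contrapositive. split; [lra|].
    apply Rmult_integral_contrapositive. split; lra. }
  assert (Hi : is_intC (fun t => chirp 1 t * dg t)%C x y (CRInt (fun t => chirp 1 t * dg t)%C x y)).
  { apply is_intC_cont. intros t Ht.
    apply contC_mult; [apply contC_chirp | now apply Hdg, Hpos]. }
  set (i := CRInt (fun t => chirp 1 t * dg t)%C x y) in *.
  assert (Hb : Cmod i <= / (2 * PI * x) - / (2 * PI * y)).
  { apply (is_intC_bound _ (fun t => / (2 * PI * t ^ 2)) x y i _ (proj2 Hxy)) with (2 := Hi).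
    - intros t Ht. unfold dg, chirp. rewrite !Cmod_mult, Cmod_cis, Cmod_Ci, Cmod_R, !Rmult_1_l.
      right. apply Rabs_pos_eq. left. apply Rinv_0_lt_compat.
      apply Rmult_lt_0_compat; [lra | apply pow_lt; lra].
    - replace (/ (2 * PI * x) - / (2 * PI * y)) with (- / (2 * PI * y) - - / (2 * PI * x)) by ring.
      apply (@is_RInt_derive R_CompleteNormedModule (fun t => - / (2 * PI * t))).
      + intros t Ht. apply Hpos in Ht. auto_derive; [|simpl; field; split; lra].
        apply Rmult_integral_contrapositive. split; lra.
      + intros t Ht. apply Hpos in Ht.
        apply (@ex_derive_continuous R_AbsRing R_NormedModule). auto_derive.
        apply Rmult_integral_contrapositive. split; [lra|].
        apply Rmult_integral_contrapositive. split; lra. }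
  assert (H : is_intC (chirp 1) x y (chirp 1 y * g y - chirp 1 x * g x - i)%C).
  { eapply is_intC_ext; [|apply (is_intC_by_parts (chirp 1)
       (fun t => Ci * RtoC (2 * PI * 1 * t) * chirp 1 t)%C g dg)].
    - intros t Ht. rewrite Rmin_left, Rmax_right in Ht by lra. simpl. unfold g.
      rewrite Rmult_1_r.
      transitivity ((- (Ci * Ci)) * RtoC (2 * PI * t * / (2 * PI * t)) * chirp 1 t)%C.
      { rewrite (RtoC_mult (2 * PI * t)). ring. }
      rewrite Rinv_r.
      + replace (Ci * Ci)%C with (- (1))%C by (apply C_ext; simpl; ring). ring.
      + apply Rmult_integral_contrapositive. split; lra.
    - intros t _. apply is_derC_chirp.
    - intros t Ht. now apply Hg, Hpos.
    - intros t _. apply contC_mult; [|apply contC_chirp]. apply contC_mult; [apply contC_const|].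
      apply contC_RtoC. apply (@ex_derive_continuous R_AbsRing R_NormedModule). now auto_derive.
    - intros t Ht. now apply Hdg, Hpos.
    - exact Hi. }
  assert (E : (fresnel 1 y - fresnel 1 x)%C = (chirp 1 y * g y - chirp 1 x * g x - i)%C).
  { rewrite <- (is_intC_CRInt _ _ _ _ (is_intC_chirp 1 x y)). now apply is_intC_CRInt. }
  rewrite E.
  assert (Hgb : forall t, x <= t <= y -> Cmod (chirp 1 t * g t) = / (2 * PI * t)).
  { intros t Ht. unfold g, chirp. rewrite !Cmod_mult, Cmod_cis, Cmod_opp, Cmod_Ci, Cmod_R, !Rmult_1_l.
    apply Rabs_pos_eq. left. apply Rinv_0_lt_compat.
    apply Rmult_lt_0_compat; lra. }
  eapply Rle_trans; [apply Cmod_triangle_sub|].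
  eapply Rle_trans; [apply Rplus_le_compat_r, Cmod_triangle_sub|].
  rewrite !Hgb by lra.
  apply Rle_trans with (2 * / (2 * PI * x)); [lra|].
  replace (2 * / (2 * PI * x)) with (/ PI * (1 / x)) by (field; split; lra).
  rewrite <- (Rmult_1_l (1 / x)) at 2. apply Rmult_le_compat_r.
  - apply Rdiv_le_0_compat; lra.
  - rewrite <- Rinv_1. apply Rinv_le_contravar; [lra|]. assert (H2 := PI2_1). lra.
Qed.

Lemma fresnel_lim : exists F : C, limC (Rbar_locally p_infty) (fresnel 1) F.
Proof.
  destruct (limC_tail (fresnel 1) 1 fresnel_tail) as [F HF].
  exists F. apply (limC_squeeze _ _ (fun x => 1 / x)).
  - exists 1. intros x Hx. apply HF. lra.
  - apply filterlim_div_infty.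
Qed.

Lemma fresnel_scale (a x : R) :
  0 < a -> fresnel a x = (RtoC (/ sqrt a) * fresnel 1 (sqrt a * x)%R)%C.
Proof.
  intros Ha. assert (Hs := sqrt_lt_R0 a Ha).
  assert (H := is_intC_chirp 1 (sqrt a * 0 + 0) (sqrt a * x + 0)).
  apply (@is_RInt_comp_lin C_R_NormedModule) in H.
  apply is_intC_CRInt.
  apply (is_intC_scal (RtoC (/ sqrt a))) in H.
  rewrite Rmult_0_r, !Rplus_0_r in H.
  replace (fresnel 1 0) with (RtoC 0) in H.
  2:{ symmetry. apply is_intC_CRInt. apply (@is_RInt_point C_R_NormedModule). }
  eapply is_intC_eq; [|unfold Cminus; rewrite <- (Cplus_0_r (fresnel 1 (sqrt a * x)))].
  - eapply is_intC_ext; [|exact H].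
    intros t _. simpl. rewrite scal_R_C, Cmult_assoc, <- RtoC_mult, Rinv_l, Cmult_1_l by lra.
    unfold chirp. f_equal. rewrite Rplus_0_r, Rpow_mult_distr.
    replace (sqrt a ^ 2) with a; [ring|]. simpl. rewrite Rmult_1_r, sqrt_def; lra.
  - f_equal. ring.
Qed.

Lemma fresnel_opp (a x : R) : fresnel a (- x) = (- fresnel a x)%C.
Proof.
  assert (H := is_intC_chirp a (-1 * 0 + 0) (-1 * x + 0)).
  apply (@is_RInt_comp_lin C_R_NormedModule) in H.
  rewrite Rmult_0_r, !Rplus_0_r in H.
  replace (fresnel a 0) with (RtoC 0) in H.
  2:{ symmetry. apply is_intC_CRInt. apply (@is_RInt_point C_R_NormedModule). }
  replace (-1 * x) with (- x) in H by ring.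
  apply (is_intC_scal (RtoC (-1))) in H.
  assert (H' : is_intC (chirp a) 0 x (- fresnel a (- x))%C).
  { eapply is_intC_eq; [eapply is_intC_ext; [|exact H]|].
    - intros t _. simpl. rewrite scal_R_C. unfold chirp.
      replace ((-1 * t + 0) ^ 2) with (t ^ 2) by ring.
      rewrite Cmult_assoc, <- RtoC_mult. replace (-1 * -1) with 1 by ring. ring.
    - ring. }
  apply is_intC_CRInt in H'. fold (fresnel a x) in H'. rewrite H'. ring.
Qed.

Lemma fresnel_lim_scale (F : C) (a : R) :
  0 < a -> limC (Rbar_locally p_infty) (fresnel 1) F ->
  limC (Rbar_locally p_infty) (fresnel a) (RtoC (/ sqrt a) * F)%C.
Proof.
  intros Ha HF. assert (Hs := sqrt_lt_R0 a Ha).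
  apply (limC_ext_loc _ (fun x => RtoC (/ sqrt a) * fresnel 1 (sqrt a * x)%R)%C).
  - exists 0. intros x _. symmetry. now apply fresnel_scale.
  - apply limC_scal; [apply _|].
    apply (limC_comp _ (Rbar_locally p_infty) (fresnel 1) (fun x => sqrt a * x)); [|easy].
    intros P [M HM]. exists (M / sqrt a). intros x Hx. apply HM.
    apply Rlt_div_l in Hx; [|easy]. lra.
Qed.

Lemma filterlim_affine_nat (b c : R) :
  0 < c -> filterlim (fun n => c * INR n + b) eventually (Rbar_locally p_infty).
Proof.
  intros Hc P [M HM].
  destruct (nfloor_ex (Rmax 0 ((M - b) / c))) as [N HN]; [apply Rmax_l|].
  exists (S N). intros n Hn. apply HM. apply le_INR in Hn. rewrite S_INR in Hn.
  assert (H := Rmax_r 0 ((M - b) / c)).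
  assert (H' : (M - b) / c < INR n) by lra.
  apply Rlt_div_l in H'; [|easy]. lra.
Qed.

Lemma limC_csum {T : Type} (F : (T -> Prop) -> Prop) {FF : Filter F}
  (f : nat -> T -> C) (l : nat -> C) (n : nat) :
  (forall i, (i < n)%nat -> limC F (f i) (l i)) ->
  limC F (fun x => csum (fun i => f i x) n) (csum l n).
Proof.
  induction n as [|n IH]; intros H; simpl.
  - now apply limC_const.
  - apply limC_plus; [easy | apply IH; intros; apply H; lia | apply H; lia].
Qed.

(** The window is cut at half-integers into intervals centred at the integers; moving each to the
    origin does not change [freq m], which has period 1. *)
Lemma csum_unit_intervals (h : R -> C) (m : Z) (q : nat) :
  (forall x, contC h x) ->
  is_intC (fun x => h x * freq m x)%C (-1/2) (INR q - 1/2)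
    (csum (fun n => CRInt (fun x => h (INR n + x)%R * freq m x)%C (-1/2) (1/2)) q).
Proof.
  intros Hh. induction q as [|q IH].
  - simpl. replace (0 - 1/2) with (-1/2) by field.
    apply (@is_RInt_point C_R_NormedModule).
  - simpl csum. apply (@is_RInt_Chasles C_R_NormedModule _ _ (INR q - 1/2)); [exact IH|].
    assert (H := is_intC_cont (fun x => h x * freq m x)%C (INR q - 1/2) (INR (S q) - 1/2)).
    specialize (H (fun x _ => contC_mult _ _ _ (Hh x) (contC_freq m x))).
    assert (H' := H).
    replace (INR q - 1/2) with (-1/2 + INR q) in H' at 1 by field.
    replace (INR (S q) - 1/2) with (1/2 + INR q) in H' at 1 by (rewrite S_INR; field).
    assert (Hs := is_intC_shift _ _ _ _ _ H').
    replace (CRInt (fun x => h (INR q + x)%R * freq m x)%C (-1/2) (1/2)) with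
      (CRInt (fun x => h x * freq m x)%C (INR q - 1/2) (INR (S q) - 1/2)); [exact H|].
    symmetry. apply is_intC_CRInt. eapply is_intC_ext; [|exact Hs].
    intros x _. simpl. rewrite (Rplus_comm x), freq_shift_nat. easy.
Qed.

Lemma is_derC_translate (h : R -> C) (c x : R) (l : C) :
  is_derC h (c + x) l -> is_derC (fun t => h (c + t)) x l.
Proof.
  intros H. apply is_derC_intro.
  - apply is_derC_Re in H. replace (Re l) with (1 * Re l) by ring.
    apply (is_derive_comp (fun t => Re (h t)) (fun t => c + t)); [exact H|].
    auto_derive; [easy | ring].
  - apply is_derC_Im in H. replace (Im l) with (1 * Im l) by ring.
    apply (is_derive_comp (fun t => Im (h t)) (fun t => c + t)); [exact H|].
    auto_derive; [easy | ring].
Qed.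

(** Poisson summation on a finite window: inversion at 0 is applied to the translates
    [chirp a (n + x)] for [n < q], and two finite sums are exchanged. The limit concerns these
    particular partial sums over [1 - M, ..., M]; no absolute convergence is claimed. *)
Lemma poisson_chirp (a : R) (q : nat) :
  limC eventually
    (fun M => csum (fun i => CRInt (fun x => chirp a x * freq (Z.of_nat M - Z.of_nat i)%Z x)%C
                       (-1/2) (INR q - 1/2)) (2 * M))
    (csum (fun n => chirp a (INR n)) q).
Proof.
  apply (limC_ext_loc _ (fun M => csum (fun n => csum (fun i =>
     CRInt (fun x => chirp a (INR n + x)%R * freq (Z.of_nat M - Z.of_nat i)%Z x)%C (-1/2) (1/2))
     (2 * M)) q)).
  - exists 0%nat. intros M _. rewrite csum_swap. apply csum_ext. intros i _.
    symmetry. apply is_intC_CRInt.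
    apply csum_unit_intervals. intros x; apply contC_chirp.
  - apply limC_csum; [apply _|]. intros n _.
    assert (H := fourier_at_0 (fun x => chirp a (INR n + x)) _
      (fun x _ => is_derC_contC _ _ _ (is_derC_translate _ _ _ _ (is_derC_chirp a (INR n + x))))
      (is_derC_translate _ _ _ _ (is_derC_chirp a (INR n + 0)))).
    simpl in H. now rewrite Rplus_0_r in H.
Qed.

Lemma chirp_complete_square (p q l j : Z) (t : R) :
  (0 < p)%Z -> (0 < q)%Z -> Z.even (p * q) = true ->
  (chirp (IZR p / IZR q)%R t * freq (p * l - j)%Z t =
   cis (- (PI * IZR q * IZR j ^ 2 / IZR p))%R *
   chirp (IZR p / IZR q)%R (t + (IZR q * IZR l - IZR j * IZR q / IZR p))%R)%C.
Proof.
  intros Hp Hq He. apply IZR_lt in Hp. apply IZR_lt in Hq.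
  apply Z.even_spec in He. destruct He as [e He].
  unfold chirp, freq. rewrite <- !cis_plus.
  (* Completing the square leaves the phase [- pi q (p l - j)^2 / p]. With [p q = 2 e] it equals
     [- pi q j^2 / p] up to the multiple [2 pi (e l^2 - q l j)], an integer number of turns. *)
  rewrite <- (Cmult_1_r (cis (_ + _))), <- (cis_2PI_Z (e * l * l - q * l * j)), <- cis_plus.
  f_equal.
  rewrite !minus_IZR, !mult_IZR.
  assert (E : IZR e = IZR p * IZR q / 2) by (rewrite <- mult_IZR, He, mult_IZR; field).
  rewrite E. field. split; lra.
Qed.

(** The phase is [pi p n^2 / q], half the customary one; a shift of [n] by [q] changes it by
    [2 pi p n + pi p q], so that the summand has period [q] when [p q] is even. *)
Definition gauss_sum (p q : nat) : C :=
  csum (fun n => chirp (INR p / INR q) (INR n)) q.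

(** For frequencies in one residue class modulo [p], completing the square shifts the window by
    successive multiples of its own length [q]. The windows tile an interval growing at both ends,
    and each end contributes [F / sqrt (p / q)]; the factors [c j] add up to the conjugate of the
    reciprocal sum. *)
Lemma gauss_sum_fresnel (F : C) (p q : nat) :
  limC (Rbar_locally p_infty) (fresnel 1) F ->
  (0 < p)%nat -> (0 < q)%nat -> Nat.even (p * q) = true ->
  gauss_sum p q = (2 * RtoC (/ sqrt (INR p / INR q)) * F * Cconj (gauss_sum q p))%C.
Proof.
  intros HF Hp Hq He.
  assert (Hp' := lt_0_INR p Hp). assert (Hq' := lt_0_INR q Hq).
  set (a := INR p / INR q). assert (Ha : 0 < a) by now apply Rdiv_lt_0_compat.
  set (c := fun j : nat => cis (- (PI * INR q * INR j ^ 2 / INR p))).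
  set (b := fun j : nat => -1/2 - INR j * INR q / INR p).
  assert (Hlim := poisson_chirp a q).
  (* Only cut-offs that are multiples of [p] are used: every residue class then receives exactly
     [2 * L] frequencies. *)
  assert (Hpl : filterlim (fun L => (p * L)%nat) eventually eventually).
  { intros P [N HN]. exists N. intros n Hn. apply HN. nia. }
  assert (Hlim' := limC_comp _ _ _ _ _ Hpl Hlim). cbv beta in Hlim'.
  apply (limC_unique eventually _ _ _ Hlim'). clear Hlim Hlim'.
  assert (Hsum : forall L : nat,
    csum (fun i => CRInt (fun x => chirp a x * freq (Z.of_nat (p * L) - Z.of_nat i)%Z x)%C
                    (-1/2) (INR q - 1/2)) (2 * (p * L)) =
    csum (fun j => c j * (fresnel a (INR q * INR L + (b j + INR q))%R +
                          fresnel a (INR q * INR L + - (b j + INR q))%R))%C p).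
  { intros L. replace (2 * (p * L))%nat with (p * (2 * L))%nat by lia.
    rewrite csum_mul, csum_swap. apply csum_ext. intros j Hj.
    (* [D l] is the Fresnel integral up to the right end of window [l], which is the left end of
       window [l - 1]; hence the telescoping. *)
    set (D := fun l : nat => fresnel a (INR q * (INR L - INR l) + (b j + INR q))).
    rewrite (csum_ext _ (fun l => c j * (D l - D (S l)))%C).
    - rewrite csum_scal, csum_telescope. f_equal. unfold D. simpl (INR 0).
      rewrite Rminus_0_r. unfold Cminus. f_equal.
      rewrite mult_INR. change (INR 2) with 2.
      rewrite <- fresnel_opp. f_equal. ring.
    - intros l _. apply is_intC_CRInt.
      set (s := INR q * (INR L - INR l) - INR j * INR q / INR p).
      assert (Hs := is_intC_shift _ s (-1/2) (INR q - 1/2) _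
                      (is_intC_chirp a (-1/2 + s) (INR q - 1/2 + s))).
      apply (is_intC_scal (c j)) in Hs.
      replace (INR q - 1/2 + s) with (INR q * (INR L - INR l) + (b j + INR q)) in Hs
        by (unfold s, b; field; lra).
      replace (-1/2 + s) with (INR q * (INR L - INR (S l)) + (b j + INR q)) in Hs
        by (unfold s, b; rewrite S_INR; field; lra).
      eapply is_intC_ext; [|exact Hs]. intros x _. simpl.
      replace (Z.of_nat (p * L) - Z.of_nat (p * l + j))%Z with
        (Z.of_nat p * (Z.of_nat L - Z.of_nat l) - Z.of_nat j)%Z by lia.
      unfold a, c, s. rewrite !INR_IZR_INZ. symmetry.
      rewrite chirp_complete_square, minus_IZR; try lia; [easy|].
      rewrite <- Nat2Z.inj_mul. apply Nat.even_spec in He. destruct He as [e ->].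
      rewrite Nat2Z.inj_mul. now rewrite Z.even_mul. }
  apply (limC_ext_loc _ (fun L => csum (fun j => c j * (fresnel a (INR q * INR L + (b j + INR q))%R +
                          fresnel a (INR q * INR L + - (b j + INR q))%R))%C p)).
  { exists 0%nat. intros L _. symmetry. apply Hsum. }
  replace (2 * RtoC (/ sqrt a) * F * Cconj (gauss_sum q p))%C with
    (csum (fun j => c j * (RtoC (/ sqrt a) * F + RtoC (/ sqrt a) * F))%C p).
  - apply limC_csum; [apply _|]. intros j _.
    apply limC_scal; [apply _|].
    assert (HFa := fresnel_lim_scale F a Ha HF).
    apply limC_plus; [apply _ | |];
      exact (limC_comp _ _ _ _ _ (filterlim_affine_nat _ _ Hq') HFa).
  - rewrite (csum_ext _ (fun j => 2 * RtoC (/ sqrt a) * F * c j)%C) by (intros; ring).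
    rewrite csum_scal. f_equal.
    unfold gauss_sum. generalize p at 1 3. intros n.
    induction n as [|n IH]; simpl.
    + apply C_ext; simpl; ring.
    + rewrite Cplus_conj, <- IH. f_equal. unfold c, chirp.
      rewrite cis_opp. do 2 f_equal. field. lra.
Qed.

(** The Fresnel constant is read off the case [p = 1], [q = 2]. *)
Lemma gauss_sum_reciprocity (p q : nat) :
  (0 < p)%nat -> (0 < q)%nat -> Nat.even (p * q) = true ->
  gauss_sum p q = (RtoC (sqrt (INR q / (2 * INR p))) * (1 + Ci) * Cconj (gauss_sum q p))%C.
Proof.
  intros Hp Hq He. destruct fresnel_lim as [F HF].
  assert (Hp' := lt_0_INR p Hp). assert (Hq' := lt_0_INR q Hq).
  rewrite (gauss_sum_fresnel F p q HF Hp Hq He). f_equal.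
  assert (H12 := gauss_sum_fresnel F 1 2 HF ltac:(lia) ltac:(lia) eq_refl).
  assert (E1 : gauss_sum 1 2 = (1 + Ci)%C).
  { unfold gauss_sum, chirp. simpl.
    replace (PI * (1 / (1 + 1)) * (0 * (0 * 1))) with 0 by field.
    replace (PI * (1 / (1 + 1)) * (1 * (1 * 1))) with (PI / 2) by field.
    rewrite cis_0. unfold cis. rewrite cos_PI2, sin_PI2. apply C_ext; simpl; ring. }
  assert (E2 : Cconj (gauss_sum 2 1) = 1).
  { unfold gauss_sum, chirp. simpl.
    replace (PI * ((1 + 1) / 1) * (0 * (0 * 1))) with 0 by field.
    rewrite cis_0. apply C_ext; simpl; ring. }
  rewrite E1, E2, Cmult_1_r in H12. change (INR 1) with 1 in H12. change (INR 2) with 2 in H12.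
  rewrite H12.
  replace (RtoC (/ sqrt (INR p / INR q))) with
    (RtoC (sqrt (INR q / (2 * INR p))) * RtoC (/ sqrt (1 / 2)))%C; [ring|].
  rewrite <- RtoC_mult. f_equal.
  rewrite <- !sqrt_inv, <- sqrt_mult.
  - f_equal. field. lra.
  - apply Rdiv_le_0_compat; lra.
  - lra.
Qed.

(** * The constants as Gauss means *)

Lemma theta_phase_chirp (r : R) (n : nat) : theta_phase r n = chirp r (INR n).
Proof. unfold theta_phase, chirp. now rewrite cis_Cexp. Qed.

Lemma Cmod_theta_phase (r : R) (n : nat) : Cmod (theta_phase r n) = 1.
Proof. rewrite theta_phase_chirp. apply Cmod_cis. Qed.

Lemma theta_phase_opp (r : R) (n : nat) : theta_phase (- r) n = Cconj (theta_phase r n).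
Proof. rewrite !theta_phase_chirp. unfold chirp. rewrite <- cis_opp. f_equal. ring. Qed.

Lemma theta_phase_add_2 (r : R) (n : nat) : theta_phase (r + 2) n = theta_phase r n.
Proof.
  rewrite !theta_phase_chirp. unfold chirp.
  replace (PI * (r + 2) * INR n ^ 2) with (PI * r * INR n ^ 2 + 2 * PI * INR (n * n))
    by (rewrite mult_INR; ring).
  rewrite cis_plus, cis_2PI_nat. ring.
Qed.

Definition phase_period (r : R) (q : nat) : Prop :=
  (0 < q)%nat /\ forall n, theta_phase r (n + q) = theta_phase r n.

(** Since [p (n + q)^2 / q = p n^2 / q + 2 p n + p q], opposite parity of [p] and [q] makes the
    added phase a multiple of [2 pi]. *)
Lemma phase_period_rational (p q : Z) :
  (0 < q)%Z -> Z.odd (p + q) = true -> phase_period (IZR p / IZR q) (Z.to_nat q).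
Proof.
  intros Hq Ho. split; [lia|]. intros n. assert (Hq' := IZR_lt _ _ Hq).
  rewrite !theta_phase_chirp. unfold chirp.
  assert (He : exists e, (p * q = 2 * e)%Z).
  { destruct (Z.Even_or_Odd p) as [[a ->] | [a ->]].
    - exists (a * q)%Z. ring.
    - destruct (Z.Even_or_Odd q) as [[b ->] | [b ->]].
      + exists ((2 * a + 1) * b)%Z. ring.
      + exfalso. replace (2 * a + 1 + (2 * b + 1))%Z with (0 + 2 * (a + b + 1))%Z in Ho by ring.
        now rewrite Z.odd_add_mul_2 in Ho. }
  destruct He as [e He].
  rewrite plus_INR, (INR_IZR_INZ (Z.to_nat q)), Z2Nat.id by lia.
  replace (PI * (IZR p / IZR q) * (INR n + IZR q) ^ 2) with
    (PI * (IZR p / IZR q) * INR n ^ 2 + 2 * PI * IZR (p * Z.of_nat n + e)).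
  - rewrite cis_plus, cis_2PI_Z. ring.
  - rewrite plus_IZR, mult_IZR, <- INR_IZR_INZ.
    assert (E : IZR e = IZR p * IZR q / 2) by (rewrite <- mult_IZR, He, mult_IZR; field).
    rewrite E. field. lra.
Qed.

Lemma phase_period_opp (r : R) (q : nat) : phase_period r q -> phase_period (- r) q.
Proof. intros [Hq H]. split; [easy|]. intros n. now rewrite !theta_phase_opp, H. Qed.

Lemma csum_phase_period (r : R) (q k : nat) :
  phase_period r q -> csum (theta_phase r) (q * k) = (INR k * csum (theta_phase r) q)%C.
Proof.
  intros [_ H]. rewrite csum_mul, <- csum_const. apply csum_ext. intros i _.
  apply csum_ext. intros j _. induction i as [|i IH].
  - now rewrite Nat.mul_0_r.
  - now rewrite Nat.mul_succ_r, <- IH, <- (H (q * i + j)%nat), <- !Nat.add_assoc, (Nat.add_comm j).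
Qed.

(** The period is quantified inside the choice, so that the mean depends on [r] alone and not on a
    representing fraction. *)
Definition phase_mean (r : R) : C :=
  epsilon (inhabits (RtoC 0))
    (fun c => exists q, phase_period r q /\ (INR q * c)%C = csum (theta_phase r) q).

Lemma RtoC_neq_0 (x : R) : x <> 0 -> RtoC x <> RtoC 0.
Proof. intros H E. apply H. now injection E. Qed.

(** Two periods [q] and [q'] are compared through the common period [q * q']. *)
Lemma phase_mean_spec (r : R) (q : nat) :
  phase_period r q -> (INR q * phase_mean r)%C = csum (theta_phase r) q.
Proof.
  intros Hq.
  assert (H : exists c q, phase_period r q /\ (INR q * c)%C = csum (theta_phase r) q).
  { exists (csum (theta_phase r) q / INR q)%C, q. split; [easy|].
    field. apply RtoC_neq_0, not_0_INR. destruct Hq. lia. }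
  destruct (epsilon_spec (inhabits (RtoC 0)) _ H) as (q' & Hq' & E).
  fold (phase_mean r) in E.
  assert (E1 := csum_phase_period r q q' Hq). assert (E2 := csum_phase_period r q' q Hq').
  rewrite Nat.mul_comm, E2, <- E in E1.
  assert (H0 : RtoC (INR q') <> 0) by (apply RtoC_neq_0, not_0_INR; destruct Hq'; lia).
  transitivity (/ INR q' * (INR q * (INR q' * phase_mean r)))%C; [field; easy|].
  rewrite E1. field. easy.
Qed.

Lemma phase_mean_unique (r : R) (q : nat) (c : C) :
  phase_period r q -> (INR q * c)%C = csum (theta_phase r) q -> phase_mean r = c.
Proof.
  intros Hq E. rewrite <- (phase_mean_spec r q Hq) in E.
  assert (H0 : RtoC (INR q) <> 0) by (apply RtoC_neq_0, not_0_INR; destruct Hq; lia).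
  transitivity (/ INR q * (INR q * phase_mean r))%C; [field; easy|].
  rewrite <- E. field. easy.
Qed.

Lemma csum_conj (f : nat -> C) (n : nat) : csum (fun i => Cconj (f i)) n = Cconj (csum f n).
Proof.
  induction n as [|n IH]; simpl.
  - apply C_ext; simpl; ring.
  - now rewrite IH, Cplus_conj.
Qed.

Lemma Cconj_RtoC (x : R) : Cconj x = x.
Proof. apply C_ext; simpl; ring. Qed.

Lemma phase_mean_opp (r : R) (q : nat) :
  phase_period r q -> phase_mean (- r) = Cconj (phase_mean r).
Proof.
  intros Hq. apply (phase_mean_unique _ q); [now apply phase_period_opp|].
  rewrite (csum_ext _ _ q (fun i _ => theta_phase_opp r i)), csum_conj,
    <- (phase_mean_spec r q Hq), Cmult_conj. now rewrite Cconj_RtoC.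
Qed.

Lemma Csqrt_Ci_div (r : R) :
  0 < r -> Csqrt (- Ci / r) = (RtoC (sqrt (/ (2 * r))) * (1 - Ci))%C.
Proof.
  intros Hr. unfold Csqrt.
  assert (E : (- Ci / r)%C = (0, - / r)).
  { unfold Cdiv. rewrite <- RtoC_inv by lra. apply C_ext; simpl; ring. }
  assert (Hi := Rinv_0_lt_compat r Hr).
  rewrite E. replace (Cmod (0, - / r)) with (/ r).
  2:{ unfold Cmod. simpl.
      replace (0 * (0 * 1) + - / r * (- / r * 1)) with (Rsqr (/ r)) by (unfold Rsqr; ring).
      rewrite sqrt_Rsqr; lra. }
  simpl. destruct (Rlt_dec (- / r) 0) as [_ | H]; [|lra].
  rewrite Rplus_0_r, Rminus_0_r.
  replace (/ r / 2) with (/ (2 * r)) by (field; lra).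
  apply C_ext; simpl; ring.
Qed.

(** The numbers [- i / r] are imaginary, hence off the branch cut, where the principal root commutes
    with conjugation. This reduces negative [r] to positive [r]. *)
Lemma Csqrt_Ci_div_opp (r : R) :
  0 < r -> Csqrt (- Ci / RtoC (- r)) = Cconj (Csqrt (- Ci / r)).
Proof.
  intros Hr. rewrite (Csqrt_Ci_div r) by easy. unfold Csqrt.
  assert (E : (- Ci / RtoC (- r))%C = (0, / r)).
  { unfold Cdiv. rewrite <- RtoC_inv by lra. apply C_ext; simpl; field; lra. }
  assert (Hi := Rinv_0_lt_compat r Hr).
  rewrite E. replace (Cmod (0, / r)) with (/ r).
  2:{ unfold Cmod. simpl.
      replace (0 * (0 * 1) + / r * (/ r * 1)) with (Rsqr (/ r)) by (unfold Rsqr; ring).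
      rewrite sqrt_Rsqr; lra. }
  simpl. destruct (Rlt_dec (/ r) 0) as [H | _]; [lra|].
  rewrite Rplus_0_r, Rminus_0_r.
  replace (/ r / 2) with (/ (2 * r)) by (field; lra).
  apply C_ext; simpl; ring.
Qed.

(** The conjugate of the reciprocal Gauss sum is [P] times the mean at [- / r], so reciprocity
    expresses the mean at [r] through the one at [- / r]; it remains to invert its scalar factor. *)
Lemma phase_mean_inv_pos (r : R) :
  parity_rational r -> 0 < r -> phase_mean (- / r) = (Csqrt (- Ci / r) * phase_mean r)%C.
Proof.
  intros (p & q & Hq & Ho & E) Hr. assert (Hq' := IZR_lt _ _ Hq).
  assert (Hp : (0 < p)%Z).
  { apply lt_IZR. replace (IZR p) with (r * IZR q) by (rewrite E; field; lra).
    now apply Rmult_lt_0_compat. }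
  assert (Hp' := IZR_lt _ _ Hp).
  set (P := Z.to_nat p). set (Q := Z.to_nat q).
  assert (EP : INR P = IZR p) by (unfold P; rewrite INR_IZR_INZ, Z2Nat.id; easy || lia).
  assert (EQ : INR Q = IZR q) by (unfold Q; rewrite INR_IZR_INZ, Z2Nat.id; easy || lia).
  assert (He : Nat.even (P * Q) = true).
  { assert (Ho' : Nat.odd (P + Q) = true).
    { apply Nat.odd_spec. apply Z.odd_spec in Ho.
      destruct Ho as [k Hk]. exists (Z.to_nat k). lia. }
    rewrite Nat.odd_add in Ho'. rewrite Nat.even_mul, <- !Nat.negb_odd.
    destruct (Nat.odd P), (Nat.odd Q); easy. }
  assert (Hrec := gauss_sum_reciprocity P Q ltac:(lia) ltac:(lia) He).
  assert (P1 : phase_period r Q) by (rewrite E; now apply phase_period_rational).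
  assert (P2 : phase_period (/ r) P).
  { replace (/ r) with (IZR q / IZR p) by (rewrite E; field; lra).
    apply phase_period_rational; [easy | now rewrite Z.add_comm]. }
  assert (G1 : gauss_sum P Q = (INR Q * phase_mean r)%C).
  { rewrite (phase_mean_spec r Q P1). apply csum_ext. intros n _.
    now rewrite theta_phase_chirp, E, EP, EQ. }
  assert (G2 : gauss_sum Q P = (INR P * phase_mean (/ r))%C).
  { rewrite (phase_mean_spec _ P P2). apply csum_ext. intros n _.
    rewrite theta_phase_chirp, E, EP, EQ. f_equal. field. lra. }
  rewrite G1, G2, Cmult_conj, Cconj_RtoC, <- (phase_mean_opp _ _ P2) in Hrec.
  rewrite Csqrt_Ci_div by easy.
  replace (/ (2 * r)) with (INR Q / (2 * INR P)) by (rewrite E, EP, EQ; field; lra).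
  assert (HQ : RtoC (INR Q) <> 0) by (apply RtoC_neq_0; lra).
  transitivity (/ INR Q * (INR Q * phase_mean (- / r)))%C; [field; easy|].
  transitivity (/ INR Q * (RtoC (sqrt (INR Q / (2 * INR P))) * (1 - Ci) * (INR Q * phase_mean r)))%C;
    [|field; easy].
  f_equal. rewrite Hrec.
  set (s := sqrt (INR Q / (2 * INR P))).
  (* [(1 - i) (1 + i) = 2] and [s^2 P = Q / 2], so the factor of reciprocity and that of the square
     root cancel to [Q]. *)
  transitivity ((1 - Ci * Ci) * (RtoC (s * s * INR P)) * phase_mean (- / r))%C.
  2:{ rewrite !RtoC_mult. ring. }
  unfold s. rewrite sqrt_def.
  - replace (INR Q / (2 * INR P) * INR P) with (INR Q / 2) by (field; lra).
    replace (1 - Ci * Ci)%C with (RtoC 2) by (apply C_ext; simpl; ring).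
    rewrite <- RtoC_mult. do 2 f_equal. field.
  - apply Rdiv_le_0_compat; lra.
Qed.

Lemma theta_equations_phase_mean : theta_equations phase_mean.
Proof.
  assert (per : forall r, S0 r -> exists q, phase_period r q).
  { intros r Hr. apply S0_iff_parity_rational in Hr.
    destruct Hr as (p & q & Hq & Ho & ->). exists (Z.to_nat q).
    now apply phase_period_rational. }
  split; [|split].
  - apply (phase_mean_unique 0 1).
    + split; [lia|]. intros n. rewrite !theta_phase_chirp. unfold chirp.
      now rewrite Rmult_0_r, !Rmult_0_l.
    + simpl. rewrite theta_phase_chirp. unfold chirp.
      rewrite Rmult_0_r, !Rmult_0_l, cis_0. ring.
  - intros r Hr. destruct (per r Hr) as [q Hq].
    apply (phase_mean_unique _ q).
    + split; [apply Hq|]. intros n. now rewrite !theta_phase_add_2, (proj2 Hq).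
    + rewrite (phase_mean_spec r q Hq). apply csum_ext. intros n _.
      now rewrite theta_phase_add_2.
  - intros r Hr H0. apply S0_iff_parity_rational in Hr.
    destruct (Rlt_le_dec 0 r) as [Hp | Hn]; [now apply phase_mean_inv_pos|].
    (* For negative [r], the identity at [- r] is conjugated. *)
    set (s := - r). assert (Hs : 0 < s) by (unfold s; lra).
    replace r with (- s) in * by (unfold s; ring). clearbody s.
    assert (Hpar : parity_rational s).
    { destruct Hr as (p & q & Hq & Ho & E). exists (- p)%Z, q. split; [easy|]. split.
      - replace (- p + q)%Z with (p + q + 2 * (- p))%Z by ring. now rewrite Z.odd_add_mul_2.
      - rewrite opp_IZR. replace s with (- - s) by ring. rewrite E. field.
        apply IZR_lt in Hq. lra. }
    assert (Hinv : parity_rational (- / s)) by (apply parity_rational_inv; [lra | easy]).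
    destruct (per _ (proj2 (S0_iff_parity_rational _) Hpar)) as [q Hq].
    destruct (per _ (proj2 (S0_iff_parity_rational _) Hinv)) as [q' Hq'].
    replace (/ - s) with (- / s) by (field; lra).
    rewrite (phase_mean_opp _ _ Hq'), phase_mean_inv_pos by easy.
    rewrite Csqrt_Ci_div_opp, (phase_mean_opp _ _ Hq), Cmult_conj by easy. easy.
Qed.

Lemma theta_p_equations : theta_equations theta_p.
Proof.
  exact (epsilon_spec _ theta_equations (ex_intro _ phase_mean theta_equations_phase_mean)).
Qed.

Lemma theta_p_mean (r : R) :
  S0 r -> exists q, phase_period r q /\ (INR q * theta_p r)%C = csum (theta_phase r) q.
Proof.
  intros Hr.
  rewrite (theta_equations_unique _ _ theta_p_equations theta_equations_phase_mean r Hr).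
  apply S0_iff_parity_rational in Hr. destruct Hr as (p & q & Hq & Ho & ->).
  exists (Z.to_nat q). assert (H := phase_period_rational p q Hq Ho).
  split; [easy | now apply phase_mean_spec].
Qed.

(** * Riesz means of periodic functions *)

(** Periodicity is asked on the half-line only, because the point masses sit at [n >= 1] and the
    second primitive is a plain quadratic to their left. Continuity holds on the whole line, so that
    primitives are differentiable everywhere. *)
Record mean_zero_periodic (q : nat) (phi : R -> C) : Prop := {
  mzp_cont : forall x, contC phi x;
  mzp_period : forall x, 0 <= x -> phi (x + INR q) = phi x;
  mzp_mean : CRInt phi 0 (INR q) = 0 }.

(** The mean zero of [phi] makes its primitive periodic, and the constant restores mean zero, so the
    operation can be iterated. *)
Definition primitive (q : nat) (phi : R -> C) (x : R) : C :=
  (CRInt phi 0 x - / INR q * CRInt (CRInt phi 0) 0 (INR q))%C.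

Lemma is_derC_CRInt (phi : R -> C) (a x : R) :
  (forall x, contC phi x) -> is_derC (fun y => CRInt phi a y) x (phi x).
Proof.
  intros H. apply (@is_derive_RInt C_R_NormedModule phi _ a x).
  - apply filter_forall. intros y. apply is_intC_cont. intros; apply H.
  - apply H.
Qed.

Lemma is_derC_primitive (q : nat) (phi : R -> C) (x : R) :
  (forall x, contC phi x) -> is_derC (primitive q phi) x (phi x).
Proof.
  intros H. eapply is_derC_eq.
  - apply is_derC_plus; [now apply is_derC_CRInt | apply is_derC_const].
  - ring.
Qed.

Lemma is_intC_periodic_shift (q : nat) (phi : R -> C) (a b : R) (l : C) :
  (forall x, 0 <= x -> phi (x + INR q) = phi x) -> 0 <= a <= b ->
  is_intC phi (a + INR q) (b + INR q) l -> is_intC phi a b l.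
Proof.
  intros H Hab Hl. eapply is_intC_ext; [|apply (is_intC_shift _ _ _ _ _ Hl)].
  intros x Hx. rewrite Rmin_left in Hx by lra. apply H. lra.
Qed.

Lemma mean_zero_periodic_primitive (q : nat) (phi : R -> C) :
  (0 < q)%nat -> mean_zero_periodic q phi -> mean_zero_periodic q (primitive q phi).
Proof.
  intros Hq [Hc Hp Hm]. assert (Hq' := lt_0_INR q Hq).
  assert (Hex : forall a b, is_intC phi a b (CRInt phi a b)).
  { intros a b. apply is_intC_cont. intros; apply Hc. }
  assert (Hcp : forall x, contC (fun y => CRInt phi 0 y) x).
  { intros x. eapply is_derC_contC, is_derC_CRInt, Hc. }
  split.
  - intros x. eapply is_derC_contC, is_derC_primitive, Hc.
  - intros x Hx. unfold primitive. f_equal.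
    apply is_intC_CRInt. eapply is_intC_eq.
    + apply (@is_RInt_Chasles C_R_NormedModule _ _ (INR q)); apply Hex.
    + rewrite Hm.
      assert (H := is_intC_periodic_shift q phi 0 x _ Hp (conj (Rle_refl 0) Hx) (Hex _ _)).
      rewrite Rplus_0_l in H. rewrite <- (is_intC_CRInt _ _ _ _ H). apply Cplus_0_l.
  - apply is_intC_CRInt. eapply is_intC_eq.
    + apply is_intC_minus; [apply is_intC_cont; intros; apply Hcp | apply is_intC_const].
    + rewrite Rminus_0_r. field. apply RtoC_neq_0. lra.
Qed.

Lemma mean_zero_periodic_bounded (q : nat) (phi : R -> C) :
  (0 < q)%nat -> mean_zero_periodic q phi ->
  exists M, 0 <= M /\ forall x, 0 <= x -> Cmod (phi x) <= M.
Proof.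
  intros Hq [Hc Hp _]. assert (Hq' := lt_0_INR q Hq).
  destruct (@bounded_continuity R_AbsRing C_R_NormedModule phi 0 (INR q)
    (fun x _ => Hc x)) as [M HM].
  assert (H0 : forall x, 0 <= x <= INR q -> Cmod (phi x) <= M).
  { intros x Hx. left. rewrite <- norm_C_R. now apply HM. }
  exists M. split.
  { eapply Rle_trans; [apply Cmod_ge_0|]. apply (H0 0). lra. }
  assert (Hn : forall n x, 0 <= x <= INR n * INR q -> Cmod (phi x) <= M).
  { induction n as [|n IH]; intros x Hx.
    - simpl in Hx. apply H0. lra.
    - destruct (Rle_dec x (INR q)) as [H | H]; [apply H0; lra|].
      rewrite S_INR in Hx.
      replace x with (x - INR q + INR q) by ring. rewrite Hp by lra. apply IH. lra. }
  intros x Hx. destruct (nfloor_ex (x / INR q)) as [n Hn'].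
  { now apply Rdiv_le_0_compat. }
  apply (Hn (S n)). split; [easy|]. rewrite S_INR.
  apply Rle_div_l; lra.
Qed.

Lemma exp_le_compat (a b : R) : a <= b -> exp a <= exp b.
Proof. intros [H | ->]; [left; now apply exp_increasing | apply Rle_refl]. Qed.

Lemma pow_exp_ln (u : R) (n : nat) : 0 < u -> u ^ n = exp (INR n * ln u).
Proof. intros H. now rewrite <- Rpower_pow. Qed.

Lemma Cmod_RCpow_opp_le (u : R) (w : C) (n : nat) :
  1 <= u -> - Re w <= INR n -> Cmod (RCpow u (- w)) <= u ^ n.
Proof.
  intros Hu Hw. rewrite Cmod_RCpow, pow_exp_ln by lra. apply exp_le_compat.
  apply Rmult_le_compat_r; [|now destruct w].
  rewrite <- ln_1. apply ln_le; lra.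
Qed.

Lemma Cmod_RCpow_opp_le_inv (u : R) (w : C) (n : nat) :
  1 <= u -> INR n <= Re w -> Cmod (RCpow u (- w)) <= / u ^ n.
Proof.
  intros Hu Hw. rewrite Cmod_RCpow, pow_exp_ln, <- exp_Ropp by lra. apply exp_le_compat.
  rewrite Ropp_mult_distr_l. apply Rmult_le_compat_r.
  - rewrite <- ln_1. apply ln_le; lra.
  - destruct w. simpl in *. lra.
Qed.

Lemma is_RInt_inv_sq (K a b : R) :
  0 < a <= b -> is_RInt (fun u => K / u ^ 2) a b (K / a - K / b).
Proof.
  intros Hab. replace (K / a - K / b) with (- K / b - - K / a) by (field; lra).
  apply (@is_RInt_derive R_CompleteNormedModule (fun u => - K / u)).
  - intros t Ht. rewrite Rmin_left in Ht by lra. auto_derive; [lra|]. simpl. field. lra.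
  - intros t Ht. rewrite Rmin_left in Ht by lra.
    apply (@ex_derive_continuous R_AbsRing R_NormedModule). auto_derive.
    apply Rmult_integral_contrapositive. split; lra.
Qed.

(** * Riesz kernels and their integration by parts *)

Definition kern (x : R) (j : nat) (w : C) (u : R) : C :=
  (RtoC ((x - u) ^ j) * RCpow u (- w))%C.

(** For [j = 0] the convention [pred 0 = 0] is harmless, as the term carries the factor [INR j]. *)
Lemma is_derC_kern (x : R) (j : nat) (w : C) (u : R) :
  0 < u ->
  is_derC (kern x j w) u (- INR j * kern x (pred j) w u - w * kern x j (w + 1) u)%C.
Proof.
  intros Hu. unfold kern. eapply is_derC_eq.
  - apply is_derC_mult; [|now apply is_derC_RCpow].
    apply is_derC_RtoC. instantiate (1 := - INR j * (x - u) ^ pred j).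
    auto_derive; [easy|]. unfold Rminus. ring.
  - rewrite RtoC_mult, RtoC_opp. replace (- (w + 1))%C with (- w - 1)%C by ring. ring.
Qed.

Lemma contC_kern (x : R) (j : nat) (w : C) (u : R) : 0 < u -> contC (kern x j w) u.
Proof. intros H. eapply is_derC_contC. now apply is_derC_kern. Qed.

Definition riesz_int (j : nat) (w : C) (phi : R -> C) (x : R) : C :=
  CRInt (fun u => phi u * kern x j w u)%C 1 x.

Lemma is_intC_riesz_int (j : nat) (w : C) (phi : R -> C) (x : R) :
  1 <= x -> (forall u, contC phi u) ->
  is_intC (fun u => phi u * kern x j w u)%C 1 x (riesz_int j w phi x).
Proof.
  intros Hx H. apply is_intC_cont. intros u Hu. rewrite Rmin_left in Hu by lra.
  apply contC_mult; [apply H | apply contC_kern; lra].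
Qed.

(** The factor [0 ^ j] is the weight at [u = x]; it keeps the boundary term when [j = 0] and removes
    it otherwise, so one formula covers both cases. *)
Lemma riesz_int_by_parts (q j : nat) (w : C) (phi : R -> C) (x : R) :
  1 <= x -> (forall u, contC phi u) ->
  riesz_int j w phi x =
  (primitive q phi x * RtoC (0 ^ j) * RCpow x (- w) - primitive q phi 1 * RtoC ((x - 1) ^ j)
   + INR j * riesz_int (pred j) w (primitive q phi) x
   + w * riesz_int j (w + 1) (primitive q phi) x)%C.
Proof.
  intros Hx Hc. set (Phi := primitive q phi).
  assert (HcP : forall u, contC Phi u).
  { intros u. eapply is_derC_contC, is_derC_primitive, Hc. }
  assert (Hpos : forall u, Rmin 1 x <= u <= Rmax 1 x -> 0 < u).
  { intros u Hu. rewrite Rmin_left in Hu by lra. lra. }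
  assert (H1 := is_intC_scal (- INR j)%C _ _ _ _ (is_intC_riesz_int (pred j) w Phi x Hx HcP)).
  assert (H2 := is_intC_scal (- w)%C _ _ _ _ (is_intC_riesz_int j (w + 1) Phi x Hx HcP)).
  assert (H3 := is_intC_plus _ _ _ _ _ _ H1 H2).
  apply is_intC_CRInt.
  eapply is_intC_eq.
  - apply (is_intC_by_parts Phi phi (kern x j w)
      (fun u => - INR j * kern x (pred j) w u - w * kern x j (w + 1) u)%C).
    + intros u _. now apply is_derC_primitive.
    + intros u Hu. apply is_derC_kern. now apply Hpos.
    + intros u _. apply Hc.
    + intros u Hu. apply Hpos in Hu.
      apply contC_minus; apply contC_mult; try apply contC_const; now apply contC_kern.
    + eapply is_intC_ext; [|exact H3]. intros u _. simpl. ring.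
  - unfold kern at 1 2. rewrite RCpow_1_l, Rminus_diag. ring.
Qed.

Lemma riesz_int_bound_2 (q : nat) (phi : R -> C) (w : C) (j : nat) :
  (0 < q)%nat -> mean_zero_periodic q phi -> 2 <= Re w ->
  exists K, 0 <= K /\ forall x, 1 <= x -> Cmod (riesz_int j w phi x) <= K * x ^ j.
Proof.
  intros Hq Hphi Hw. destruct (mean_zero_periodic_bounded q phi Hq Hphi) as (M & HM0 & HM).
  exists M. split; [easy|]. intros x Hx.
  assert (Hxj : 0 <= x ^ j) by (apply pow_le; lra).
  apply Rle_trans with (M * x ^ j / 1 - M * x ^ j / x).
  - apply (is_intC_bound (fun u => phi u * kern x j w u)%C (fun u => M * x ^ j / u ^ 2) 1 x).
    + easy.
    + intros u Hu. unfold kern. rewrite !Cmod_mult, Cmod_R.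
      assert (H1 := HM u ltac:(lra)).
      assert (H2 := Cmod_RCpow_opp_le_inv u w 2 ltac:(lra) ltac:(simpl; lra)).
      rewrite Rabs_pos_eq by (apply pow_le; lra).
      assert (H3 : (x - u) ^ j <= x ^ j) by (apply pow_incr; lra).
      unfold Rdiv. rewrite Rmult_assoc.
      apply Rmult_le_compat; try easy; try apply Cmod_ge_0.
      * apply Rmult_le_pos; [apply pow_le; lra | apply Cmod_ge_0].
      * apply Rmult_le_compat; try easy; [apply pow_le; lra | apply Cmod_ge_0].
    + apply is_intC_riesz_int; [easy | apply Hphi].
    + apply is_RInt_inv_sq. lra.
  - assert (0 <= M * x ^ j / x).
    { apply Rdiv_le_0_compat; [now apply Rmult_le_pos | lra]. }
    lra.
Qed.

(** Each integration by parts trades one unit of decay of [u ^ (- w)] for a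
    lower power of [x - u]. *)
Lemma riesz_int_bound (q M j : nat) (phi : R -> C) (w : C) :
  (0 < q)%nat -> mean_zero_periodic q phi -> 2 - INR M <= Re w ->
  exists K, 0 <= K /\
    forall x, 1 <= x -> Cmod (riesz_int j w phi x) <= K * x ^ Nat.max j M.
Proof.
  (* The outer induction takes care of the term with exponent [w + 1], the inner one on [j], at
     fixed [w], of the term with lower power. Both apply to the primitive, hence [phi] stays
     general. *)
  intros Hq. revert j phi w. induction M as [|M IHM]; intros j phi w Hphi Hw.
  { rewrite Nat.max_0_r. apply (riesz_int_bound_2 q); try easy. simpl in Hw. lra. }
  rewrite S_INR in Hw. revert phi Hphi. induction j as [|j IHj]; intros phi Hphi.
  - set (Phi := primitive q phi).
    assert (HPhi : mean_zero_periodic q Phi) by now apply mean_zero_periodic_primitive.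
    destruct (mean_zero_periodic_bounded q Phi Hq HPhi) as (B & HB0 & HB).
    destruct (IHM 0%nat Phi (w + 1)%C HPhi) as (K & HK0 & HK).
    { destruct w; simpl in *; lra. }
    assert (Hcw := Cmod_ge_0 w).
    exists (B + B + Cmod w * K). split; [nra|].
    intros x Hx. rewrite (riesz_int_by_parts q) by (easy || apply Hphi). fold Phi.
    simpl (INR 0). rewrite !pow_O, Nat.max_0_l.
    replace (Phi x * 1 * RCpow x (- w) - Phi 1%R * 1 + 0 * riesz_int (Init.Nat.pred 0) w Phi x +
      w * riesz_int 0 (w + 1) Phi x)%C with
      (Phi x * RCpow x (- w) - Phi 1%R + w * riesz_int 0 (w + 1) Phi x)%C by ring.
    eapply Rle_trans; [apply Cmod_triangle|].
    eapply Rle_trans; [apply Rplus_le_compat_r, Cmod_triangle_sub|].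
    rewrite !Cmod_mult.
    assert (H1 := HB x ltac:(lra)). assert (H2 := HB 1 ltac:(lra)).
    assert (H3 := HK x Hx). rewrite Nat.max_0_l in H3.
    assert (H4 : x ^ M <= x ^ S M) by (apply Rle_pow; [easy | lia]).
    assert (H5 : 1 <= x ^ S M) by (apply pow_R1_Rle; easy).
    assert (H6 : Cmod (RCpow x (- w)) <= x ^ S M).
    { apply Cmod_RCpow_opp_le; [easy|]. rewrite S_INR. lra. }
    assert (H7 : Cmod (Phi x) * Cmod (RCpow x (- w)) <= B * x ^ S M).
    { apply Rmult_le_compat; try easy; apply Cmod_ge_0. }
    assert (H8 : Cmod w * Cmod (riesz_int 0 (w + 1) Phi x) <= Cmod w * K * x ^ S M).
    { rewrite Rmult_assoc. apply Rmult_le_compat_l; [easy|]. nra. }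
    nra.
  - set (Phi := primitive q phi).
    assert (HPhi : mean_zero_periodic q Phi) by now apply mean_zero_periodic_primitive.
    destruct (IHM (S j) Phi (w + 1)%C HPhi) as (K & HK0 & HK).
    { destruct w; simpl in *; lra. }
    destruct (IHj Phi HPhi) as (K' & HK'0 & HK').
    assert (Hcw := Cmod_ge_0 w). assert (HcP := Cmod_ge_0 (Phi 1)).
    assert (Hj := pos_INR (S j)).
    exists (Cmod (Phi 1) + INR (S j) * K' + Cmod w * K).
    assert (0 <= INR (S j) * K') by now apply Rmult_le_pos.
    assert (0 <= Cmod w * K) by now apply Rmult_le_pos.
    split; [lra|].
    intros x Hx. rewrite (riesz_int_by_parts q) by (easy || apply Hphi). fold Phi.
    rewrite pow_i by lia. change (Init.Nat.pred (S j)) with j.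
    replace (Phi x * 0 * RCpow x (- w) - Phi 1%R * RtoC ((x - 1) ^ S j) +
      INR (S j) * riesz_int j w Phi x + w * riesz_int (S j) (w + 1) Phi x)%C with
      (- (Phi 1%R * RtoC ((x - 1) ^ S j)) + INR (S j) * riesz_int j w Phi x
        + w * riesz_int (S j) (w + 1) Phi x)%C by ring.
    eapply Rle_trans; [apply Cmod_triangle|].
    eapply Rle_trans; [apply Rplus_le_compat_r, Cmod_triangle|].
    rewrite Cmod_opp, !Cmod_mult, !Cmod_R.
    rewrite (Rabs_pos_eq (INR (S j))) by easy.
    rewrite (Rabs_pos_eq (_ ^ _)) by (apply pow_le; lra).
    set (X := x ^ Nat.max (S j) (S M)).
    assert (H1 := HK x Hx). assert (H2 := HK' x Hx).
    assert (H3 : x ^ Nat.max (S j) M <= X) by (apply Rle_pow; [easy | lia]).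
    assert (H4 : x ^ Nat.max j (S M) <= X) by (apply Rle_pow; [easy | lia]).
    assert (H5 : (x - 1) ^ S j <= X).
    { apply Rle_trans with (x ^ S j); [apply pow_incr; lra|]. apply Rle_pow; [easy | lia]. }
    assert (H6 : Cmod (Phi 1) * (x - 1) ^ S j <= Cmod (Phi 1) * X) by now apply Rmult_le_compat_l.
    assert (H7 : INR (S j) * Cmod (riesz_int j w Phi x) <= INR (S j) * K' * X).
    { rewrite Rmult_assoc. apply Rmult_le_compat_l; [easy|].
      eapply Rle_trans; [exact H2|]. now apply Rmult_le_compat_l. }
    assert (H8 : Cmod w * Cmod (riesz_int (S j) (w + 1) Phi x) <= Cmod w * K * X).
    { rewrite Rmult_assoc. apply Rmult_le_compat_l; [easy|].
      eapply Rle_trans; [exact H1|]. now apply Rmult_le_compat_l. }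
    lra.
Qed.

(** * Complex differentiability *)

Notation ex_derive_CC := (@ex_derive C_AbsRing C_NormedModule).

(** Coquelicot's product and chain rules put the norm-induced uniform structure
    on the codomain [C], whereas [C_NormedModule] carries the product one. *)
Lemma ex_derive_CC_iff (f : C -> C) (z : C) :
  ex_derive_CC f z <-> @ex_derive C_AbsRing (AbsRing_NormedModule C_AbsRing) f z.
Proof.
  split; intros [l [Hl Hd]]; exists l.
  - split; [apply (@is_linear_scal_l C_AbsRing (AbsRing_NormedModule C_AbsRing))|]. exact Hd.
  - split; [apply (@is_linear_scal_l C_AbsRing C_NormedModule)|]. exact Hd.
Qed.

Lemma ex_derive_CC_const (c z : C) : ex_derive_CC (fun _ => c) z.
Proof. apply ex_derive_const. Qed.

Lemma ex_derive_CC_id (z : C) : ex_derive_CC (fun w => w) z.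
Proof. apply ex_derive_CC_iff. apply (@ex_derive_id C_AbsRing). Qed.

Lemma ex_derive_CC_plus (f g : C -> C) (z : C) :
  ex_derive_CC f z -> ex_derive_CC g z -> ex_derive_CC (fun w => f w + g w)%C z.
Proof. exact (@ex_derive_plus C_AbsRing C_NormedModule f g z). Qed.

Lemma ex_derive_CC_mult (f g : C -> C) (z : C) :
  ex_derive_CC f z -> ex_derive_CC g z -> ex_derive_CC (fun w => f w * g w)%C z.
Proof.
  rewrite !ex_derive_CC_iff. intros [a Ha] [b Hb]. eexists.
  exact (@is_derive_mult C_AbsRing f g z a b Ha Hb Cmult_comm).
Qed.

Lemma ex_derive_CC_shift (f : C -> C) (c z : C) :
  ex_derive_CC f (z + c)%C -> ex_derive_CC (fun w => f (w + c)%C) z.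
Proof.
  intros [l Hl].
  assert (H : @is_derive C_AbsRing (AbsRing_NormedModule C_AbsRing) (fun w => w + c)%C z
                (plus one zero)).
  { exact (@is_derive_plus C_AbsRing (AbsRing_NormedModule C_AbsRing) _ _ z _ _
      (@is_derive_id C_AbsRing z) (@is_derive_const C_AbsRing (AbsRing_NormedModule C_AbsRing) c z)). }
  eexists. exact (@is_derive_comp C_AbsRing C_NormedModule f (fun w => w + c)%C z _ _ Hl H).
Qed.

Lemma locally_CC (z : C) (P : C -> Prop) (d : R) :
  0 < d -> (forall w, Cmod (w - z) < d -> P w) ->
  @locally (AbsRing_UniformSpace C_AbsRing) z P.
Proof. intros Hd H. exists (mkposreal d Hd). intros w Hw. apply H. exact Hw. Qed.

Lemma ex_derive_CC_ext_loc (f g : C -> C) (z : C) (d : R) :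
  0 < d -> (forall w, Cmod (w - z) < d -> f w = g w) -> ex_derive_CC f z -> ex_derive_CC g z.
Proof.
  intros Hd H. apply (@ex_derive_ext_loc C_AbsRing C_NormedModule).
  now apply (locally_CC z _ d).
Qed.

(** A second-order bound survives passage to the limit, so an improper integral can be
    differentiated in its parameter without interchanging limit and derivative. *)
Lemma ex_derive_CC_quadratic (f : C -> C) (z l : C) (M d : R) :
  0 < d -> 0 <= M ->
  (forall h, Cmod h < d -> Cmod (f (z + h)%C - f z - h * l) <= M * Cmod h ^ 2) ->
  ex_derive_CC f z.
Proof.
  intros Hd HM H. exists l. split; [apply (@is_linear_scal_l C_AbsRing C_NormedModule)|].
  intros x Hx.
  assert (E : z = x).
  { apply (@is_filter_lim_locally_unique C_AbsRing (AbsRing_NormedModule C_AbsRing)). exact Hx. }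
  subst x. intros eps. assert (He := cond_pos eps).
  set (d' := Rmin d (eps / (M + 1))).
  assert (Hd' : 0 < d').
  { apply Rmin_pos; [easy|]. apply Rdiv_lt_0_compat; lra. }
  apply (locally_CC z _ d' Hd'). intros w Hw.
  change (Cmod (f w - f z - (w - z) * l) <= eps * Cmod (w - z)).
  assert (Hw1 : Cmod (w - z) < d) by (apply Rlt_le_trans with d'; [easy | apply Rmin_l]).
  assert (Hw2 : Cmod (w - z) < eps / (M + 1)) by (apply Rlt_le_trans with d'; [easy | apply Rmin_r]).
  assert (H' := H (w - z)%C Hw1).
  replace (z + (w - z))%C with w in H' by ring.
  eapply Rle_trans; [exact H'|].
  assert (Hp := Cmod_ge_0 (w - z)).
  apply Rlt_div_r in Hw2; [|lra].
  replace (M * Cmod (w - z) ^ 2) with ((Cmod (w - z) * M) * Cmod (w - z)) by ring.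
  apply Rmult_le_compat_r; [easy | nra].
Qed.

(** With [f t = exp (t z)], the remainder is the integral of [z (f - 1)] over [[0, 1]], and [f - 1]
    is in turn an integral of [z f]. *)
Lemma Cmod_Cexp_taylor2 (z : C) : Cmod (Cexp z - 1 - z) <= Cmod z ^ 2 * exp (Cmod z).
Proof.
  set (f := fun t : R => Cexp (RtoC t * z)).
  assert (Hz := Cmod_ge_0 z).
  assert (Hd : forall t, is_derC f t (z * f t)%C).
  { intros t. eapply is_derC_eq.
    - apply is_derC_Cexp. apply (is_derC_mult _ (fun _ => z)); [|apply is_derC_const].
      apply is_derC_RtoC. apply (@is_derive_id R_AbsRing).
    - unfold f. change (RtoC one) with (RtoC 1). ring. }
  assert (Hc : forall t, contC f t) by (intros t; eapply is_derC_contC, Hd).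
  assert (Hb : forall t, 0 <= t <= 1 -> Cmod (z * f t) <= Cmod z * exp (Cmod z)).
  { intros t Ht. rewrite Cmod_mult. apply Rmult_le_compat_l; [easy|].
    unfold f. rewrite Cmod_Cexp. apply exp_le_compat.
    apply Rle_trans with (Cmod (t * z)).
    - eapply Rle_trans; [apply Rle_abs | apply re_le_Cmod].
    - rewrite Cmod_mult, Cmod_R, Rabs_pos_eq by lra. nra. }
  assert (E0 : f 0 = 1) by (unfold f; rewrite Cmult_0_l; apply Cexp_0).
  assert (Hfi : forall t, is_intC (fun s => z * f s)%C 0 t (f t - 1)%C).
  { intros t. rewrite <- E0. apply (is_intC_derive f); intros s _; [apply Hd|].
    apply contC_mult; [apply contC_const | apply Hc]. }
  assert (Hf1 : forall t, 0 <= t <= 1 -> Cmod (f t - 1) <= Cmod z * exp (Cmod z)).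
  { intros t Ht. apply Rle_trans with ((t - 0) * (Cmod z * exp (Cmod z))).
    - apply (is_intC_bound_const _ _ _ _ _ (proj1 Ht)) with (2 := Hfi t).
      intros s Hs. apply Hb. lra.
    - assert (0 <= Cmod z * exp (Cmod z)).
      { apply Rmult_le_pos; [easy | left; apply exp_pos]. }
      nra. }
  assert (Hi : is_intC (fun s => z * (f s - 1))%C 0 1 (Cexp z - 1 - z)%C).
  { eapply is_intC_ext; [|eapply is_intC_eq;
      [apply (is_intC_minus _ _ _ _ _ _ (Hfi 1) (is_intC_const z 0 1))|]].
    - intros s _. simpl. ring.
    - unfold f. rewrite Cmult_1_l. rewrite Rminus_0_r. ring. }
  replace (Cmod z ^ 2 * exp (Cmod z)) with ((1 - 0) * (Cmod z * (Cmod z * exp (Cmod z)))) by ring.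
  apply (is_intC_bound_const _ 0 1 _ _ Rle_0_1) with (2 := Hi).
  intros s Hs. rewrite Cmod_mult. apply Rmult_le_compat_l; [easy | now apply Hf1].
Qed.

Lemma limC_Cmod_le {T : Type} (F : (T -> Prop) -> Prop) {FF : ProperFilter F}
  (f : T -> C) (l : C) (M : R) :
  limC F f l -> F (fun x => Cmod (f x) <= M) -> Cmod l <= M.
Proof.
  intros Hl HM. apply Rle_plus_epsilon. intros eps He.
  destruct (filter_ex (F := F) _ (filter_and (F := F) _ _ (Hl eps He) HM)) as (x & H1 & H2).
  replace l with (f x - (f x - l))%C by ring.
  eapply Rle_trans; [apply Cmod_triangle_sub | lra].
Qed.

(** * Regularised integrals and their holomorphy *)

Definition riesz_mean (k : nat) (w : C) (phi : R -> C) (x : R) : C :=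
  (RtoC (/ x ^ k) * riesz_int k w phi x)%C.

(** Asking for all orders from some [K] on makes the limit unique: two candidates share an order at
    which they can be compared. *)
Definition is_riesz_lim (phi : R -> C) (w l : C) : Prop :=
  exists K : nat, forall k, (K <= k)%nat ->
    limC (Rbar_locally p_infty) (riesz_mean k w phi) l.

(** The regularised integral of [phi u * u ^ (- w)] over [u >= 1]. *)
Definition reg_int (phi : R -> C) (w : C) : C :=
  epsilon (inhabits (RtoC 0)) (is_riesz_lim phi w).

Lemma reg_int_unique (phi : R -> C) (w l : C) : is_riesz_lim phi w l -> reg_int phi w = l.
Proof.
  intros H.
  destruct (epsilon_spec (inhabits (RtoC 0)) (is_riesz_lim phi w) (ex_intro _ l H)) as [K HK].
  destruct H as [K' HK'].
  apply (limC_unique (Rbar_locally p_infty) (riesz_mean (Nat.max K K') w phi)).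
  - apply HK. lia.
  - apply HK'. lia.
Qed.

Lemma limC_div_infty (f : R -> C) (l : C) (K : R) :
  (forall x, 1 <= x -> Cmod (f x - l) <= K / x) -> limC (Rbar_locally p_infty) f l.
Proof.
  intros H. apply (limC_squeeze _ _ (fun x => K / x)); [|apply filterlim_div_infty].
  exists 1. intros x Hx. apply H. lra.
Qed.

(** Bernoulli's inequality, applied to the weights [(1 - u / x) ^ k]. *)
Lemma one_minus_pow_bound (s : R) (k : nat) :
  0 <= s <= 1 -> 0 <= 1 - (1 - s) ^ k <= INR k * s.
Proof.
  intros Hs. induction k as [|k IH].
  { rewrite pow_O. change (INR 0) with 0. rewrite Rmult_0_l. lra. }
  rewrite S_INR. simpl pow.
  assert (H : (1 - s) ^ k <= 1).
  { apply Rle_trans with (1 ^ k); [apply pow_incr; lra | rewrite pow1; lra]. }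
  assert (H' : 0 <= (1 - s) ^ k) by (apply pow_le; lra).
  assert (0 <= s * (1 - (1 - s) ^ k)) by (apply Rmult_le_pos; lra).
  assert (0 <= s * (1 - s) ^ k) by (apply Rmult_le_pos; lra). lra.
Qed.

Lemma improper_lim (g : R -> C) (M : R) :
  (forall u, 1 <= u -> contC g u) -> (forall u, 1 <= u -> Cmod (g u) <= M / u ^ 2) ->
  exists l, limC (Rbar_locally p_infty) (fun x => CRInt g 1 x) l.
Proof.
  intros Hc Hb.
  assert (HM : 0 <= M).
  { assert (H1 := Hb 1 (Rle_refl 1)). assert (H2 := Cmod_ge_0 (g 1)).
    replace (M / 1 ^ 2) with M in H1 by (field; lra). lra. }
  assert (Hex : forall x, 1 <= x -> is_intC g 1 x (CRInt g 1 x)).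
  { intros x Hx. apply is_intC_cont. intros u Hu. rewrite Rmin_left in Hu by lra.
    apply Hc. lra. }
  destruct (limC_tail (fun x => CRInt g 1 x) M) as [l Hl].
  { intros x y Hxy.
    assert (Hi : is_intC g x y (CRInt g 1 y - CRInt g 1 x)%C).
    { eapply is_intC_eq.
      - apply (@is_RInt_Chasles C_R_NormedModule _ x 1 y).
        + apply (@is_RInt_swap C_R_NormedModule), Hex. lra.
        + apply Hex. lra.
      - apply Cplus_comm. }
    apply Rle_trans with (M / x - M / y).
    - apply (is_intC_bound g (fun u => M / u ^ 2) x y _ _ (proj2 Hxy)) with (2 := Hi).
      + intros u Hu. apply Hb. lra.
      + apply is_RInt_inv_sq. lra.
    - assert (0 <= M / y) by (apply Rdiv_le_0_compat; lra). lra. }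
  exists l. now apply (limC_div_infty _ _ M).
Qed.

Lemma riesz_int_0 (w : C) (phi : R -> C) (x : R) :
  riesz_int 0 w phi x = CRInt (fun u => phi u * RCpow u (- w))%C 1 x.
Proof.
  apply (@RInt_ext C_R_CompleteNormedModule). intros u _. unfold kern.
  rewrite pow_O. now rewrite Cmult_1_l.
Qed.

Lemma riesz_mean_0 (w : C) (phi : R -> C) (x : R) : riesz_mean 0 w phi x = riesz_int 0 w phi x.
Proof. unfold riesz_mean. rewrite pow_O, Rinv_1. ring. Qed.

(** Replacing the weight [(1 - u / x)^k] by 1 costs at most [k u / x]. Decay [u^(-3)] pays for the
    extra factor [u] and leaves an integrable [u^(-2)]; hence the half-plane [Re w >= 3] as starting
    point. *)
Lemma riesz_mean_sub (phi : R -> C) (w : C) (M : R) (k : nat) :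
  (forall u, contC phi u) -> (forall u, 0 <= u -> Cmod (phi u) <= M) -> 3 <= Re w ->
  forall x, 1 <= x -> Cmod (riesz_mean k w phi x - riesz_int 0 w phi x) <= INR k * M / x.
Proof.
  intros Hc HM Hw x Hx.
  assert (HM0 : 0 <= M).
  { eapply Rle_trans; [apply Cmod_ge_0 | apply (HM 0); lra]. }
  assert (Hk := pos_INR k).
  assert (Hxk : x ^ k <> 0) by (apply pow_nonzero; lra).
  assert (Hi := is_intC_minus _ _ _ _ _ _
    (is_intC_scal (RtoC (/ x ^ k)) _ _ _ _ (is_intC_riesz_int k w phi x Hx Hc))
    (is_intC_riesz_int 0 w phi x Hx Hc)).
  fold (riesz_mean k w phi x) in Hi.
  apply Rle_trans with (INR k * M / x / 1 - INR k * M / x / x).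
  - apply (is_intC_bound _ (fun u => INR k * M / x / u ^ 2) 1 x _ _ Hx) with (2 := Hi).
    + intros u Hu. unfold kern. rewrite pow_O.
      replace (RtoC (/ x ^ k) * (phi u * (RtoC ((x - u) ^ k) * RCpow u (- w))) -
        phi u * (1 * RCpow u (- w)))%C with
        (- RtoC (1 - (1 - u / x) ^ k) * (phi u * RCpow u (- w)))%C.
      2:{ replace (1 - u / x) with ((x - u) * / x) by (field; lra).
          rewrite Rpow_mult_distr, pow_inv, RtoC_minus, RtoC_mult. ring. }
      rewrite Cmod_mult, Cmod_opp, Cmod_R, Cmod_mult.
      assert (Hs : 0 <= u / x <= 1).
      { split; [apply Rdiv_le_0_compat; lra | apply Rle_div_l; lra]. }
      assert (Hp := one_minus_pow_bound (u / x) k Hs).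
      rewrite Rabs_pos_eq by lra.
      assert (H2 := Cmod_RCpow_opp_le_inv u w 3 ltac:(lra) ltac:(simpl; lra)).
      apply Rle_trans with ((INR k * (u / x)) * (M * / u ^ 3)).
      * apply Rmult_le_compat; try lra.
        -- apply Rmult_le_pos; apply Cmod_ge_0.
        -- apply Rmult_le_compat; try apply Cmod_ge_0; [apply HM; lra | easy].
      * right. field. lra.
    + apply is_RInt_inv_sq. lra.
  - assert (0 <= INR k * M / x / x).
    { repeat apply Rdiv_le_0_compat; try lra. now apply Rmult_le_pos. }
    lra.
Qed.

Lemma riesz_lim_3 (q : nat) (phi : R -> C) (w : C) :
  (0 < q)%nat -> mean_zero_periodic q phi -> 3 <= Re w ->
  forall k, limC (Rbar_locally p_infty) (riesz_mean k w phi) (reg_int phi w).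
Proof.
  intros Hq Hphi Hw. destruct (mean_zero_periodic_bounded q phi Hq Hphi) as (M & HM0 & HM).
  assert (Hc := mzp_cont _ _ Hphi).
  destruct (improper_lim (fun u => phi u * RCpow u (- w))%C M) as [l Hl].
  - intros u Hu. apply contC_mult; [apply Hc | apply contC_RCpow; lra].
  - intros u Hu. rewrite Cmod_mult. apply Rmult_le_compat; try apply Cmod_ge_0.
    + apply HM. lra.
    + apply Cmod_RCpow_opp_le_inv; simpl; lra.
  - assert (H : forall k, limC (Rbar_locally p_infty) (riesz_mean k w phi) l).
    { intros k.
      assert (H1 : limC (Rbar_locally p_infty)
        (fun x => riesz_mean k w phi x - riesz_int 0 w phi x)%C 0).
      { apply (limC_div_infty _ _ (INR k * M)). intros x Hx.
        replace (riesz_mean k w phi x - riesz_int 0 w phi x - 0)%C with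
          (riesz_mean k w phi x - riesz_int 0 w phi x)%C by ring.
        now apply riesz_mean_sub. }
      assert (H2 := limC_plus _ _ _ _ _ H1 Hl). rewrite Cplus_0_l in H2.
      revert H2. apply limC_ext_loc; [apply _|]. exists 1. intros x _.
      rewrite riesz_int_0. ring. }
    rewrite (reg_int_unique phi w l); [easy|]. now exists 0%nat.
Qed.

(** The square of [s <= 4 exp (s / 4)]. With [s = ln u] it absorbs the squared logarithm of the
    Taylor remainder into [u^(1/2)]. *)
Lemma sq_ln_bound (s : R) : 0 <= s -> s ^ 2 <= 16 * exp (s / 2).
Proof.
  intros Hs. assert (H : s <= 4 * exp (s / 4)).
  { destruct (Req_dec s 0) as [-> | H0].
    - assert (H := exp_pos (0 / 4)). lra.
    - assert (H := exp_ineq1 (s / 4) ltac:(lra)). lra. }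
  replace (s / 2) with (s / 4 + s / 4) by field. rewrite exp_plus. nra.
Qed.

(** The derivative is the integral [J] of the formal derivative [dphi]. The Taylor remainder of
    [u^(-h)] is at most [16 |h|^2 u], which against [u^(-3)] is integrable uniformly in [h]. *)
Lemma ex_derive_reg_int_3 (q : nat) (phi : R -> C) (w : C) :
  (0 < q)%nat -> mean_zero_periodic q phi -> 3 < Re w -> ex_derive_CC (reg_int phi) w.
Proof.
  intros Hq Hphi Hw. destruct (mean_zero_periodic_bounded q phi Hq Hphi) as (M & HM0 & HM).
  assert (Hc := mzp_cont _ _ Hphi).
  set (dphi := fun u => (- RtoC (ln u) * (phi u * RCpow u (- w)))%C).
  assert (Hln : forall u, 1 <= u -> 0 <= ln u).
  { intros u Hu. rewrite <- ln_1. apply ln_le; lra. }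
  assert (Hexp : forall u, 1 <= u -> / u ^ 2 = exp (- (2 * ln u))).
  { intros u Hu. rewrite exp_Ropp, pow_exp_ln by lra. easy. }
  assert (Hpw : forall u, 1 <= u -> Cmod (RCpow u (- w)) <= exp (- (3 * ln u))).
  { intros u Hu. rewrite Cmod_RCpow. apply exp_le_compat.
    assert (H := Hln u Hu). destruct w. simpl in *. nra. }
  assert (Hdc : forall u, 1 <= u -> contC dphi u).
  { intros u Hu. apply contC_mult.
    - apply contC_opp, contC_RtoC.
      apply (@ex_derive_continuous R_AbsRing R_NormedModule). auto_derive. lra.
    - apply contC_mult; [apply Hc | apply contC_RCpow; lra]. }
  destruct (improper_lim dphi (4 * M)) as [J HJ]; [easy | |].
  { intros u Hu. unfold dphi. rewrite Cmod_mult, Cmod_opp, Cmod_R, Cmod_mult.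
    assert (Hl := Hln u Hu). rewrite Rabs_pos_eq by easy.
    assert (H1 : ln u <= 4 * exp (ln u)).
    { assert (H := exp_ge_taylor (ln u) 1 Hl). simpl in H. lra. }
    replace (4 * M / u ^ 2) with (4 * exp (ln u) * (M * exp (- (3 * ln u)))).
    - apply Rmult_le_compat; try easy.
      + apply Rmult_le_pos; apply Cmod_ge_0.
      + apply Rmult_le_compat; try apply Cmod_ge_0; [apply HM; lra | now apply Hpw].
    - unfold Rdiv. rewrite Hexp by easy.
      replace (- (2 * ln u)) with (ln u + - (3 * ln u)) by ring. rewrite exp_plus. ring. }
  (* The bound 1/2 gives [exp (|h| ln u) <= u^(1/2)], the other half of the available factor [u];
     the bound [Re w - 3] keeps [w + h] in the half-plane of convergence. *)
  set (d := Rmin (1 / 2) (Re w - 3)).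
  assert (Hd : 0 < d) by (apply Rmin_pos; lra).
  apply (ex_derive_CC_quadratic _ w J (16 * M) d Hd); [lra|].
  intros h Hh. assert (Hh0 := Cmod_ge_0 h).
  assert (Hh1 : Cmod h < 1 / 2) by (eapply Rlt_le_trans; [exact Hh | apply Rmin_l]).
  assert (Hh2 : Cmod h < Re w - 3) by (eapply Rlt_le_trans; [exact Hh | apply Rmin_r]).
  assert (Hwh : 3 <= Re (w + h)).
  { assert (H := re_le_Cmod h). apply Rabs_le_between in H. destruct w, h. simpl in *. lra. }
  assert (L := limC_minus (Rbar_locally p_infty) _ _ _ _
     (limC_minus (Rbar_locally p_infty) _ _ _ _ (riesz_lim_3 q phi (w + h)%C Hq Hphi Hwh 0)
        (riesz_lim_3 q phi w Hq Hphi ltac:(lra) 0))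
     (limC_scal (Rbar_locally p_infty) h _ _ HJ)).
  apply (limC_Cmod_le _ _ _ _ L).
  exists 1. intros x Hx.
  assert (Hpos : forall u, Rmin 1 x <= u <= Rmax 1 x -> 1 <= u).
  { intros u Hu. rewrite Rmin_left in Hu by lra. lra. }
  assert (Hi := is_intC_minus _ _ _ _ _ _
    (is_intC_minus _ _ _ _ _ _
       (is_intC_riesz_int 0 (w + h)%C phi x ltac:(lra) Hc)
       (is_intC_riesz_int 0 w phi x ltac:(lra) Hc))
    (is_intC_scal h _ _ _ _ (is_intC_cont dphi 1 x (fun u Hu => Hdc u (Hpos u Hu))))).
  rewrite !riesz_mean_0.
  set (K := 16 * M * Cmod h ^ 2).
  assert (HK : 0 <= K).
  { apply Rmult_le_pos; [lra | apply pow2_ge_0]. }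
  apply Rle_trans with (K / 1 - K / x).
  - apply (is_intC_bound _ (fun u => K / u ^ 2) 1 x _ _ ltac:(lra)) with (2 := Hi).
    + intros u Hu. assert (Hl := Hln u (proj1 Hu)). unfold kern, dphi. rewrite !pow_O.
      set (z := (- h * RtoC (ln u))%C).
      replace (phi u * (1 * RCpow u (- (w + h))) - phi u * (1 * RCpow u (- w)) -
        h * (- RtoC (ln u) * (phi u * RCpow u (- w))))%C with
        (phi u * RCpow u (- w) * (Cexp z - 1 - z))%C.
      2:{ replace (- (w + h))%C with (- w + - h)%C by ring. rewrite RCpow_plus.
          change (RCpow u (- h)) with (Cexp z). unfold z. ring. }
      assert (Hz : Cmod z = Cmod h * ln u).
      { unfold z. rewrite Cmod_mult, Cmod_opp, Cmod_R, Rabs_pos_eq; easy. }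
      rewrite !Cmod_mult. assert (Ht := Cmod_Cexp_taylor2 z). rewrite Hz in Ht.
      assert (Hb : (Cmod h * ln u) ^ 2 * exp (Cmod h * ln u) <=
                   16 * Cmod h ^ 2 * exp (ln u)).
      { rewrite Rpow_mult_distr.
        replace (16 * Cmod h ^ 2 * exp (ln u)) with
          (Cmod h ^ 2 * ((16 * exp (ln u / 2)) * exp (ln u / 2))).
        - rewrite Rmult_assoc. apply Rmult_le_compat_l; [apply pow2_ge_0|].
          apply Rmult_le_compat; [apply pow2_ge_0 | left; apply exp_pos | now apply sq_ln_bound|].
          apply exp_le_compat. nra.
        - replace (exp (ln u)) with (exp (ln u / 2 + ln u / 2)) by (f_equal; field).
          rewrite exp_plus. ring. }
      replace (K / u ^ 2) with
        (M * exp (- (3 * ln u)) * (16 * Cmod h ^ 2 * exp (ln u))).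
      * apply Rmult_le_compat; try apply Cmod_ge_0; [| |lra].
        -- apply Rmult_le_pos; apply Cmod_ge_0.
        -- apply Rmult_le_compat; try apply Cmod_ge_0; [apply HM; lra | apply Hpw; lra].
      * unfold Rdiv, K. rewrite Hexp by lra.
        replace (- (2 * ln u)) with (- (3 * ln u) + ln u) by ring. rewrite exp_plus. ring.
    + apply is_RInt_inv_sq. lra.
  - assert (0 <= K / x) by (apply Rdiv_le_0_compat; lra). lra.
Qed.

Lemma limC_eq {T : Type} (F : (T -> Prop) -> Prop) (f : T -> C) (l l' : C) :
  limC F f l -> l = l' -> limC F f l'.
Proof. now intros H <-. Qed.

Lemma limC_one_minus_inv_pow (k : nat) :
  limC (Rbar_locally p_infty) (fun x => RtoC ((x - 1) ^ k / x ^ k)) 1.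
Proof.
  apply (limC_div_infty _ _ (INR k)). intros x Hx.
  rewrite <- RtoC_minus, Cmod_R, Rabs_minus_sym.
  replace ((x - 1) ^ k / x ^ k) with ((1 - / x) ^ k).
  - assert (0 < / x <= 1).
    { split; [apply Rinv_0_lt_compat; lra|]. rewrite <- Rinv_1. apply Rinv_le_contravar; lra. }
    assert (H' := one_minus_pow_bound (/ x) k ltac:(lra)).
    rewrite Rabs_pos_eq; unfold Rdiv; lra.
  - replace (1 - / x) with ((x - 1) * / x) by (field; lra).
    now rewrite Rpow_mult_distr, pow_inv.
Qed.

Lemma riesz_int_small (q M j k : nat) (phi : R -> C) (w : C) :
  (0 < q)%nat -> mean_zero_periodic q phi -> 2 - INR M <= Re w ->
  (j < k)%nat -> (M < k)%nat ->
  limC (Rbar_locally p_infty) (fun x => RtoC (/ x ^ k) * riesz_int j w phi x)%C 0.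
Proof.
  intros Hq Hphi Hw Hj HM.
  destruct (riesz_int_bound q M j phi w Hq Hphi Hw) as (K & HK0 & HK).
  apply (limC_div_infty _ _ K). intros x Hx.
  match goal with |- Cmod (?a - _) <= _ => replace (a - 0)%C with a by ring end.
  rewrite Cmod_mult, Cmod_R.
  assert (Hxk : 0 < x ^ k) by (apply pow_lt; lra).
  rewrite Rabs_pos_eq by (left; now apply Rinv_0_lt_compat).
  apply Rle_trans with (/ x ^ k * (K * x ^ pred k)).
  - apply Rmult_le_compat_l; [left; now apply Rinv_0_lt_compat|].
    eapply Rle_trans; [now apply HK|]. apply Rmult_le_compat_l; [easy|].
    apply Rle_pow; [easy | lia].
  - destruct k as [|k]; [lia|]. simpl pred. simpl pow. right. field.
    split; [lra | apply pow_nonzero; lra].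
Qed.

(** Integration by parts continues [reg_int] analytically, one unit strip at a time. *)
Lemma reg_int_spec (q M : nat) :
  (0 < q)%nat -> forall phi w, mean_zero_periodic q phi -> 3 - INR M < Re w ->
  (forall k, (M <= k)%nat -> limC (Rbar_locally p_infty) (riesz_mean k w phi) (reg_int phi w)) /\
  ex_derive_CC (reg_int phi) w.
Proof.
  intros Hq. induction M as [|M IH]; intros phi w Hphi Hw.
  { simpl in Hw. split.
    - intros k _. apply (riesz_lim_3 q); try easy. lra.
    - apply (ex_derive_reg_int_3 q); try easy. lra. }
  rewrite S_INR in Hw.
  set (Phi := primitive q phi).
  assert (HPhi : mean_zero_periodic q Phi) by now apply mean_zero_periodic_primitive.
  (* The value forced by integration by parts: the boundary term at 1 survives division by [x^k],
     the integral of order [k - 1] does not. *)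
  set (L := fun v => (- Phi 1%R + v * reg_int Phi (v + 1))%C).
  assert (Hre : forall v, Re (v + 1) = Re v + 1) by now intros [].
  assert (HL : forall v, 2 - INR M < Re v -> forall k, (S M <= k)%nat ->
            limC (Rbar_locally p_infty) (riesz_mean k v phi) (L v)).
  { intros v Hv k Hk.
    assert (H1 := limC_one_minus_inv_pow k).
    assert (H2 := riesz_int_small q M (pred k) k Phi v Hq HPhi ltac:(lra) ltac:(lia) ltac:(lia)).
    destruct (IH Phi (v + 1)%C HPhi) as [H3 _]; [rewrite Hre; lra|].
    specialize (H3 k ltac:(lia)).
    assert (H := limC_plus _ _ _ _ _
      (limC_plus (Rbar_locally p_infty) _ _ _ _
        (limC_scal (Rbar_locally p_infty) (- Phi 1)%C _ _ H1)
        (limC_scal (Rbar_locally p_infty) (INR k) _ _ H2))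
      (limC_scal (Rbar_locally p_infty) v _ _ H3)).
    refine (limC_eq _ _ _ _ (limC_ext_loc (Rbar_locally p_infty) _ _ _ _ H) _).
    - exists 1. intros x Hx.
      unfold riesz_mean. rewrite (riesz_int_by_parts q k v phi) by (lra || apply Hphi).
      fold Phi. rewrite pow_i by lia. unfold Rdiv. rewrite RtoC_mult. ring.
    - unfold L. ring. }
  assert (HE : forall v, 2 - INR M < Re v -> reg_int phi v = L v).
  { intros v Hv. apply reg_int_unique. exists (S M). now apply HL. }
  split.
  - intros k Hk. rewrite HE by lra. apply HL; [lra | easy].
  (* The recursion holds on the open half-plane [Re v > 2 - M]; the radius is the distance from [w]
     to its boundary. *)
  - apply (ex_derive_CC_ext_loc L _ w (Re w - (2 - INR M))); [lra| |].
    + intros v Hv. symmetry. apply HE.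
      assert (H := re_le_Cmod (v - w)). apply Rabs_le_between in H.
      replace (Re (v - w)) with (Re v - Re w) in H by (now destruct v, w). lra.
    + apply ex_derive_CC_plus; [apply ex_derive_CC_const|].
      apply ex_derive_CC_mult; [apply ex_derive_CC_id|].
      apply (ex_derive_CC_shift (reg_int Phi) 1 w).
      apply (IH Phi (w + 1)%C HPhi). rewrite Hre. lra.
Qed.

(** * The piecewise quadratic second primitive and Euler-Maclaurin summation *)

Lemma Rmax_0_abs (t : R) : Rmax 0 t = (t + Rabs t) / 2.
Proof.
  unfold Rmax. destruct (Rle_dec 0 t).
  - rewrite Rabs_pos_eq; lra.
  - rewrite Rabs_left; lra.
Qed.

Lemma contC_hinge (c x : R) : contC (fun u => RtoC (Rmax 0 (u - c))) x.
Proof.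
  apply contC_RtoC.
  apply (continuous_ext (fun u => / 2 * ((u - c) + Rabs (u - c)))).
  - intros u. rewrite Rmax_0_abs. simpl. field.
  - assert (H : continuous (fun u => u - c) x).
    { apply (@ex_derive_continuous R_AbsRing R_NormedModule). now auto_derive. }
    apply (continuous_scal_r (K := R_AbsRing) (V := R_NormedModule)).
    apply (continuous_plus (V := R_NormedModule)); [exact H|].
    apply (continuous_comp (fun u => u - c) Rabs x H), continuous_Rabs.
Qed.

Lemma contC_csum (f : nat -> R -> C) (n : nat) (x : R) :
  (forall i, contC (f i) x) -> contC (fun u => csum (fun i => f i u) n) x.
Proof.
  intros H. induction n as [|n IH]; simpl.
  - apply contC_const.
  - now apply contC_plus.
Qed.

Lemma csum_extend (f : nat -> C) (n m : nat) :
  (n <= m)%nat -> (forall i, (n <= i)%nat -> f i = 0) -> csum f m = csum f n.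
Proof.
  intros Hnm H. replace m with (n + (m - n))%nat by lia. rewrite csum_add.
  rewrite (csum_zero (fun i => f (n + i)%nat)); [ring|].
  intros i _. apply H. lia.
Qed.

(** A hinge [max (0, u - n)] is a second primitive of the Dirac mass at [n]; the masses start at
    [n = 1]. *)
Definition hinge_sum (f : nat -> C) (N : nat) (u : R) : C :=
  csum (fun i => f (S i) * RtoC (Rmax 0 (u - INR (S i))))%C N.

(** Hinges placed at or beyond [u] vanish at [u]. The infinite sum is thus represented by any long
    enough truncation, and no limit is taken. *)
Lemma hinge_sum_stable (f : nat -> C) (N N' : nat) (u : R) :
  u <= INR N + 1 -> u <= INR N' + 1 -> hinge_sum f N u = hinge_sum f N' u.
Proof.
  intros H H'.
  assert (E : forall n, u <= INR n + 1 -> hinge_sum f (Nat.max N N') u = hinge_sum f n u \/ (Nat.max N N' < n)%nat).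
  { intros n Hn. destruct (le_lt_dec n (Nat.max N N')); [left | now right].
    apply csum_extend; [easy|]. intros i Hi.
    rewrite Rmax_left; [ring|]. rewrite S_INR. apply le_INR in Hi. lra. }
  destruct (E N H) as [E1 | ?]; [|lia]. destruct (E N' H') as [E2 | ?]; [|lia]. congruence.
Qed.

Lemma INR_up_ge (u : R) : u <= INR (Z.to_nat (up u)).
Proof.
  destruct (archimed u) as [H _]. destruct (Z_le_gt_dec 0 (up u)) as [H0 | H0].
  - rewrite INR_IZR_INZ, Z2Nat.id by easy. lra.
  - assert (IZR (up u) < 0) by (apply IZR_lt; lia).
    assert (H2 := pos_INR (Z.to_nat (up u))). lra.
Qed.

(** A periodic mean-zero [S1] whose second derivative is, as a distribution on
    [u >= 0], the sum of [f n] times the Dirac mass at [n >= 1], minus [m]. *)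
Lemma second_primitive_exists (f : nat -> C) (q : nat) (m : C) :
  (0 < q)%nat -> (forall n, f (n + q)%nat = f n) -> csum f q = (INR q * m)%C ->
  exists (S1 : R -> C) (al be : C), mean_zero_periodic q S1 /\
    forall N u, u <= INR N + 1 ->
      S1 u = (hinge_sum f N u + (- (m / 2) * RtoC (u ^ 2) + al * RtoC u + be))%C.
Proof.
  intros Hq Hf Hm. assert (Hq' := lt_0_INR q Hq).
  assert (Hq0 : RtoC (INR q) <> 0) by (apply RtoC_neq_0; lra).
  (* The mean is given over [0, ..., q - 1] while the hinges start at 1; periodicity moves the
     window. *)
  assert (Hm' : csum (fun i => f (S i)) q = (INR q * m)%C).
  { rewrite <- Hm. assert (H := csum_succ_l f q). simpl csum in H.
    rewrite <- (Hf O) in H. simpl in H.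
    replace (csum (fun i => f (S i)) q) with (f q + csum (fun i => f (S i)) q - f q)%C by ring.
    rewrite <- H. ring. }
  (* Over one period the hinges grow by [m q u + ga] and the quadratic term by
     [- m q u - m q^2 / 2]; [al] is the slope that cancels the remaining constant. *)
  set (ga := csum (fun i => f (S i) * RtoC (INR q - INR (S i)))%C q).
  set (al := (m * INR q / 2 - ga / INR q)%C).
  set (V := fun u => (hinge_sum f (Z.to_nat (up u)) u + (- (m / 2) * RtoC (u ^ 2) + al * RtoC u))%C).
  assert (HV : forall N u, u <= INR N + 1 ->
     V u = (hinge_sum f N u + (- (m / 2) * RtoC (u ^ 2) + al * RtoC u))%C).
  { intros N u Hu. unfold V. f_equal. apply hinge_sum_stable; [|easy].
    assert (H := INR_up_ge u). lra. }
  assert (HVc : forall u, contC V u).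
  { intros u. set (N := S (Z.to_nat (up u))).
    apply (contC_ext_loc (fun t => hinge_sum f N t + (- (m / 2) * RtoC (t ^ 2) + al * RtoC t))%C).
    - exists (mkposreal 1 Rlt_0_1). intros t Ht. symmetry. apply HV.
      apply Rabs_def2 in Ht. unfold minus, plus, opp in Ht. simpl in Ht.
      unfold N. rewrite S_INR. assert (H := INR_up_ge u). lra.
    - apply contC_plus.
      + apply contC_csum. intros i. apply contC_mult; [apply contC_const | apply contC_hinge].
      + apply contC_plus; apply contC_mult; try apply contC_const; apply contC_RtoC;
          apply (@ex_derive_continuous R_AbsRing R_NormedModule); now auto_derive. }
  assert (HVp : forall u, 0 <= u -> V (u + INR q) = V u).
  { intros u Hu. set (N := Z.to_nat (up u)).
    assert (HN : u <= INR N) by apply INR_up_ge.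
    rewrite (HV (q + N)%nat) by (rewrite plus_INR; lra). rewrite (HV N u) by lra.
    unfold hinge_sum at 1. rewrite csum_add.
    rewrite (csum_ext _ (fun i => RtoC u * f (S i) + f (S i) * RtoC (INR q - INR (S i)))%C q).
    2:{ intros i Hi. rewrite Rmax_right.
        - replace (u + INR q - INR (S i)) with (u + (INR q - INR (S i))) by ring.
          rewrite RtoC_plus. ring.
        - assert (INR (S i) <= INR q) by (apply le_INR; lia). lra. }
    rewrite csum_plus, csum_scal, Hm'. fold ga.
    rewrite (csum_ext _ (fun i => f (S i) * RtoC (Rmax 0 (u - INR (S i))))%C N).
    2:{ intros i Hi. replace (S (q + i)) with (S i + q)%nat by lia. rewrite Hf.
        do 3 f_equal. rewrite plus_INR. ring. }
    fold (hinge_sum f N u). unfold al.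
    replace ((u + INR q) ^ 2) with (u ^ 2 + 2 * u * INR q + INR q * INR q) by ring.
    rewrite !RtoC_plus, !RtoC_mult. field. easy. }
  set (be := (- (/ INR q * CRInt V 0 (INR q)))%C).
  exists (fun u => V u + be)%C, al, be. split; [split|].
  - intros u. apply contC_plus; [apply HVc | apply contC_const].
  - intros u Hu. now rewrite HVp.
  - apply is_intC_CRInt. eapply is_intC_eq.
    + apply is_intC_plus; [apply is_intC_cont; intros; apply HVc | apply is_intC_const].
    + unfold be. rewrite Rminus_0_r. field. easy.
  - intros N u Hu. rewrite (HV N u Hu). ring.
Qed.

(** The integral is split at the kink: the integrand is 0 before [c] and the derivative of
    [(u - c) * dg u - g u] after it. The value [g c] is the trace of the Dirac mass. *)
Lemma is_intC_hinge (c X : R) (g dg ddg : R -> C) :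
  1 <= c <= X ->
  (forall u, 1 <= u <= X -> is_derC g u (dg u)) ->
  (forall u, 1 <= u <= X -> is_derC dg u (ddg u)) ->
  (forall u, 1 <= u <= X -> contC ddg u) ->
  is_intC (fun u => RtoC (Rmax 0 (u - c)) * ddg u)%C 1 X
    (RtoC (X - c) * dg X - g X + g c)%C.
Proof.
  intros Hc Hg Hdg Hddg.
  assert (H1 : is_intC (fun u => RtoC (Rmax 0 (u - c)) * ddg u)%C 1 c (RtoC 0)).
  { eapply is_intC_ext; [|eapply is_intC_eq; [apply (is_intC_const 0)|]].
    - intros u Hu. rewrite Rmax_right in Hu by lra. simpl.
      rewrite Rmax_left by lra. ring.
    - ring. }
  assert (H2 : is_intC (fun u => RtoC (Rmax 0 (u - c)) * ddg u)%C c X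
     ((RtoC (X - c) * dg X - g X) - (RtoC (c - c) * dg c - g c))%C).
  { eapply is_intC_ext; [|apply (is_intC_derive (fun u => RtoC (u - c) * dg u - g u)%C
       (fun u => RtoC (u - c) * ddg u)%C)].
    - intros u Hu. rewrite Rmin_left in Hu by lra. simpl. rewrite Rmax_right by lra. easy.
    - intros u Hu. rewrite Rmin_left, Rmax_right in Hu by lra.
      eapply is_derC_eq.
      + apply is_derC_minus; [|apply Hg; lra].
        apply is_derC_mult; [|apply Hdg; lra]. apply is_derC_RtoC.
        instantiate (1 := 1). auto_derive; [easy | ring].
      + cbv beta. ring.
    - intros u Hu. rewrite Rmin_left, Rmax_right in Hu by lra.
      apply contC_mult; [|apply Hddg; lra]. apply contC_RtoC.
      apply (@ex_derive_continuous R_AbsRing R_NormedModule). now auto_derive. }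
  eapply is_intC_eq; [exact (@is_RInt_Chasles C_R_NormedModule _ _ _ _ _ _ H1 H2)|].
  change (plus ?a ?b) with (Cplus a b). rewrite Rminus_diag. ring.
Qed.

(** [S1] plays the part of the second periodic Bernoulli function, up to sign and scale. No hinge
    has opened at 1, so the boundary terms there involve only the quadratic part: its value
    [be + al - m / 2] and its slope [al - m]. At [X] the coefficient of [g] is the slope of [S1]
    with all [N] hinges open. *)
Lemma euler_maclaurin (f : nat -> C) (m al be : C) (S1 g dg ddg : R -> C) (N : nat) (X : R) (G : C) :
  (forall u, u <= INR N + 1 ->
      S1 u = (hinge_sum f N u + (- (m / 2) * RtoC (u ^ 2) + al * RtoC u + be))%C) ->
  1 <= X -> INR N <= X <= INR N + 1 ->
  (forall u, 1 <= u <= X -> is_derC g u (dg u)) ->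
  (forall u, 1 <= u <= X -> is_derC dg u (ddg u)) ->
  (forall u, 1 <= u <= X -> contC ddg u) ->
  is_intC g 1 X G ->
  is_intC (fun u => S1 u * ddg u)%C 1 X
    (csum (fun i => f (S i) * g (INR (S i)))%C N - m * G
     + S1 X * dg X - (csum (fun i => f (S i)) N + (al - m * X)) * g X
     - (be + al - m / 2) * dg 1%R + (al - m) * g 1%R)%C.
Proof.
  intros HS1 HX HN Hg Hdg Hddg HG.
  assert (Hpos : forall u, Rmin 1 X <= u <= Rmax 1 X -> 1 <= u <= X).
  { intros u Hu. now rewrite Rmin_left, Rmax_right in Hu by lra. }
  set (Q := fun u : R => (- (m / 2) * RtoC (u ^ 2) + al * RtoC u + be)%C).
  set (dQ := fun u : R => (- m * RtoC u + al)%C).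
  assert (HQ : forall u, is_derC Q u (dQ u)).
  { intros u. eapply is_derC_eq.
    - apply is_derC_plus; [apply is_derC_plus|apply is_derC_const];
        apply is_derC_scal, is_derC_RtoC.
      + instantiate (1 := 2 * u). auto_derive; [easy | ring].
      + apply (@is_derive_id R_AbsRing).
    - unfold dQ. change (RtoC one) with (RtoC 1). rewrite RtoC_mult. field. }
  assert (HdQ : forall u, is_derC dQ u (- m)%C).
  { intros u. eapply is_derC_eq.
    - apply is_derC_plus; [|apply is_derC_const].
      apply is_derC_scal, is_derC_RtoC, (@is_derive_id R_AbsRing).
    - change (RtoC one) with (RtoC 1). ring. }
  assert (Hi1 : is_intC (fun u => Q u * ddg u + m * g u)%C 1 X
     ((Q X * dg X - dQ X * g X) - (Q 1%R * dg 1%R - dQ 1%R * g 1%R))%C).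
  { apply (is_intC_derive (fun u => Q u * dg u - dQ u * g u)%C).
    - intros u Hu. apply Hpos in Hu. eapply is_derC_eq.
      + apply is_derC_minus.
        * apply is_derC_mult; [apply HQ | now apply Hdg].
        * apply is_derC_mult; [apply HdQ | now apply Hg].
      + ring.
    - intros u Hu. apply Hpos in Hu. apply contC_plus; apply contC_mult.
      + eapply is_derC_contC, HQ.
      + now apply Hddg.
      + apply contC_const.
      + eapply is_derC_contC. now apply Hg. }
  assert (Hi2 : is_intC (fun u => csum (fun i => f (S i) * (RtoC (Rmax 0 (u - INR (S i))) * ddg u))%C N)
     1 X (csum (fun i => f (S i) * (RtoC (X - INR (S i)) * dg X - g X + g (INR (S i))))%C N)).
  { apply is_intC_csum. intros i Hi. apply is_intC_scal. apply is_intC_hinge; try easy.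
    assert (H1 : INR (S i) <= INR N) by (apply le_INR; lia).
    assert (H2 := pos_INR i). rewrite S_INR in *. lra. }
  eapply is_intC_eq.
  - eapply is_intC_ext; [|exact (is_intC_plus _ _ _ _ _ _ Hi2
      (is_intC_minus _ _ _ _ _ _ Hi1 (is_intC_scal m _ _ _ _ HG)))].
    intros u Hu. rewrite Rmax_right in Hu by lra. rewrite (HS1 u) by lra.
    fold (Q u). cbv beta.
    rewrite (csum_ext _ (fun i => ddg u * (f (S i) * RtoC (Rmax 0 (u - INR (S i)))))%C)
      by (intros; ring).
    rewrite csum_scal. fold (hinge_sum f N u). ring.
  - rewrite (HS1 X) by lra. fold (Q X).
    assert (EH : hinge_sum f N X = csum (fun i => f (S i) * RtoC (X - INR (S i)))%C N).
    { apply csum_ext. intros i Hi. rewrite Rmax_right; [easy|].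
      assert (H1 : INR (S i) <= INR N) by (apply le_INR; lia). lra. }
    rewrite EH.
    rewrite (csum_ext _ (fun i => dg X * (f (S i) * RtoC (X - INR (S i))) +
       ((- g X) * f (S i) + f (S i) * g (INR (S i)))))%C by (intros; ring).
    rewrite csum_plus, csum_plus, !csum_scal. unfold Q, dQ.
    replace (1 ^ 2) with 1 by ring. field.
Qed.

(** * The zeta function *)

Lemma sum_n_m_csum (a : nat -> C) (n : nat) :
  @sum_n_m C_AbelianMonoid a 1 n = csum (fun i => a (S i)) n.
Proof.
  induction n as [|n IH].
  - now rewrite sum_n_m_zero by lia.
  - rewrite sum_n_Sm by lia. now rewrite IH.
Qed.

Lemma sum_n_csum (a : nat -> C) (n : nat) :
  @sum_n C_AbelianMonoid a n = csum a (S n).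
Proof.
  induction n as [|n IH].
  - rewrite sum_O. simpl. ring.
  - rewrite sum_Sn, IH. easy.
Qed.

Definition zeta_step (r : R) (z : C) (n : nat) (x : R) : C :=
  if Rlt_dec (INR n) x then (theta_phase r n / RCpow (INR n) z)%C else RtoC 0.

(** The range of summation moves with [x]; a fixed [N] allows termwise integration over a whole
    interval. *)
Lemma zeta_partial_csum (r : R) (z : C) (N : nat) (x : R) :
  x <= INR N + 1 -> zeta_partial r z x = csum (fun i => zeta_step r z (S i) x) N.
Proof.
  intros Hx. unfold zeta_partial. rewrite sum_n_m_csum.
  fold (zeta_step r z).
  set (N' := Z.to_nat (up x)). assert (H' := INR_up_ge x). fold N' in H'.
  assert (Hz : forall n i, x <= INR n + 1 -> (n <= i)%nat -> zeta_step r z (S i) x = 0).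
  { intros n i Hn Hi. unfold zeta_step. destruct (Rlt_dec (INR (S i)) x) as [H|]; [|easy].
    rewrite S_INR in H. apply le_INR in Hi. lra. }
  transitivity (csum (fun i => zeta_step r z (S i) x) (Nat.max N N')).
  - symmetry. apply csum_extend; [lia|]. intros i Hi. apply (Hz N'); [lra | easy].
  - apply csum_extend; [lia|]. intros i Hi. now apply (Hz N).
Qed.

Lemma is_derC_pow_primitive (x : R) (j : nat) (u : R) :
  is_derC (fun t => RtoC (- / INR (S j) * (x - t) ^ S j)) u (RtoC ((x - u) ^ j)).
Proof.
  apply is_derC_RtoC.
  assert (Hj : INR (S j) <> 0) by now apply not_0_INR.
  assert (H : is_derive (fun t : R => (x - t) ^ S j) u (INR (S j) * -1 * (x - u) ^ j)).
  { apply (is_derive_pow (fun t => x - t) (S j)). auto_derive; [easy | ring]. }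
  apply (is_derive_scal _ _ (- / INR (S j))) in H.
  replace ((x - u) ^ j) with (- / INR (S j) * (INR (S j) * -1 * (x - u) ^ j)) by (field; easy).
  exact H.
Qed.

Lemma is_intC_zeta_step (r : R) (z : C) (n j : nat) (x : R) :
  (1 <= n)%nat -> INR n <= x ->
  is_intC (fun u => RtoC ((x - u) ^ j) * zeta_step r z n u)%C 1 x
    (theta_phase r n * (RtoC (/ INR (S j)) * kern x (S j) z (INR n)))%C.
Proof.
  intros Hn Hx. assert (H1 : 1 <= INR n) by (now apply (le_INR 1)).
  set (a := (theta_phase r n / RCpow (INR n) z)%C).
  assert (I1 : is_intC (fun u => RtoC ((x - u) ^ j) * zeta_step r z n u)%C 1 (INR n) (RtoC 0)).
  { eapply is_intC_ext; [|eapply is_intC_eq; [apply (is_intC_const 0)|]].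
    - intros u Hu. rewrite Rmax_right in Hu by lra. unfold zeta_step.
      destruct (Rlt_dec (INR n) u); [lra|]. ring.
    - ring. }
  assert (I2 : is_intC (fun u => a * RtoC ((x - u) ^ j))%C (INR n) x
     (a * (RtoC (- / INR (S j) * (x - x) ^ S j) - RtoC (- / INR (S j) * (x - INR n) ^ S j)))%C).
  { apply is_intC_scal.
    apply (is_intC_derive (fun u => RtoC (- / INR (S j) * (x - u) ^ S j))
              (fun u => RtoC ((x - u) ^ j))).
    - intros u _. apply is_derC_pow_primitive.
    - intros u _. apply contC_RtoC.
      apply (@ex_derive_continuous R_AbsRing R_NormedModule). now auto_derive. }
  assert (I3 : is_intC (fun u => RtoC ((x - u) ^ j) * zeta_step r z n u)%C (INR n) x
     (a * (RtoC (- / INR (S j) * (x - x) ^ S j) - RtoC (- / INR (S j) * (x - INR n) ^ S j)))%C).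
  { eapply is_intC_ext; [|exact I2].
    intros u Hu. rewrite Rmin_left in Hu by lra. unfold zeta_step.
    destruct (Rlt_dec (INR n) u); [|lra]. apply Cmult_comm. }
  eapply is_intC_eq; [exact (@is_RInt_Chasles C_R_NormedModule _ _ _ _ _ _ I1 I3)|].
  change (plus ?a ?b) with (Cplus a b).
  rewrite Rminus_diag, pow_i by lia. unfold a, kern. rewrite RCpow_opp.
  rewrite Rmult_0_r, !RtoC_mult, RtoC_opp. unfold Cdiv. ring.
Qed.

Lemma is_intC_RCpow_inv (z : C) (x : R) :
  0 < x -> is_intC (fun xi => / RCpow xi z)%C 1 x (CRInt (fun xi => / RCpow xi z)%C 1 x).
Proof.
  intros Hx. apply is_intC_cont. intros u Hu.
  assert (0 < u).
  { unfold Rmin in Hu. destruct (Rle_dec 1 x); lra. }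
  apply (contC_ext_loc (fun t => RCpow t (- z))).
  - apply filter_forall. intros t. apply RCpow_opp.
  - now apply contC_RCpow.
Qed.

Lemma is_intC_power_integral (z : C) (j : nat) (x : R) :
  1 <= x ->
  is_intC (fun u => RtoC ((x - u) ^ j) * CRInt (fun xi => / RCpow xi z)%C 1 u)%C 1 x
    (RtoC (/ INR (S j)) * CRInt (kern x (S j) z) 1 x)%C.
Proof.
  intros Hx.
  set (P := fun u => CRInt (fun xi => / RCpow xi z)%C 1 u).
  assert (Hpos : forall u, Rmin 1 x <= u <= Rmax 1 x -> 0 < u).
  { intros u Hu. rewrite Rmin_left in Hu by lra. lra. }
  assert (HP : forall u, 0 < u -> is_derC P u (RCpow u (- z))).
  { intros u Hu. rewrite RCpow_opp.
    apply (@is_derive_RInt C_R_NormedModule (fun xi => / RCpow xi z)%C P 1 u).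
    - exists (mkposreal u Hu). intros t Ht. apply is_intC_RCpow_inv.
      apply Rabs_def2 in Ht. unfold minus, plus, opp in Ht. simpl in Ht. lra.
    - apply (contC_ext_loc (fun t => RCpow t (- z))).
      + apply filter_forall. intros t. apply RCpow_opp.
      + now apply contC_RCpow. }
  assert (HK : is_intC (kern x (S j) z) 1 x (CRInt (kern x (S j) z) 1 x)).
  { apply is_intC_cont. intros u Hu. apply contC_kern. now apply Hpos. }
  eapply is_intC_eq.
  - apply (is_intC_by_parts (fun u => RtoC (- / INR (S j) * (x - u) ^ S j))
       (fun u => RtoC ((x - u) ^ j)) P (fun u => RCpow u (- z))).
    + intros u _. apply is_derC_pow_primitive.
    + intros u Hu. apply HP. now apply Hpos.
    + intros u _. apply contC_RtoC.
      apply (@ex_derive_continuous R_AbsRing R_NormedModule). now auto_derive.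
    + intros u Hu. apply contC_RCpow. now apply Hpos.
    + eapply is_intC_ext; [|exact (is_intC_scal (RtoC (- / INR (S j))) _ _ _ _ HK)].
      intros u _. unfold kern. cbv beta. rewrite (RtoC_mult (- / INR (S j))). ring.
  - rewrite Rminus_diag, pow_i, Rmult_0_r by lia.
    replace (P 1) with (RtoC 0).
    + rewrite RtoC_opp. ring.
    + symmetry. apply is_intC_CRInt. apply (@is_RInt_point C_R_NormedModule).
Qed.

Definition zeta_remainder (r : R) (z : C) (x : R) : C :=
  (zeta_partial r z x - theta_p r * CRInt (fun xi => / RCpow xi z) 1 x)%C.

(** The classical passage from Cesàro means of partial sums to Riesz means of the terms: integrating
    the weight raises its order by one, each jump at [n] yields its weight [(x - n)^(j + 1)], and
    the integral is treated by parts in the same way. *)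
Lemma is_intC_zeta_remainder (r : R) (z : C) (j N : nat) (x : R) :
  1 <= x -> INR N <= x <= INR N + 1 ->
  is_intC (fun u => RtoC ((x - u) ^ j) * zeta_remainder r z u)%C 1 x
    (RtoC (/ INR (S j)) *
      (csum (fun i => theta_phase r (S i) * kern x (S j) z (INR (S i)))%C N
       - theta_p r * CRInt (kern x (S j) z) 1 x))%C.
Proof.
  intros Hx HN.
  assert (I1 : is_intC (fun u => csum (fun i => RtoC ((x - u) ^ j) * zeta_step r z (S i) u)%C N) 1 x
     (csum (fun i => theta_phase r (S i) * (RtoC (/ INR (S j)) * kern x (S j) z (INR (S i))))%C N)).
  { apply is_intC_csum. intros i Hi. apply is_intC_zeta_step; [lia|].
    apply Rle_trans with (INR N); [apply le_INR; lia | lra]. }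
  assert (I2 := is_intC_scal (theta_p r) _ _ _ _ (is_intC_power_integral z j x Hx)).
  eapply is_intC_eq.
  - eapply is_intC_ext; [|exact (is_intC_minus _ _ _ _ _ _ I1 I2)].
    intros u Hu. rewrite Rmax_right in Hu by lra. unfold zeta_remainder. cbv beta.
    rewrite csum_scal, (zeta_partial_csum r z N u) by lra. ring.
  - rewrite (csum_ext _ (fun i => RtoC (/ INR (S j)) *
      (theta_phase r (S i) * kern x (S j) z (INR (S i))))%C) by (intros; ring).
    rewrite csum_scal. ring.
Qed.

Lemma nat_ge_bound (y : R) : exists M : nat, y <= INR M.
Proof. exists (Z.to_nat (up y)). apply INR_up_ge. Qed.

Lemma limC_RCpow_neg (w : C) :
  Re w < 0 -> limC (Rbar_locally p_infty) (fun x => RCpow x w) 0.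
Proof.
  intros Hw eps He. exists (exp (ln eps / Re w)). intros x Hx.
  assert (Hp := exp_pos (ln eps / Re w)).
  replace (RCpow x w - 0)%C with (RCpow x w) by ring. rewrite Cmod_RCpow.
  apply Rlt_le_trans with (exp (ln eps)); [apply exp_increasing | rewrite exp_ln; lra].
  apply ln_increasing in Hx; [|easy]. rewrite ln_exp in Hx.
  replace (ln eps) with (Re w * (ln eps / Re w)) by (field; lra). nra.
Qed.

Lemma limC_mult_bounded {T : Type} (F : (T -> Prop) -> Prop) {FF : Filter F}
  (f g : T -> C) (B : R) :
  limC F f 0 -> F (fun x => Cmod (g x) <= B) -> limC F (fun x => f x * g x)%C 0.
Proof.
  intros Hf Hg eps He.
  assert (HB : 0 < Rabs B + 1) by (assert (H := Rabs_pos B); lra).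
  eapply filter_imp; [|apply (filter_and (F := F) _ _ Hg
    (Hf (eps / (Rabs B + 1)) ltac:(now apply Rdiv_lt_0_compat)))].
  intros x [H1 H2]. simpl in H2.
  replace (f x - 0)%C with (f x) in H2 by ring.
  replace (f x * g x - 0)%C with (f x * g x)%C by ring. rewrite Cmod_mult.
  assert (H3 := Rle_abs B). assert (H4 := Cmod_ge_0 (f x)).
  apply Rle_lt_trans with (Cmod (f x) * (Rabs B + 1)).
  - apply Rmult_le_compat_l; lra.
  - apply Rlt_div_r in H2; lra.
Qed.

Lemma is_intC_power (z : C) (x : R) :
  1 <= x -> z <> RtoC 1 ->
  is_intC (kern x 0 z) 1 x ((1 - RCpow x (1 - z)) / (z - 1))%C.
Proof.
  intros Hx Hz.
  assert (Hz1 : (1 - z)%C <> 0).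
  { intros E. apply Hz. replace z with (1 - (1 - z))%C by ring. rewrite E. ring. }
  assert (Hz2 : (z - 1)%C <> 0).
  { intros E. apply Hz1. replace (1 - z)%C with (- (z - 1))%C by ring. rewrite E. ring. }
  assert (H : is_intC (fun u => (1 - z) * RCpow u (1 - z - 1))%C 1 x
                (RCpow x (1 - z) - RCpow 1 (1 - z))%C).
  { apply (is_intC_derive (fun u => RCpow u (1 - z))); intros u Hu;
      rewrite Rmin_left in Hu by lra.
    - apply is_derC_RCpow. lra.
    - apply contC_mult; [apply contC_const | apply contC_RCpow; lra]. }
  apply (is_intC_scal (/ (1 - z))%C) in H.
  eapply is_intC_eq.
  - eapply is_intC_ext; [|exact H]. intros u _. unfold kern.
    rewrite pow_O. replace (1 - z - 1)%C with (- z)%C by ring. field. exact Hz1.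
  - rewrite RCpow_1_l. field. now split.
Qed.

(** The second-order remainder is [h^2 / (z^2 (z + h))], and [|z + h| >= |z| / 2] for small [h]. *)
Lemma ex_derive_CC_inv (z : C) : z <> 0 -> ex_derive_CC Cinv z.
Proof.
  intros Hz. assert (Hm := proj1 (Cmod_gt_0 z) Hz).
  assert (H3 : 0 < Cmod z * Cmod z * (Cmod z / 2)) by (repeat apply Rmult_lt_0_compat; lra).
  apply (ex_derive_CC_quadratic Cinv z (- / (z * z))%C (/ (Cmod z * Cmod z * (Cmod z / 2)))
    (Cmod z / 2)); [lra | left; now apply Rinv_0_lt_compat|].
  intros h Hh.
  assert (Hzh : Cmod z / 2 <= Cmod (z + h)).
  { assert (H := Cmod_triangle_sub (z + h) h).
    replace (z + h - h)%C with z in H by ring. lra. }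
  assert (Hzh0 : (z + h)%C <> 0) by (apply Cmod_gt_0; lra).
  replace (/ (z + h) - / z - h * - / (z * z))%C with (/ (z * z * (z + h)) * (h * h))%C
    by (field; now split).
  assert (Hne : (z * z * (z + h))%C <> 0) by (repeat apply Cmult_neq_0; easy).
  rewrite Cmod_mult, Cmod_inv, !Cmod_mult by easy.
  replace (Cmod h ^ 2) with (Cmod h * Cmod h) by ring.
  assert (Hh0 := Cmod_ge_0 h).
  apply Rmult_le_compat_r; [nra|]. apply Rinv_le_contravar; [easy|].
  apply Rmult_le_compat_l; nra.
Qed.

(** Euler-Maclaurin summation is used with two test functions, [(x - u)^k u^(-z)] for the Cesàro
    means and [u^(-z)] for the series in [Re z > 1]. Both leave the same boundary terms at 1 and the
    same regularised integral, so one [A] serves for both. *)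
Lemma zeta_regularization (r : R) :
  S0 r ->
  exists A : C -> C, entire A /\
    (forall z, is_cesaro_lim (zeta_remainder r z) (A z)) /\
    (forall z, 1 < Re z ->
       limC eventually (csum (zeta_term r z)) (A z + theta_p r / (z - 1))%C).
Proof.
  intros Hr. destruct (theta_p_mean r Hr) as (q & [Hq Hper] & Hmean).
  set (m := theta_p r) in *. symmetry in Hmean.
  destruct (second_primitive_exists (theta_phase r) q m Hq Hper Hmean)
    as (S1 & al & be & HS & HS1).
  set (Q1 := (be + al - m / 2)%C). set (dQ1 := (al - m)%C).
  assert (Hre : forall (z : C) (t : R), Re (z + t) = Re z + t) by now intros [].
  (* For [g u = u^(-z)] one has [g 1 = 1], [g' 1 = - z] and [g'' u = z (z + 1) u^(-z-2)]. *)
  exists (fun z => - z * Q1 - dQ1 + z * (z + 1) * reg_int S1 (z + 2))%C.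
  split; [|split].
  - intros z _. destruct (nat_ge_bound (2 - Re z)) as [M HM].
    destruct (reg_int_spec q M Hq S1 (z + 2)%C HS) as [_ Hd]; [rewrite Hre; lra|].
    apply ex_derive_CC_plus.
    + apply ex_derive_CC_plus; [|apply ex_derive_CC_const].
      apply (@ex_derive_ext C_AbsRing C_NormedModule (fun z => z * (- Q1))%C).
      { intros t. change (@eq C (t * - Q1)%C (- t * Q1)%C). ring. }
      apply ex_derive_CC_mult; [apply ex_derive_CC_id | apply ex_derive_CC_const].
    + apply ex_derive_CC_mult.
      * apply ex_derive_CC_mult; [apply ex_derive_CC_id|].
        apply ex_derive_CC_plus; [apply ex_derive_CC_id | apply ex_derive_CC_const].
      * now apply (ex_derive_CC_shift (reg_int S1) 2 z).
  - intros z. split.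
    + intros x Hx. destruct (nfloor_ex x) as [N HN]; [lra|].
      eexists. eapply is_intC_ext; [|apply (is_intC_zeta_remainder r z 0 N x); lra].
      intros u _. cbv beta. rewrite pow_O. ring.
    + destruct (nat_ge_bound (2 - Re z)) as [M HM].
      (* Differentiating the weight twice lowers its power from [k] to [M = k - 2]. Order [M + 2]
         makes the two lower integrals negligible against [x^k] and leaves positive powers of
         [x - u] in the boundary terms at [x]. *)
      exists (S (S M)). split; [lia|]. apply limC_filterlim; [apply _|].
      set (k := S (S M)).
      assert (Hc := mzp_cont _ _ HS).
      assert (L1 := riesz_int_small q M M k S1 z Hq HS ltac:(lra) ltac:(unfold k; lia) ltac:(unfold k; lia)).
      assert (L2 := riesz_int_small q M (S M) k S1 (z + 1)%C Hq HS
        ltac:(rewrite Hre; lra) ltac:(unfold k; lia) ltac:(unfold k; lia)).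
      assert (L3 := proj1 (reg_int_spec q M Hq S1 (z + 2)%C HS ltac:(rewrite Hre; lra)) k
         ltac:(unfold k; lia)).
      assert (L4 := limC_one_minus_inv_pow k).
      (* The part of [dg 1] in which the derivative fell on the weight; it is of order [k - 1] and
         disappears. *)
      assert (L5 : limC (Rbar_locally p_infty)
                     (fun x => RtoC (INR k) * RtoC ((x - 1) ^ S M / x ^ k))%C 0).
      { apply (limC_div_infty _ _ (INR k)). intros x Hx.
        match goal with |- Cmod (?a - _) <= _ => replace (a - 0)%C with a by ring end.
        assert (Hk := pos_INR k).
        rewrite Cmod_mult, !Cmod_R, (Rabs_pos_eq (INR k)) by easy.
        unfold Rdiv at 2. apply Rmult_le_compat_l; [easy|].
        assert (Hxk : 0 < x ^ S M) by (apply pow_lt; lra).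
        assert (H1 : 0 <= (x - 1) ^ S M <= x ^ S M).
        { split; [apply pow_le; lra | apply pow_incr; lra]. }
        replace ((x - 1) ^ S M / x ^ k) with ((x - 1) ^ S M / x ^ S M * / x).
        2:{ unfold k. change (x ^ S (S M)) with (x * x ^ S M). field. lra. }
        assert (Hix : 0 < / x) by (apply Rinv_0_lt_compat; lra).
        assert (H2 : 0 <= (x - 1) ^ S M / x ^ S M <= 1).
        { split; [now apply Rdiv_le_0_compat | apply Rle_div_l; lra]. }
        rewrite Rabs_pos_eq; [|apply Rmult_le_pos; lra].
        rewrite <- (Rmult_1_l (/ x)) at 2. apply Rmult_le_compat_r; lra. }
      assert (L := limC_plus (Rbar_locally p_infty) _ _ _ _
        (limC_plus (Rbar_locally p_infty) _ _ _ _
          (limC_scal (Rbar_locally p_infty) (INR k * INR (S M))%C _ _ L1)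
          (limC_plus (Rbar_locally p_infty) _ _ _ _
            (limC_scal (Rbar_locally p_infty) (2 * INR k * z)%C _ _ L2)
            (limC_scal (Rbar_locally p_infty) (z * (z + 1))%C _ _ L3)))
        (limC_plus (Rbar_locally p_infty) _ _ _ _
          (limC_scal (Rbar_locally p_infty) (- z * Q1 - dQ1)%C _ _ L4)
          (limC_scal (Rbar_locally p_infty) (- Q1)%C _ _ L5))).
      refine (limC_eq _ _ _ _ (limC_ext_loc (Rbar_locally p_infty) _ _ _ _ L) _); [|ring].
      exists 1. intros x Hx. destruct (nfloor_ex x) as [N HN]; [lra|].
      assert (Hx1 : 1 <= x) by lra.
      set (g := kern x k z).
      set (dg := fun u => (- INR k * kern x (S M) z u - z * kern x k (z + 1) u)%C).
      set (ddg := fun u => (INR k * INR (S M) * kern x M z u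
          + (2 * INR k * z * kern x (S M) (z + 1) u + z * (z + 1) * kern x k (z + 2) u))%C).
      assert (HG : is_intC g 1 x (CRInt g 1 x)).
      { apply is_intC_cont. intros u Hu. rewrite Rmin_left in Hu by lra.
        apply contC_kern. lra. }
      assert (HE := euler_maclaurin (theta_phase r) m al be S1 g dg ddg N x (CRInt g 1 x) (HS1 N)
        Hx1 ltac:(lra)).
      assert (HE' := HE (fun u Hu => is_derC_kern x k z u ltac:(lra))). clear HE.
      assert (Hddg : forall u, 1 <= u <= x -> is_derC dg u (ddg u)).
      { intros u Hu. eapply is_derC_eq.
        - apply is_derC_minus; apply is_derC_scal; apply is_derC_kern; lra.
        - unfold ddg. change (Init.Nat.pred (S M)) with M. change (Init.Nat.pred k) with (S M).
          replace (z + 1 + 1)%C with (z + 2)%C by (rewrite <- Cplus_assoc; f_equal; apply C_ext; simpl; ring).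
          ring. }
      specialize (HE' Hddg).
      assert (Hcdd : forall u, 1 <= u <= x -> contC ddg u).
      { intros u Hu. apply contC_plus; [|apply contC_plus];
          (apply contC_mult; [apply contC_const | apply contC_kern; lra]). }
      specialize (HE' Hcdd HG).
      assert (HR : is_intC (fun u => S1 u * ddg u)%C 1 x
         (INR k * INR (S M) * riesz_int M z S1 x
          + (2 * INR k * z * riesz_int (S M) (z + 1) S1 x
             + z * (z + 1) * riesz_int k (z + 2) S1 x))%C).
      { eapply is_intC_ext; [|apply is_intC_plus; [|apply is_intC_plus]; apply is_intC_scal;
          apply is_intC_riesz_int; easy].
        intros u _. unfold ddg. cbv beta. ring. }
      assert (E := eq_trans (eq_sym (is_intC_CRInt _ _ _ _ HR)) (is_intC_CRInt _ _ _ _ HE')).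
      (* The weight vanishes to order [k >= 2] at the upper limit, so both boundary terms there are
         zero. *)
      assert (Egx : g x = 0) by (unfold g, kern; rewrite Rminus_diag, pow_i by (unfold k; lia); ring).
      assert (Edgx : dg x = 0).
      { unfold dg, kern. rewrite Rminus_diag, !pow_i by (unfold k; lia). ring. }
      assert (Eg1 : g 1 = RtoC ((x - 1) ^ k)) by (unfold g, kern; rewrite RCpow_1_l; ring).
      assert (Edg1 : dg 1 = (- INR k * RtoC ((x - 1) ^ S M) - z * RtoC ((x - 1) ^ k))%C)
        by (unfold dg, kern; rewrite !RCpow_1_l; ring).
      rewrite Egx, Edgx, Eg1, Edg1 in E.
      assert (HZ := is_intC_CRInt _ _ _ _ (is_intC_zeta_remainder r z (S M) N x Hx1 ltac:(lra))).
      change (S (S M)) with k in HZ. fold g in HZ. fold m in HZ.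
      replace (k - 1)%nat with (S M) by (unfold k; lia).
      rewrite HZ.
      replace (csum (fun i => theta_phase r (S i) * g (INR (S i)))%C N - m * CRInt g 1 x)%C
        with (INR k * INR (S M) * riesz_int M z S1 x
          + (2 * INR k * z * riesz_int (S M) (z + 1) S1 x
             + z * (z + 1) * riesz_int k (z + 2) S1 x)
          + Q1 * (- INR k * RtoC ((x - 1) ^ S M) - z * RtoC ((x - 1) ^ k))
          - dQ1 * RtoC ((x - 1) ^ k))%C by (rewrite E; unfold Q1, dQ1; ring).
      assert (Hk0 : RtoC (INR k) <> 0) by (apply RtoC_neq_0, not_0_INR; unfold k; lia).
      assert (Hxk : RtoC (x ^ k) <> 0) by (apply RtoC_neq_0, pow_nonzero; lra).
      unfold riesz_mean. unfold Rdiv. rewrite !RtoC_mult.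
      rewrite !RtoC_inv. 2: (apply not_0_INR; unfold k; lia). 2: (apply pow_nonzero; lra).
      field. now split.
  - intros z Hz.
    assert (Hz1 : z <> RtoC 1) by (intros ->; simpl in Hz; lra).
    assert (Hz2 : (z - 1)%C <> 0).
    { intros E. apply Hz1. replace z with (z - 1 + 1)%C by ring. rewrite E. ring. }
    destruct (mean_zero_periodic_bounded q S1 Hq HS) as (B & HB0 & HB).
    assert (Hnat : filterlim INR eventually (Rbar_locally p_infty)).
    { apply (filterlim_ext (fun n => 1 * INR n + 0)); [intros; ring|].
      apply filterlim_affine_nat. lra. }
    assert (Hc := mzp_cont _ _ HS).
    assert (L1 : limC eventually (fun N => riesz_int 0 (z + 2) S1 (INR N)) (reg_int S1 (z + 2))).
    { assert (H := limC_comp _ _ _ _ _ Hnat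
        (riesz_lim_3 q S1 (z + 2)%C Hq HS ltac:(rewrite Hre; lra) 0)).
      revert H. apply limC_ext_loc; [apply _|]. exists 0%nat. intros N _. apply riesz_mean_0. }
    assert (L2 : limC eventually (fun N => RCpow (INR N) (1 - z)) 0).
    { apply (limC_comp _ _ _ _ _ Hnat (limC_RCpow_neg (1 - z) ltac:(destruct z; simpl in *; lra))). }
    assert (L3 : limC eventually (fun N => RCpow (INR N) (- (z + 1)) * S1 (INR N))%C 0).
    { apply (limC_mult_bounded _ _ _ B).
      - apply (limC_comp _ _ _ _ _ Hnat (limC_RCpow_neg (- (z + 1)) ltac:(destruct z; simpl in *; lra))).
      - exists 0%nat. intros N _. apply HB, pos_INR. }
    (* The trivial bound [N] for the exponential sum is enough here: divided by [N] it is bounded,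
       and [N^(1 - z)] tends to 0. *)
    assert (L4 : limC eventually (fun N => RCpow (INR N) (1 - z) *
       (RtoC (/ INR N) * (csum (fun i => theta_phase r (S i)) N + (al - m * INR N))))%C 0).
    { apply (limC_mult_bounded _ _ _ (1 + (Cmod al + Cmod m)) L2).
      exists 1%nat. intros N HN. assert (HN1 : 1 <= INR N) by now apply (le_INR 1).
      assert (Hi : 0 < / INR N) by (apply Rinv_0_lt_compat; lra).
      rewrite Cmod_mult, Cmod_R, Rabs_pos_eq by lra.
      assert (H1 : Cmod (csum (fun i => theta_phase r (S i)) N) <= INR N * 1).
      { apply Cmod_csum. intros i _. rewrite Cmod_theta_phase. lra. }
      assert (H2 : Cmod (al - m * INR N) <= Cmod al + Cmod m * INR N).
      { eapply Rle_trans; [apply Cmod_triangle_sub|]. rewrite Cmod_mult, Cmod_R, Rabs_pos_eq; lra. }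
      assert (H3 := Cmod_triangle (csum (fun i => theta_phase r (S i)) N) (al - m * INR N)).
      assert (H4 := Cmod_ge_0 al).
      apply Rle_trans with (/ INR N * (INR N * (1 + (Cmod al + Cmod m)))).
      - apply Rmult_le_compat_l; [lra|]. nra.
      - right. field. lra. }
    assert (L := limC_plus eventually _ _ _ _
      (limC_plus eventually _ _ _ _
        (limC_scal eventually (z * (z + 1))%C _ _ L1)
        (limC_plus eventually _ _ _ _ (limC_scal eventually z _ _ L3) L4))
      (limC_plus eventually _ _ _ _
        (limC_const eventually (- z * Q1 - dQ1 + m / (z - 1))%C)
        (limC_scal eventually (- (m / (z - 1)))%C _ _ L2))).
    refine (limC_eq _ _ _ _ (limC_ext_loc eventually _ _ _ _ L) _); [|ring].
    exists 1%nat. intros N HN. assert (HN1 : 1 <= INR N) by now apply (le_INR 1).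
    set (x := INR N) in *.
    set (g := kern x 0 z).
    set (dg := fun u => (- z * kern x 0 (z + 1) u)%C).
    set (ddg := fun u => (z * (z + 1) * kern x 0 (z + 2) u)%C).
    assert (HG := is_intC_power z x HN1 Hz1).
    assert (Hkd : forall w u, 1 <= u <= x -> is_derC (kern x 0 w) u (- w * kern x 0 (w + 1) u)%C).
    { intros w u Hu. eapply is_derC_eq; [apply is_derC_kern; lra|]. simpl. ring. }
    assert (HE := euler_maclaurin (theta_phase r) m al be S1 g dg ddg N x
        ((1 - RCpow x (1 - z)) / (z - 1))%C (HS1 N)
        HN1 ltac:(unfold x; lra) (Hkd z)).
    assert (Hddg : forall u, 1 <= u <= x -> is_derC dg u (ddg u)).
    { intros u Hu. eapply is_derC_eq.
      - apply is_derC_scal, Hkd, Hu.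
      - unfold ddg.
        replace (z + 1 + 1)%C with (z + 2)%C by (rewrite <- Cplus_assoc; f_equal; apply C_ext; simpl; ring).
        ring. }
    assert (Hcdd : forall u, 1 <= u <= x -> contC ddg u).
    { intros u Hu. apply contC_mult; [apply contC_const | apply contC_kern; lra]. }
    specialize (HE Hddg Hcdd HG).
    assert (HR : is_intC (fun u => S1 u * ddg u)%C 1 x (z * (z + 1) * riesz_int 0 (z + 2) S1 x)%C).
    { eapply is_intC_ext; [|apply is_intC_scal; apply is_intC_riesz_int; easy].
      intros u _. unfold ddg. cbv beta. ring. }
    assert (E := eq_trans (eq_sym (is_intC_CRInt _ _ _ _ HR)) (is_intC_CRInt _ _ _ _ HE)).
    assert (Ek : forall w u, kern x 0 w u = RCpow u (- w)).
    { intros w u. unfold kern. rewrite pow_O. ring. }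
    rewrite (csum_ext (zeta_term r z) (fun i => theta_phase r (S i) * g (INR (S i)))%C).
    2:{ intros i _. unfold zeta_term, g. now rewrite Ek. }
    unfold g, dg in E. rewrite !Ek, !RCpow_1_l in E.
    rewrite E. fold g.
    replace (RCpow x (1 - z)) with (RCpow x (- z) * x)%C.
    2:{ replace (1 - z)%C with (- z + 1)%C by ring. rewrite RCpow_plus, RCpow_1_r by lra. easy. }
    assert (Hx0 : RtoC x <> 0) by (apply RtoC_neq_0; lra).
    unfold Q1, dQ1. rewrite RtoC_inv by lra. field. now split.
Qed.

Theorem proposition8p21 :
  (forall r : R,
     S0 r <->
     ((exists nu j : Z, j <> 0%Z /\ r = IZR (2 * nu + 1) / IZR (2 * j)) \/
      (exists nu j : Z, r = IZR (2 * j) / IZR (2 * nu + 1)))) /\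
  (forall r : R, S0 r ->
     exists zeta : C -> C,
       (forall z : C, 1 < Re z ->
          @is_series C_AbsRing C_NormedModule (zeta_term r z) (zeta z)) /\
       holomorphic_on (fun z => z <> RtoC 1) zeta /\
       simple_pole_with_residue zeta (RtoC 1) (theta_p r) /\
       exists A : C -> C,
         entire A /\
         (forall z : C, z <> RtoC 1 ->
            A z = (zeta z - theta_p r / (z - RtoC 1))%C) /\
         (forall z : C,
            is_cesaro_lim
              (fun x : R =>
                 (zeta_partial r z x
                  - theta_p r * CRInt (fun xi => / RCpow xi z) 1 x)%C)
              (A z))).
Proof.
  split.
  { intros r. rewrite S0_iff_parity_rational. apply parity_rational_iff. }
  intros r Hr. destruct (zeta_regularization r Hr) as (A & HA & Hces & Hser).
  exists (fun z => A z + theta_p r / (z - 1))%C. split; [|split; [|split]].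
  - intros z Hz.
    (* The partial sum [sum_n] up to index [n] has [n + 1] terms. *)
    assert (H : limC eventually (fun n => csum (zeta_term r z) (S n)) (A z + theta_p r / (z - 1))%C).
    { apply (limC_comp eventually eventually (csum (zeta_term r z)) S); [|now apply Hser].
      intros P [N HN]. exists N. intros n Hn. apply HN. lia. }
    unfold is_series. apply (filterlim_ext (fun n => csum (zeta_term r z) (S n))).
    { intros n. symmetry. apply sum_n_csum. }
    exact (limC_filterlim eventually _ _ H).
  - intros z Hz.
    apply ex_derive_CC_plus; [now apply HA|].
    apply ex_derive_CC_mult; [apply ex_derive_CC_const|].
    apply (ex_derive_CC_shift Cinv (Copp 1) z). apply ex_derive_CC_inv.
    intros E. apply Hz. replace z with (z + Copp 1 + 1)%C by ring. rewrite E. ring.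
  - split.
    + apply (theta_equations_neq_0 theta_p theta_p_equations r Hr).
    (* Being entire, [A] is the regular part of the Laurent expansion on every neighbourhood of
       1. *)
    + exists A. apply filter_forall. intros z. split; [now apply HA|].
      intros _. apply Cplus_comm.
  - exists A. split; [easy|]. split; [|exact Hces].
    intros z _. ring.
Qed.
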